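(* Let $q\geq5$ be odd, $A=\mathbb{F}_q[T]$, $F=\mathbb{F}_q(T)$. Let $\eta\in\mathbb{F}_q^\times$ be a non-square and let $a_1,a_2$ be distinct elements of $\mathbb{F}_q^\times$. Let $(g_1,g_2)\in A^2$ with $g_2\neq0$ be such that (1) $g_1$ is divisible by $T-a_1$; (2) $g_1$ is coprime to $T(T-a_2)$; (3) $g_2$ is divisible by $T-a_2$ but not by $(T-a_2)^2$; (4) $g_2\equiv -a_1\eta^{-1}\pmod{T-a_1}$; (5) $g_2$ is coprime to $T$. Let $\phi$ be the rank $2$ Drinfeld module with $\phi_T=T+g_1\tau+g_2\tau^2$. Then the $T$-adic Galois representation $\rho=\hat\rho_{\phi,(T)}:\operatorname{Gal}(F^{\mathrm{sep}}/F)\to\operatorname{GL}_2(A_{(T)})$ is surjective.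
   Context: $\phi:A\to F\{\tau\}$ is the $\mathbb{F}_q$-algebra homomorphism into the twisted polynomial ring ($\tau c=c^q\tau$) determined by $\phi_T$. With $\mathfrak p=(T)$, $A_{\mathfrak p}=\mathbb{F}_q[[T]]$, $\phi[\mathfrak p^n]$ is the set of roots in $F^{\mathrm{sep}}$ of the $\mathbb{F}_q$-linear polynomial $\phi_{T^n}(x)$ (an $A$-module via $b\ast\alpha=\phi_b(\alpha)$, isomorphic to $(A/\mathfrak p^n)^2$), $T_{\mathfrak p}(\phi)=\varprojlim_n\phi[\mathfrak p^n]\cong A_{\mathfrak p}^2$, and $\rho$ is the Galois action on $T_{\mathfrak p}(\phi)$ with respect to an $A_{\mathfrak p}$-basis. *)

(* Defs.v *)
From HB Require Import structures.
From mathcomp Require Import all_boot all_order all_algebra all_field.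
From mathcomp Require Import boolp.

Set Implicit Arguments.
Unset Strict Implicit.
Unset Printing Implicit Defensive.

Import GRing.Theory.
Local Open Scope ring_scope.

Section Convolution.
Context {V : nmodType}.

Lemma sum_triangle (G : nat -> nat -> V) n :
  \sum_(i < n) \sum_(j < i.+1) G j (i - j)%N =
  \sum_(j < n) \sum_(l < n - j) G j l.
Proof.
elim: n => [|n IHn]; first by rewrite !big_ord0.
rewrite big_ord_recr /= IHn [RHS]big_ord_recr /= subSnn.
rewrite [X in _ = _ + X]big_ord_recl big_ord0 addr0.
rewrite [X in _ + X = _]big_ord_recr /= subnn addrA; congr (_ + _).
rewrite -big_split /=; apply: eq_bigr => j _.
by rewrite subSn ?(ltnW (ltn_ord j)) // big_ord_recr.
Qed.

Lemma sum_triangle_rect (G : nat -> nat -> V) a b :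
  (forall i j, (a <= i)%N || (b <= j)%N -> G i j = 0) ->
  \sum_(i < a + b) \sum_(j < i.+1) G j (i - j)%N =
  \sum_(j < a) \sum_(l < b) G j l.
Proof.
move=> G0; rewrite sum_triangle big_split_ord /= [X in _ + X]big1 ?addr0.
  apply: eq_bigr => j _; rewrite addnC -addnBA ?(ltnW (ltn_ord j)) //.
  rewrite big_split_ord /= [X in _ + X]big1 ?addr0 // => l _.
  by rewrite G0 // leq_addr orbT.
by move=> j _; apply: big1 => l _; rewrite G0 // leq_addr.
Qed.

End Convolution.

Section Twisted.
Context {R : comNzRingType} (s : {rmorphism R -> R}).
Implicit Types a b c : nat -> R.

Definition conv a b (n : nat) := \sum_(i < n.+1) a i * iter i s (b (n - i)%N).

Lemma eq_conv a a' b b' n : a =1 a' -> b =1 b' -> conv a b n = conv a' b' n.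
Proof. by move=> aa' bb'; apply: eq_bigr => i _; rewrite aa' bb'. Qed.

Lemma iter_rmorphM i : {morph iter i s : x y / x * y}.
Proof. by move=> x y; elim: i => //= i ->; rewrite rmorphM. Qed.
Lemma iter_rmorph_sum i I (r : seq I) P (F : I -> R) :
  iter i s (\sum_(j <- r | P j) F j) = \sum_(j <- r | P j) iter i s (F j).
Proof. by elim: i => //= i ->; rewrite rmorph_sum. Qed.
Lemma iter_rmorphD i : {morph iter i s : x y / x + y}.
Proof. by move=> x y; elim: i => //= i ->; rewrite rmorphD. Qed.
Lemma iter_rmorph0 i : iter i s 0 = 0.
Proof. by elim: i => //= i ->; rewrite rmorph0. Qed.
Lemma iter_rmorph1 i : iter i s 1 = 1.
Proof. by elim: i => //= i ->; rewrite rmorph1. Qed.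

Lemma convA a b c n : conv a (conv b c) n = conv (conv a b) c n.
Proof.
rewrite /conv.
pose G j l := a j * iter j s (b l * iter l s (c (n - j - l)%N)).
transitivity (\sum_(j < n.+1) \sum_(l < n.+1 - j) G j l).
  apply: eq_bigr => j _; rewrite subSn -1?ltnS // iter_rmorph_sum mulr_sumr.
  exact: eq_bigr.
rewrite -sum_triangle; apply: eq_bigr => i _; rewrite mulr_suml.
apply: eq_bigr => j _; rewrite /G iter_rmorphM -iterD mulrA.
have lji : (j <= i)%N by rewrite -ltnS.
by rewrite -subnDA !subnKC.
Qed.

Lemma convDl a b c n : conv (fun i => a i + b i) c n = conv a c n + conv b c n.
Proof. by rewrite /conv -big_split; apply: eq_bigr => i _; rewrite mulrDl. Qed.
Lemma convDr a b c n : conv a (fun i => b i + c i) n = conv a b n + conv a c n.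
Proof.
by rewrite /conv -big_split; apply: eq_bigr => i _; rewrite iter_rmorphD mulrDr.
Qed.
Lemma conv1l a b n : a 0%N = 1 -> (forall i, a i.+1 = 0) -> conv a b n = b n.
Proof.
move=> a0 aS; rewrite /conv big_ord_recl a0 mul1r subn0 big1 ?addr0 // => i _.
by rewrite aS mul0r.
Qed.
Lemma conv1r a b n : b 0%N = 1 -> (forall i, b i.+1 = 0) -> conv a b n = a n.
Proof.
move=> b0 bS; rewrite /conv big_ord_recr /= subnn b0 iter_rmorph1 mulr1.
rewrite big1 ?add0r // => i _.
by rewrite /= -(subnSK (ltn_ord i)) bS iter_rmorph0 mulr0.
Qed.

End Twisted.

(* The twisted polynomial ring R{tau}, tau c = s(c) tau: the polynomial p      *)
(* stands for \sum_i p`_i tau^i.                                              *)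
Record twpoly (R : comNzRingType) (s : {rmorphism R -> R}) :=
  TwPoly { twcoefs : {poly R} }.

Section TwPolyRing.
Context {R : comNzRingType} (s : {rmorphism R -> R}).
Local Notation tw := (twpoly s).
Local Notation c_ := (@twcoefs R s).
Implicit Types u v w : tw.

HB.instance Definition _ := [isNew for @twcoefs R s].
HB.instance Definition _ := [Choice of tw by <:].

Lemma twpolyP u v : (forall i, (c_ u)`_i = (c_ v)`_i) <-> u = v.
Proof. by split=> [/polyP uv|-> //]; apply: val_inj. Qed.

Definition tw_add u v : tw := TwPoly s (c_ u + c_ v).
Definition tw_opp u : tw := TwPoly s (- c_ u).

Fact tw_addA : associative tw_add.
Proof. by move=> u v w; apply: val_inj; rewrite /= addrA. Qed.
Fact tw_addC : commutative tw_add.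
Proof. by move=> u v; apply: val_inj; rewrite /= addrC. Qed.
Fact tw_add0 : left_id (TwPoly s 0) tw_add.
Proof. by move=> u; apply: val_inj; rewrite /= add0r. Qed.
Fact tw_addN : left_inverse (TwPoly s 0) tw_opp tw_add.
Proof. by move=> u; apply: val_inj; rewrite /= addNr. Qed.
HB.instance Definition _ :=
  GRing.isZmodule.Build tw tw_addA tw_addC tw_add0 tw_addN.

Lemma coef_twD u v i : (c_ (u + v))`_i = (c_ u)`_i + (c_ v)`_i.
Proof. exact: coefD. Qed.

Definition tw_mul u v : tw := TwPoly s
  (\poly_(n < size (c_ u) + size (c_ v))
     \sum_(i < n.+1) (c_ u)`_i * iter i s (c_ v)`_(n - i)).

Lemma coef_tw_mul u v n :
  (c_ (tw_mul u v))`_n = conv s (nth 0 (c_ u)) (nth 0 (c_ v)) n.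
Proof.
rewrite coef_poly; case: ltnP => // le_n; rewrite /conv big1 // => i _.
have [/(nth_default 0)->|lt_i] := leqP (size (c_ u)) i; first by rewrite mul0r.
rewrite (@nth_default _ 0 (c_ v)) ?iter_rmorph0 ?mulr0 //.
rewrite leq_subRL -1?ltnS //; apply: leq_trans le_n.
by rewrite leq_add2r ltnW.
Qed.

Fact tw_mulA : associative tw_mul.
Proof.
move=> u v w; apply/twpolyP => n; rewrite !coef_tw_mul.
transitivity (conv s (nth 0 (c_ u)) (conv s (nth 0 (c_ v)) (nth 0 (c_ w))) n).
  by apply: eq_conv => // i; rewrite coef_tw_mul.
by rewrite convA; apply: eq_conv => // i; rewrite coef_tw_mul.
Qed.
Fact tw_mul1l : left_id (TwPoly s 1) tw_mul.
Proof.
by move=> u; apply/twpolyP=> n; rewrite coef_tw_mul conv1l // => [|i]; rewrite coef1.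
Qed.
Fact tw_mul1r : right_id (TwPoly s 1) tw_mul.
Proof.
by move=> u; apply/twpolyP=> n; rewrite coef_tw_mul conv1r // => [|i]; rewrite coef1.
Qed.
Fact tw_mulDl : left_distributive tw_mul +%R.
Proof.
move=> u v w; apply/twpolyP=> n; rewrite coef_twD !coef_tw_mul -convDl.
by apply: eq_conv => // i; rewrite coef_twD.
Qed.
Fact tw_mulDr : right_distributive tw_mul +%R.
Proof.
move=> u v w; apply/twpolyP=> n; rewrite coef_twD !coef_tw_mul -convDr.
by apply: eq_conv => // i; rewrite coef_twD.
Qed.
Fact tw_oner_neq0 : TwPoly s 1 != 0.
Proof. by apply/eqP => -[] /eqP; rewrite oner_eq0. Qed.
HB.instance Definition _ := GRing.Zmodule_isNzRing.Build tw
  tw_mulA tw_mul1l tw_mul1r tw_mulDl tw_mulDr tw_oner_neq0.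

Definition twC (a : R) : tw := TwPoly s a%:P.
Definition tau : tw := TwPoly s 'X.

Lemma tau_twC a : tau * twC a = twC (s a) * tau.
Proof.
apply/twpolyP=> n; rewrite !coef_tw_mul /conv !big_ord_recl /= !coefX !coefC /=.
rewrite mul0r add0r subn0 [X in _ = _ + X]big1 ?addr0; last first.
  by move=> i _; rewrite coefC mul0r.
case: n => [|n]; first by rewrite big_ord0 mulr0.
rewrite big_ord_recl /= coefX mul1r coefC subSS subn0 big1 ?addr0; last first.
  by move=> i _; rewrite coefX mul0r.
by case: n => [|n] /=; rewrite ?mulr1 ?mulr0 ?rmorph0.
Qed.

Fact twC_is_zmod_morphism : zmod_morphism twC.
Proof. by move=> a b; apply: val_inj; rewrite /= polyCB. Qed.
Fact twC_is_monoid_morphism : monoid_morphism twC.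
Proof.
split=> // a b; apply/twpolyP=> n; rewrite coef_tw_mul /conv big_ord_recl /=.
rewrite big1 ?addr0 ?subn0; last by move=> i _; rewrite coefC mul0r.
by rewrite !coefC; case: eqP; rewrite ?mulr0.
Qed.
HB.instance Definition _ :=
  GRing.isZmodMorphism.Build R tw twC twC_is_zmod_morphism.
HB.instance Definition _ :=
  GRing.isMonoidMorphism.Build R tw twC twC_is_monoid_morphism.

Lemma coef_tw0 i : (c_ 0)`_i = 0. Proof. exact: coef0. Qed.
Lemma coef_tw1 i : (c_ 1)`_i = (i == 0%N)%:R. Proof. exact: coef1. Qed.
Lemma coef_twN u i : (c_ (- u))`_i = - (c_ u)`_i. Proof. exact: coefN. Qed.
Lemma coef_twM u v n :
  (c_ (u * v))`_n = \sum_(i < n.+1) (c_ u)`_i * iter i s (c_ v)`_(n - i).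
Proof. exact: coef_tw_mul. Qed.

End TwPolyRing.

Record powser (R : comNzRingType) := PowSer { pscoef :> nat -> R }.

Section PowSerRing.
Context {R : comNzRingType}.
Local Notation ps := (powser R).
Implicit Types f g h : ps.

HB.instance Definition _ := gen_eqMixin ps.
HB.instance Definition _ := gen_choiceMixin ps.

Lemma powserP f g : f =1 g <-> f = g.
Proof.
by split=> [|-> //]; case: f g => f [g] /= fg; congr PowSer; apply: funext.
Qed.

Definition ps_add f g : ps := PowSer (fun n => f n + g n).
Definition ps_opp f : ps := PowSer (fun n => - f n).
Definition ps_mul f g : ps :=
  PowSer (fun n => \sum_(i < n.+1) f i * g (n - i)%N).
Definition ps_zero : ps := PowSer (fun=> 0).
Definition ps_one : ps := PowSer (fun n => (n == 0%N)%:R).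

Lemma ps_mulE f g : ps_mul f g =1 conv (@idfun R) f g.
Proof. by move=> n; apply: eq_bigr => i _; rewrite iter_fix. Qed.

Fact ps_addA : associative ps_add.
Proof. by move=> f g h; apply/powserP=> n /=; rewrite addrA. Qed.
Fact ps_addC : commutative ps_add.
Proof. by move=> f g; apply/powserP=> n /=; rewrite addrC. Qed.
Fact ps_add0 : left_id ps_zero ps_add.
Proof. by move=> f; apply/powserP=> n /=; rewrite add0r. Qed.
Fact ps_addN : left_inverse ps_zero ps_opp ps_add.
Proof. by move=> f; apply/powserP=> n /=; rewrite addNr. Qed.
HB.instance Definition _ :=
  GRing.isZmodule.Build ps ps_addA ps_addC ps_add0 ps_addN.

Fact ps_mulA : associative ps_mul.
Proof.
move=> f g h; apply/powserP=> n; rewrite !ps_mulE.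
transitivity (conv (@idfun R) f (conv (@idfun R) g h) n).
  by apply: eq_conv => // i; rewrite ps_mulE.
by rewrite convA; apply: eq_conv => // i; rewrite ps_mulE.
Qed.
Fact ps_mulC : commutative ps_mul.
Proof.
move=> f g; apply/powserP=> n /=; rewrite (reindex_inj rev_ord_inj) /=.
apply: eq_bigr => i _; rewrite mulrC subSS subKn //.
by rewrite -ltnS.
Qed.
Fact ps_mul1 : left_id ps_one ps_mul.
Proof. by move=> f; apply/powserP=> n; rewrite ps_mulE conv1l. Qed.
Fact ps_mulDl : left_distributive ps_mul +%R.
Proof. by move=> f g h; apply/powserP=> n; rewrite ps_mulE convDl /= -!ps_mulE. Qed.
Fact ps_oner_neq0 : ps_one != 0.
Proof. by apply/eqP => /powserP/(_ 0%N)/eqP; rewrite oner_eq0. Qed.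
HB.instance Definition _ := GRing.Zmodule_isComNzRing.Build ps
  ps_mulA ps_mulC ps_mul1 ps_mulDl ps_oner_neq0.

Definition ps_unit : pred ps := fun f => `[< exists g, g * f = 1 >].
Definition ps_inv f : ps :=
  if pselect (exists g, g * f = 1) is left fU then projT1 (cid fU) else f.

Fact ps_mulVr : {in ps_unit, left_inverse 1 ps_inv *%R}.
Proof. by move=> f /asboolP fU; rewrite /ps_inv; case: pselect => // ?; case: cid. Qed.
Fact ps_unitP f g : g * f = 1 -> ps_unit f.
Proof. by move=> gf1; apply/asboolP; exists g. Qed.
Fact ps_inv_out : {in [predC ps_unit], ps_inv =1 id}.
Proof. by move=> f /asboolP fU; rewrite /ps_inv; case: pselect. Qed.
HB.instance Definition _ := GRing.ComNzRing_hasMulInverse.Build ps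
  ps_mulVr ps_unitP ps_inv_out.

(* The class of f in R[[T]]/(T^n) = R[T]/(T^n).                               *)
Definition ps_trunc n f : {poly R} := \poly_(i < n) f i.

End PowSerRing.

Section PowSerTrunc.
Context {R : comNzRingType}.
Implicit Types f g : powser R.

Lemma coef_ps_trunc n f i : (ps_trunc n f)`_i = if (i < n)%N then f i else 0.
Proof. exact: coef_poly. Qed.

Lemma ps_truncD n f g : ps_trunc n (f + g) = ps_trunc n f + ps_trunc n g.
Proof.
by apply/polyP=> i; rewrite coefD !coef_ps_trunc; case: ifP; rewrite ?addr0.
Qed.

Lemma ps_truncS n f : ps_trunc n.+1 f = ps_trunc n f + (f n)%:P * 'X^n.
Proof.
apply/polyP=> i; rewrite coefD !coef_ps_trunc coefCM coefXn ltnS.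
by case: ltngtP => // [||->]; rewrite ?mulr0 ?mulr1 ?addr0 ?add0r.
Qed.

Lemma ps_trunc1 n : ps_trunc n.+1 1 = 1 :> {poly R}.
Proof. by apply/polyP=> -[|i]; rewrite coef_ps_trunc coef1 //=; case: ifP. Qed.

Lemma ps_truncM n f g : exists p,
  ps_trunc n f * ps_trunc n g = ps_trunc n (f * g) + p * 'X^n.
Proof.
set r := _ * _; exists (drop_poly n r).
rewrite -[r in LHS](poly_take_drop n); congr (_ + _).
apply/polyP=> i; rewrite coef_take_poly coef_ps_trunc; case: ltnP => // lt_in.
rewrite coefM; apply: eq_bigr => j _; rewrite !coef_ps_trunc.
by rewrite !(leq_ltn_trans _ lt_in) // ?leq_subr // -ltnS.
Qed.

End PowSerTrunc.

Notation ratfun k := {fraction {poly k}}.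
Notation tofrac := (@FracField.tofrac _).



Section Drinfeld.
Context (k : finFieldType).
Local Notation q := #|k|.
Local Notation F := (ratfun k).

Lemma pchar_card (R : nzRingType) (f : {rmorphism k -> R}) : [pchar R].-nat q.
Proof.
have [p p_pr pk] := finPcharP k.
have pR : p \in [pchar R] by apply: (rmorph_pchar f).
rewrite (eq_pnat _ (pcharf_eq pR)) (card_pprimeChar pk : q = _).
by rewrite pnatX pnat_id.
Qed.

Lemma exprq_sum (R : comNzRingType) (f : {rmorphism k -> R}) i I r P (E : I -> R) :
  (\sum_(j <- r | P j) E j) ^+ (q ^ i) = \sum_(j <- r | P j) E j ^+ (q ^ i).
Proof.
apply: (big_morph (fun x => x ^+ (q ^ i))) => [x y|].
  by rewrite exprDn_pchar // pnatX (pchar_card f).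
by rewrite expr0n expn_eq0 -leqn0 leqNgt (leq_trans _ (finNzRing_gt1 k)).
Qed.

Lemma exprqD (R : comNzRingType) (f : {rmorphism k -> R}) i (x y : R) :
  (x + y) ^+ (q ^ i) = x ^+ (q ^ i) + y ^+ (q ^ i).
Proof. by rewrite exprDn_pchar // pnatX (pchar_card f). Qed.

Definition frob (x : F) : F := x ^+ q.

Fact frob_is_nmod_morphism : nmod_morphism frob.
Proof.
split=> [|x y]; last by rewrite /frob -[q]expn1 (exprqD (tofrac \o polyC)).
by rewrite /frob expr0n -leqn0 leqNgt (leq_trans _ (finNzRing_gt1 k)).
Qed.
Fact frob_is_monoid_morphism : monoid_morphism frob.
Proof. by split=> [|x y]; rewrite /frob ?expr1n ?exprMn. Qed.
HB.instance Definition _ :=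
  GRing.isNmodMorphism.Build F F frob frob_is_nmod_morphism.
HB.instance Definition _ :=
  GRing.isMonoidMorphism.Build F F frob frob_is_monoid_morphism.

Lemma iter_frob i x : iter i frob x = x ^+ (q ^ i).
Proof. by elim: i => [|i /= ->]; rewrite ?expr1 // /frob -exprM expnSr. Qed.

Definition Ftau := twpoly frob.
HB.instance Definition _ := GRing.NzRing.on Ftau.

(* The F_q-linear polynomial \sum_i u_i x^(q^i) attached to \sum_i u_i tau^i. *)
Definition twlin (u : Ftau) : {poly F} :=
  \sum_(i < size (twcoefs u)) (twcoefs u)`_i *: 'X^(q ^ i).

Definition Ftau_const : k -> Ftau := twC frob \o (tofrac \o polyC).
HB.instance Definition _ := GRing.RMorphism.on Ftau_const.

Fact Ftau_const_comm (u : Ftau) : commr_rmorph Ftau_const u.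
Proof.
move=> a; have fa i : iter i frob (tofrac a%:P) = tofrac a%:P.
  by elim: i => //= i ->; rewrite /frob -!rmorphXn /= expf_card.
apply/twpolyP=> n; rewrite !coef_twM big_ord_recr big_ord_recl /= subnn coefC /=.
rewrite [X in X + _]big1 ?add0r; last first.
  by move=> i _; rewrite -(subnSK (ltn_ord i)) coefC /= iter_rmorph0 mulr0.
rewrite big1 ?addr0; last by move=> i _; rewrite coefC mul0r.
by rewrite subn0 fa mulrC.
Qed.

(* The F_q-algebra morphism F_q[T] -> F{tau} that maps T to u.                *)
Definition drinfeld (u : Ftau) : {poly k} -> Ftau :=
  horner_morph (Ftau_const_comm u).
HB.instance Definition _ u := GRing.RMorphism.on (drinfeld u).

Lemma drinfeldX u : drinfeld u 'X = u.
Proof. exact: horner_morphX. Qed.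

Definition drinfeld2 (g1 g2 : {poly k}) : {rmorphism {poly k} -> Ftau} :=
  drinfeld (twC frob (tofrac 'X) + twC frob (tofrac g1) * tau frob
            + twC frob (tofrac g2) * tau frob ^+ 2).

Context {L : fieldType} (iota : {rmorphism F -> L}).

Definition tweval (u : Ftau) (x : L) : L := (map_poly iota (twlin u)).[x].

Lemma twevalE n u x : (size (twcoefs u) <= n)%N ->
  tweval u x = \sum_(i < n) iota (twcoefs u)`_i * x ^+ (q ^ i).
Proof.
move=> /subnKC <-; rewrite /tweval /twlin rmorph_sum horner_sum big_split_ord /=.
rewrite [X in _ = _ + X]big1 ?addr0; last first.
  by move=> i _; rewrite nth_default ?leq_addr // rmorph0 mul0r.
apply: eq_bigr => i _.
by rewrite map_polyZ hornerZ map_polyXn hornerXn.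
Qed.

Lemma twevalDl u v x : tweval (u + v) x = tweval u x + tweval v x.
Proof.
set n := (size (twcoefs u) + size (twcoefs v))%N.
rewrite !(@twevalE n) ?leq_addr ?leq_addl //; last first.
  by rewrite (leq_trans (size_polyD _ _)) // geq_max leq_addr leq_addl.
by rewrite -big_split; apply: eq_bigr => i _; rewrite coef_twD rmorphD mulrDl.
Qed.

Lemma tweval0l x : tweval 0 x = 0.
Proof. by rewrite (@twevalE 0) ?big_ord0 //= size_poly0. Qed.

Lemma tweval1 x : tweval 1 x = x.
Proof.
by rewrite (@twevalE 1) ?big_ord1 ?coef_tw1 ?rmorph1 ?mul1r ?expr1 //= size_poly1.
Qed.

Lemma twevalDr u x y : tweval u (x + y) = tweval u x + tweval u y.
Proof.
rewrite !(@twevalE (size (twcoefs u))) // -big_split; apply: eq_bigr => i _.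
by rewrite (exprqD (iota \o (tofrac \o polyC))) mulrDr.
Qed.

Lemma tweval0r u : tweval u 0 = 0.
Proof. by apply: (addIr (tweval u 0)); rewrite -twevalDr !add0r. Qed.

Lemma twevalNr u x : tweval u (- x) = - tweval u x.
Proof. by apply: (addrI (tweval u x)); rewrite -twevalDr !subrr tweval0r. Qed.

Lemma twevalM u v x : tweval (u * v) x = tweval u (tweval v x).
Proof.
rewrite (@twevalE (size (twcoefs u) + size (twcoefs v)) (u * v)) ?size_poly //.
pose G i j := iota (twcoefs u)`_i * iota (twcoefs v)`_j ^+ (q ^ i)
  * x ^+ (q ^ (i + j)).
transitivity (\sum_(i < size (twcoefs u) + size (twcoefs v))
    \sum_(j < i.+1) G j (i - j)%N).
  apply: eq_bigr => i _; rewrite coef_twM rmorph_sum mulr_suml.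
  apply: eq_bigr => j _; rewrite /G rmorphM iter_frob rmorphXn subnKC //.
  by rewrite -ltnS.
rewrite sum_triangle_rect => [|i j]; last first.
  rewrite /G => /orP[/(nth_default 0)->|/(nth_default 0)->].
    by rewrite rmorph0 !mul0r.
  rewrite rmorph0 expr0n expn_eq0 -leqn0 leqNgt (leq_trans _ (finNzRing_gt1 k)) //=.
  by rewrite mulr0 mul0r.
rewrite [RHS](@twevalE (size (twcoefs u))) //; apply: eq_bigr => i _.
rewrite (@twevalE (size (twcoefs v))) // (exprq_sum (iota \o (tofrac \o polyC))).
rewrite mulr_sumr; apply: eq_bigr => j _.
by rewrite /G exprMn -exprM -expnD addnC mulrA.
Qed.

Definition separable_closure : Prop :=
  (forall x : L, exists2 p : {poly F},
     separable_poly p & root (map_poly iota p) x) /\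
  (forall p : {poly L}, separable_poly p -> (1 < size p)%N ->
     exists x, root p x).

Record galaut := GalAut {
  galmap :> {rmorphism L -> L};
  gal_bij : bijective galmap;
  gal_fix : forall a : F, galmap (iota a) = iota a }.

Lemma gal_tweval (s : galaut) u x : s (tweval u x) = tweval u (s x).
Proof.
rewrite !(@twevalE (size (twcoefs u))) // rmorph_sum; apply: eq_bigr => i _.
by rewrite rmorphM rmorphXn gal_fix.
Qed.

Context (phi : {rmorphism {poly k} -> Ftau}).

Definition drinfeld_act (b : {poly k}) (x : L) : L := tweval (phi b) x.

Definition Ttorsion n (x : L) : bool := root (map_poly iota (twlin (phi 'X^n))) x.

Lemma drinfeld_actDl b c x :
  drinfeld_act (b + c) x = drinfeld_act b x + drinfeld_act c x.
Proof. by rewrite /drinfeld_act rmorphD twevalDl. Qed.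
Lemma drinfeld_actDr b x y :
  drinfeld_act b (x + y) = drinfeld_act b x + drinfeld_act b y.
Proof. exact: twevalDr. Qed.
Lemma drinfeld_actM b c x :
  drinfeld_act (b * c) x = drinfeld_act b (drinfeld_act c x).
Proof. by rewrite /drinfeld_act rmorphM twevalM. Qed.
Lemma drinfeld_act1 x : drinfeld_act 1 x = x.
Proof. by rewrite /drinfeld_act rmorph1 tweval1. Qed.
Lemma drinfeld_act0r b : drinfeld_act b 0 = 0. Proof. exact: tweval0r. Qed.
Lemma drinfeld_act0l x : drinfeld_act 0 x = 0.
Proof. by rewrite /drinfeld_act rmorph0 tweval0l. Qed.
Lemma drinfeld_actNr b x : drinfeld_act b (- x) = - drinfeld_act b x.
Proof. exact: twevalNr. Qed.
Lemma drinfeld_actC b c x :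
  drinfeld_act b (drinfeld_act c x) = drinfeld_act c (drinfeld_act b x).
Proof. by rewrite -!drinfeld_actM mulrC. Qed.

Lemma TtorsionP n x : reflect (drinfeld_act 'X^n x = 0) (Ttorsion n x).
Proof. exact: eqP. Qed.

(* T_p(phi) for p = (T): the inverse limit of the phi[T^n] along phi_T.       *)
Record tate := Tate {
  tseq :> nat -> L;
  tate_torsion : forall n, Ttorsion n (tseq n);
  tate_compat : forall n, drinfeld_act 'X (tseq n.+1) = tseq n }.

HB.instance Definition _ := gen_eqMixin tate.
HB.instance Definition _ := gen_choiceMixin tate.

Lemma tateP (x y : tate) : x =1 y <-> x = y.
Proof.
split=> [|-> //]; case: x y => x xt xc [y yt yc] /= /funext xy; subst y.
by congr Tate; apply: Prop_irrelevance.
Qed.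

Implicit Types (x y : tate) (f g : powser k).

Fact tate_zero_torsion n : Ttorsion n 0.
Proof. exact/TtorsionP/drinfeld_act0r. Qed.
Definition tate_zero : tate :=
  @Tate (fun=> 0) tate_zero_torsion (fun=> drinfeld_act0r 'X).

Fact tate_opp_torsion x n : Ttorsion n (- x n).
Proof.
apply/TtorsionP; rewrite drinfeld_actNr.
by rewrite (TtorsionP _ _ (tate_torsion x n)) oppr0.
Qed.
Fact tate_opp_compat x n : drinfeld_act 'X (- x n.+1) = - x n.
Proof. by rewrite drinfeld_actNr tate_compat. Qed.
Definition tate_opp x : tate :=
  @Tate (fun n => - x n) (tate_opp_torsion x) (tate_opp_compat x).

Fact tate_add_torsion x y n : Ttorsion n (x n + y n).
Proof.
apply/TtorsionP; rewrite drinfeld_actDr.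
by rewrite !(TtorsionP _ _ (tate_torsion _ n)) addr0.
Qed.
Fact tate_add_compat x y n : drinfeld_act 'X (x n.+1 + y n.+1) = x n + y n.
Proof. by rewrite drinfeld_actDr !tate_compat. Qed.
Definition tate_add x y : tate :=
  @Tate (fun n => x n + y n) (tate_add_torsion x y) (tate_add_compat x y).

Fact tate_scale_torsion f x n :
  Ttorsion n (drinfeld_act (ps_trunc n f) (x n)).
Proof.
apply/TtorsionP; rewrite drinfeld_actC.
by rewrite (TtorsionP _ _ (tate_torsion _ n)) drinfeld_act0r.
Qed.
Fact tate_scale_compat f x n :
  drinfeld_act 'X (drinfeld_act (ps_trunc n.+1 f) (x n.+1)) =
  drinfeld_act (ps_trunc n f) (x n).
Proof.
rewrite drinfeld_actC tate_compat ps_truncS drinfeld_actDl.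
by rewrite drinfeld_actM (TtorsionP _ _ (tate_torsion _ n)) drinfeld_act0r addr0.
Qed.
Definition tate_scale f x : tate :=
  @Tate (fun n => drinfeld_act (ps_trunc n f) (x n))
    (tate_scale_torsion f x) (tate_scale_compat f x).

Fact tate_addA : associative tate_add.
Proof. by move=> x y z; apply/tateP => n /=; rewrite addrA. Qed.
Fact tate_addC : commutative tate_add.
Proof. by move=> x y; apply/tateP => n /=; rewrite addrC. Qed.
Fact tate_add0 : left_id tate_zero tate_add.
Proof. by move=> x; apply/tateP => n /=; rewrite add0r. Qed.
Fact tate_addN : left_inverse tate_zero tate_opp tate_add.
Proof. by move=> x; apply/tateP => n /=; rewrite addNr. Qed.
HB.instance Definition _ :=
  GRing.isZmodule.Build tate tate_addA tate_addC tate_add0 tate_addN.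

Fact tate_scaleA f g x : tate_scale f (tate_scale g x) = tate_scale (f * g) x.
Proof.
apply/tateP => n /=; rewrite -drinfeld_actM.
have [p ->] := ps_truncM n f g; rewrite drinfeld_actDl drinfeld_actM.
by rewrite (TtorsionP _ _ (tate_torsion _ n)) drinfeld_act0r addr0.
Qed.
Lemma tate0n x : x 0%N = 0.
Proof.
by have /TtorsionP := tate_torsion x 0; rewrite expr0 drinfeld_act1.
Qed.
Fact tate_scale1 : left_id 1 tate_scale.
Proof.
move=> x; apply/tateP => -[|n] /=; first by rewrite tate0n drinfeld_act0r.
by rewrite ps_trunc1 drinfeld_act1.
Qed.
Fact tate_scaleDr : right_distributive tate_scale +%R.
Proof. by move=> f x y; apply/tateP => n /=; rewrite drinfeld_actDr. Qed.
Fact tate_scaleDl x : {morph tate_scale^~ x : f g / f + g}.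
Proof. by move=> f g; apply/tateP => n /=; rewrite ps_truncD drinfeld_actDl. Qed.
HB.instance Definition _ := GRing.Zmodule_isLmodule.Build (powser k) tate
  tate_scaleA tate_scale1 tate_scaleDr tate_scaleDl.

Fact tate_gal_torsion (s : galaut) x n : Ttorsion n (s (x n)).
Proof.
apply/TtorsionP; rewrite /drinfeld_act -gal_tweval.
by rewrite [tweval _ _](TtorsionP _ _ (tate_torsion x n)) rmorph0.
Qed.
Fact tate_gal_compat (s : galaut) x n : drinfeld_act 'X (s (x n.+1)) = s (x n).
Proof.
by rewrite /drinfeld_act -gal_tweval; congr (s _); exact: tate_compat.
Qed.
Definition tate_gal (s : galaut) x : tate :=
  @Tate (fun n => s (x n)) (tate_gal_torsion s x) (tate_gal_compat s x).

Fact tate_gal_linear s : linear (tate_gal s).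
Proof.
move=> f x y; apply/tateP => n /=.
by rewrite rmorphD /= /drinfeld_act gal_tweval.
Qed.
HB.instance Definition _ s :=
  GRing.isLinear.Build (powser k) tate tate *:%R (tate_gal s) (tate_gal_linear s).

Lemma tate_gal_surj s y : exists x, tate_gal s x = y.
Proof.
have [s' sK s'K] := gal_bij s.
have ht n : Ttorsion n (s' (y n)).
  apply/TtorsionP/(can_inj sK); rewrite rmorph0 /drinfeld_act gal_tweval s'K.
  exact/TtorsionP/tate_torsion.
have hc n : drinfeld_act 'X (s' (y n.+1)) = s' (y n).
  apply: (can_inj sK); rewrite /drinfeld_act gal_tweval !s'K.
  exact: tate_compat.
by exists (Tate ht hc); apply/tateP => n /=; rewrite s'K.
Qed.

Definition tate_basis (e : 'I_2 -> tate) : Prop :=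
  forall x, exists! c : 'cV[powser k]_2, x = \sum_i c i 0 *: e i.

Definition tate_coord e (eB : tate_basis e) x : 'cV[powser k]_2 :=
  projT1 (cid (eB x)).

Section Rho.
Context (e : 'I_2 -> tate) (eB : tate_basis e).

Lemma tate_coordE x : x = \sum_i tate_coord eB x i 0 *: e i.
Proof. by rewrite {1}(projT2 (cid (eB x))).1. Qed.

Lemma tate_coord_uniq x (c : 'cV[powser k]_2) :
  x = \sum_i c i 0 *: e i -> tate_coord eB x = c.
Proof. exact: (projT2 (cid (eB x))).2. Qed.

(* s(e_j) = \sum_i (rho_mx s)_ij e_i                                          *)
Definition rho_mx (s : galaut) : 'M[powser k]_2 :=
  \matrix_(i, j) tate_coord eB (tate_gal s (e j)) i 0.

Lemma rho_mxE s j : tate_gal s (e j) = \sum_i rho_mx s i j *: e i.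
Proof. by rewrite {1}[LHS]tate_coordE; apply: eq_bigr => i _; rewrite mxE. Qed.

Lemma rho_mx_coord s x :
  tate_coord eB (tate_gal s x) = rho_mx s *m tate_coord eB x.
Proof.
apply: tate_coord_uniq; rewrite {1}[x in LHS]tate_coordE linear_sum /=.
under eq_bigr => j _ do rewrite linearZ /= rho_mxE scaler_sumr.
rewrite exchange_big; apply: eq_bigr => i _; rewrite mxE scaler_suml.
by apply: eq_bigr => j _; rewrite scalerA mulrC.
Qed.

Lemma rho_mx_unit s : rho_mx s \in unitmx.
Proof.
pose h j := cid (tate_gal_surj s (e j)).
pose N := \matrix_(i, j) tate_coord eB (projT1 (h j)) i 0.
suff sN : rho_mx s *m N = 1%:M by exact: (proj1 (mulmx1_unit sN)).
apply/matrixP=> i j.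
transitivity ((rho_mx s *m tate_coord eB (projT1 (h j))) i 0).
  by rewrite !mxE; apply: eq_bigr => l _; rewrite !mxE.
rewrite -rho_mx_coord (projT2 (h j)).
rewrite (@tate_coord_uniq _ (\col_i (i == j)%:R)) ?mxE //.
rewrite (bigD1 j) //= mxE eqxx scale1r big1 ?addr0 // => l /negPf lj.
by rewrite mxE lj scale0r.
Qed.

End Rho.
End Drinfeld.

Definition GL n (R : comUnitRingType) := {M : 'M[R]_n | M \in unitmx}.

Section GaloisRep.
Context (k : finFieldType) (L : fieldType) (iota : {rmorphism ratfun k -> L}).
Context (phi : {rmorphism {poly k} -> Ftau k}).
Context (e : 'I_2 -> tate iota phi) (eB : tate_basis e).

Definition rho (s : galaut iota) : GL 2 (powser k) :=
  exist _ (rho_mx eB s) (rho_mx_unit eB s).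

End GaloisRep.

(* Main.v *)
Require Import Defs.
From HB Require Import structures.
From mathcomp Require Import boolp classical_sets qpoly.
From mathcomp Require Import all_boot all_order all_algebra all_field ring zify.

(******************************************************************************)
(* Write phi_T(x) = T x + g1 x^q + g2 x^(q^2) and let H be the image of rho.  *)
(*                                                                            *)
(* At T - a2, where g1 and T are units and g2 is a uniformizer, phi[T^2] has a *)
(* rank one submodule A nu that is integral and generates an unramified       *)
(* extension E of F, while a complementary generator lam has valuation        *)
(* -1/(q^2(q-1)) and phi_T(lam) has valuation -1/(q(q-1)).  A valuation with   *)
(* integer values on E and value 1/D at x forces deg_E(x) >= D, so comparing  *)
(* orbit sizes under Gal(Fsep/E) shows that H mod T contains every matrix     *)
(* (1 b; 0 a) and that H contains some 1 + T X with X mod T nonzero of the    *)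
(* form (0 b; 0 d).  The line spanned by phi_T(nu) is not stable under Galois: *)
(* otherwise b = phi_T(nu)^(q-1) would be a root in F of T + g1 b + g2 b^(q+1), *)
(* and reducing at T = a1 gives b^2 = eta.  Hence H mod T is GL_2(F_q).        *)
(*                                                                            *)
(* The determinant is given by the Weil pairing of phi, with values in the    *)
(* torsion of psi_T = T - g2 tau, whose T^n-torsion points have valuation     *)
(* 1/(q^(n-1)(q-1)) at T: so det H is dense in F_q[[T]]^x.  Commutators then   *)
(* lift surjectivity from T^n to T^(n+1), and a limit of automorphisms        *)
(* realizes every element of GL_2(F_q[[T]]).                                  *)
(*                                                                            *)
(* The valuations are given by maximal subrings of Fsep in which T - a is not *)
(* invertible, and automorphisms of Fsep by maximal graphs of isomorphisms    *)
(* between subfields.                                                         *)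
(******************************************************************************)

Set Implicit Arguments.
Unset Strict Implicit.
Unset Printing Implicit Defensive.

Import GRing.Theory.
Local Open Scope ring_scope.

(** * Extension of isomorphisms between subfields *)

(** The group-theoretic core is [subgroup_full]: over a field k with more than two elements, a
    subgroup of GL_2(k[[t]]) is dense as soon as it is everything modulo t, has dense determinants,
    and contains some 1 + tX with X modulo t nonzero of the form (0 b; 0 d). Three primes supply
    these inputs.

    At T - a2 the Newton polygon of phi_T has a segment of slope 0, which yields an unramified
    direction nu, and a segment that forces ramification q^2 - q on phi[T] and a further factor q on
    phi[T^2] ([bad_place_points]). Ramification bounds orbits from below ([orbit_size]), while the
    shape of the matrices fixing nu bounds them from above; comparing the two gives [image_borel]
    and [image_nonscalar]. At T - a1, [no_rational_line] excludes a Galois-stable line, so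
    [image_move] finds an element that leaves the Borel subgroup. At T, the Weil pairing sends phi
    to the rank one module psi, whose torsion is totally ramified ([weil_ramified]); this gives
    [det_dense].

    Finally [rho_closed] upgrades density to surjectivity, and [change_basis_surj] carries the
    result from the basis adapted to T - a2 to the given one. Only orbits and valuation rings of the
    whole separable closure occur; intermediate fields appear through polynomials in a generator. *)

Lemma irreducible_root (E L : fieldType) (i : {rmorphism E -> L}) x (f : {poly E}) :
  f != 0 -> root (map_poly i f) x ->
  exists p, [/\ irreducible_poly p, p %| f & root (map_poly i p) x].
Proof.
move=> f0 fx.
(* The minimal polynomial of x is taken as a nonzero annihilator of least size; both claims follow
   from minimality. *)
pose P n := `[< exists p : {poly E}, [/\ p != 0, size p = n & root (map_poly i p) x] >].
have exP : exists n, P n by exists (size f); apply/asboolP; exists f.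
case: (ex_minnP exP) => n /asboolP[p [p0 <- px]] minp.
have {}minp r : r != 0 -> root (map_poly i r) x -> (size p <= size r)%N.
  by move=> r0 rx; apply: minp; apply/asboolP; exists r.
have p1 : (1 < size p)%N.
  rewrite ltnNge; apply/negP => /size1_polyC pE; move: px p0.
  by rewrite pE map_polyC rootC fmorph_eq0 polyC_eq0 => ->.
exists p; split=> //.
  split=> // r r1 rp; rewrite -(dvdp_size_eqp rp) eqn_leq dvdp_leq //=.
  have /dvdpP[s pE] := rp; have := p0; have := px.
  rewrite pE rmorphM rootM mulf_eq0 negb_or -pE => /orP[sx|rx] /andP[s0 r0]; last exact: minp.
  have := minp _ s0 sx; rewrite {1}pE size_mul // -subn1 leq_subLR => sz.
  case/negP: r1; rewrite eqn_leq size_poly_gt0 r0 andbT.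
  by move: sz; rewrite addnC leq_add2r.
apply: contraT => r0; have := minp (f %% p) r0.
rewrite leqNgt ltn_modp p0 => /(_ _)/negP []//.
move: fx; rewrite {1}(divp_eq f p) rmorphD rmorphM !rootE !hornerE.
by rewrite (rootP px) mulr0 add0r.
Qed.

Section AdjoinGraph.
Context {E L : fieldType} (i j : {rmorphism E -> L}) (p : {poly E}) (x y : L).
Hypotheses (p_irr : irreducible_poly p).
Hypotheses (px : root (map_poly i p) x) (py : root (map_poly j p) y).

(** The graph of the isomorphism from i(E)(x) to j(E)(y) sending x to y. As a relation it requires
    no choice of f; [adjoin_graph0] makes it both well defined and injective. *)
Definition adjoin_graph (u v : L) : Prop :=
  exists f : {poly E}, u = (map_poly i f).[x] /\ v = (map_poly j f).[y].

Lemma root_irreducibleE (h : {rmorphism E -> L}) (z : L) f :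
  root (map_poly h p) z -> root (map_poly h f) z = (p %| f).
Proof.
move=> pz; apply/idP/idP => [fz|/dvdpP[g ->]]; last first.
  by rewrite rmorphM rootM pz orbT.
apply: contraT; rewrite -irreducible_poly_coprime // => /Bezout_eq1_coprimepP[[u v]] /=.
move=> /(congr1 (fun g => (map_poly h g).[z])) /eqP.
rewrite rmorphD !rmorphM rmorph1 /= !hornerE (rootP pz) (rootP fz) !mulr0 addr0.
by rewrite eq_sym oner_eq0.
Qed.

Lemma adjoin_graph0 u v : adjoin_graph u v -> (u == 0) = (v == 0).
Proof.
move=> [f [-> ->]]; have := root_irreducibleE f px.
by have := root_irreducibleE f py; rewrite /root => -> ->.
Qed.

(** A Bezout relation a p + b f = 1 shows that b represents the inverse of f at x and at y
    simultaneously. *)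
Lemma adjoin_graphV u v : adjoin_graph u v -> adjoin_graph u^-1 v^-1.
Proof.
move=> uv; have := adjoin_graph0 uv; case: eqP => [-> /esym/eqP ->|/eqP u0 /esym].
  by exists 0; rewrite !rmorph0 !horner0 invr0.
move=> /negbT v0; case: uv u0 v0 => f [-> ->] fx fy.
have : coprimep p f.
  by rewrite irreducible_poly_coprime // -(root_irreducibleE f px).
move=> /Bezout_eq1_coprimepP[[a b]] /= ab1.
have inv (h : {rmorphism E -> L}) z : root (map_poly h p) z ->
    (map_poly h f).[z] != 0 -> (map_poly h f).[z]^-1 = (map_poly h b).[z].
  move=> pz fz; apply: (mulIf fz); rewrite mulVf //.
  have := congr1 (fun g => (map_poly h g).[z]) ab1.
  by rewrite rmorphD !rmorphM rmorph1 /= !hornerE (rootP pz) mulr0 add0r => ->.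
by exists b; rewrite !inv.
Qed.

Lemma adjoin_graphB u v u' v' :
  adjoin_graph u v -> adjoin_graph u' v' -> adjoin_graph (u - u') (v - v').
Proof.
by move=> [f [-> ->]] [g [-> ->]]; exists (f - g); rewrite !rmorphB !hornerE.
Qed.

Lemma adjoin_graphM u v u' v' :
  adjoin_graph u v -> adjoin_graph u' v' -> adjoin_graph (u * u') (v * v').
Proof.
by move=> [f [-> ->]] [g [-> ->]]; exists (f * g); rewrite !rmorphM !hornerE.
Qed.

Lemma adjoin_graphC a : adjoin_graph (i a) (j a).
Proof. by exists a%:P; rewrite !map_polyC !hornerC. Qed.

Lemma adjoin_graphX : adjoin_graph x y.
Proof. by exists 'X; rewrite !map_polyX !hornerX. Qed.

End AdjoinGraph.

(** Divide by the factor at x: separability prevents x from being a root of the quotient, which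
    still has a root. *)
Lemma separable_other_root (L : fieldType) (p : {poly L}) (x : L) :
  (forall p : {poly L}, separable_poly p -> (1 < size p)%N -> exists x, root p x) ->
  separable_poly p -> (2 < size p)%N -> exists2 y, root p y & y != x.
Proof.
move=> closedL sep_p sz_p; have [y py] := closedL p sep_p (ltnW sz_p).
have [yx|] := eqVneq y x; last by exists y.
move: py sep_p sz_p; rewrite {y}yx => /factor_theorem[r ->].
rewrite separable_root => /andP[sep_r rx] sz_p.
have [|y ry] := closedL r sep_r.
  have r0 : r != 0 by apply: contraTneq sz_p => ->; rewrite mul0r size_poly0.
  by move: sz_p; rewrite size_Mmonic ?monicXsubC // size_XsubC addn2.
by exists y; rewrite ?rootM ?ry //; apply: contraNneq rx => <-.
Qed.

Section FieldGraph.
Context {F L : fieldType} (iota : {rmorphism F -> L}).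

(* The graph of an F-isomorphism between two subfields of L containing F. *)
Record field_graph (G : L -> L -> Prop) : Prop := FieldGraph {
  graph_base : forall a, G (iota a) (iota a);
  graphB : forall x y x' y', G x y -> G x' y' -> G (x - x') (y - y');
  graphM : forall x y x' y', G x y -> G x' y' -> G (x * x') (y * y');
  graphV : forall x y, G x y -> G x^-1 y^-1;
  graph0 : forall x y, G x y -> (x == 0) = (y == 0) }.

(** This turns every extension result about domains into one about images. *)
Lemma field_graph_sym G : field_graph G -> field_graph (fun x y => G y x).
Proof.
case=> Gb GB GM GV G0; split=> //.
- by move=> x y x' y'; apply: GB.
- by move=> x y x' y'; apply: GM.
- by move=> x y; apply: GV.
- by move=> x y /G0.
Qed.

Lemma graph_fun G x y y' : field_graph G -> G x y -> G x y' -> y = y'.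
Proof.
move=> gG Gy Gy'; have /(graph0 gG) := graphB gG Gy Gy'.
by rewrite subrr eqxx => /esym; rewrite subr_eq0 => /eqP.
Qed.

Lemma graph_1 G : field_graph G -> G 1 1.
Proof. by move=> gG; have := graph_base gG 1; rewrite rmorph1. Qed.

Section Domain.
Context (G : L -> L -> Prop) (gG : field_graph G).

Definition graph_dom : {pred L} := fun x => `[< exists y, G x y >].

Fact graph_dom_divring : divring_closed graph_dom.
Proof.
split=> [|x x' /asboolP[y Gy] /asboolP[y' Gy']|x x' /asboolP[y Gy] /asboolP[y' Gy']].
- by apply/asboolP; exists 1; apply: graph_1.
- by apply/asboolP; exists (y - y'); apply: graphB.
- by apply/asboolP; exists (y / y'); apply: graphM => //; apply: graphV.
Qed.

HB.instance Definition _ :=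
  GRing.isDivringClosed.Build L graph_dom graph_dom_divring.

Record graph_field := GraphField { graph_val : L; _ : graph_val \in graph_dom }.
HB.instance Definition _ := [isSub for graph_val].
HB.instance Definition _ := [Choice of graph_field by <:].
HB.instance Definition _ := [SubChoice_isSubComUnitRing of graph_field by <:].
HB.instance Definition _ := [SubComUnitRing_isSubIntegralDomain of graph_field by <:].
HB.instance Definition _ := [SubIntegralDomain_isSubField of graph_field by <:].

Lemma graph_field_ex (u : graph_field) : exists y, G (val u) y.
Proof. by have /asboolP := valP u. Qed.

Definition graph_img (u : graph_field) : L := projT1 (cid (graph_field_ex u)).

Lemma graph_imgP u : G (val u) (graph_img u).
Proof. by rewrite /graph_img; case: cid. Qed.

Fact graph_img_zmod : zmod_morphism graph_img.
Proof.
move=> u v; apply: (graph_fun gG (graph_imgP _)).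
by rewrite rmorphB; apply: graphB => //; apply: graph_imgP.
Qed.
Fact graph_img_monoid : monoid_morphism graph_img.
Proof.
split=> [|u v]; apply: (graph_fun gG (graph_imgP _)).
  by rewrite rmorph1; apply: graph_1.
by rewrite rmorphM; apply: graphM => //; apply: graph_imgP.
Qed.
HB.instance Definition _ :=
  GRing.isZmodMorphism.Build graph_field L graph_img graph_img_zmod.
HB.instance Definition _ :=
  GRing.isMonoidMorphism.Build graph_field L graph_img graph_img_monoid.

Fact graph_in_subproof a : iota a \in graph_dom.
Proof. by apply/asboolP; exists (iota a); apply: graph_base. Qed.
Definition graph_in (a : F) : graph_field := GraphField (graph_in_subproof a).
Fact graph_in_zmod : zmod_morphism graph_in.
Proof. by move=> a b; apply: val_inj; rewrite /= rmorphB. Qed.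
Fact graph_in_monoid : monoid_morphism graph_in.
Proof. by split=> [|a b]; apply: val_inj; rewrite /= ?rmorph1 ?rmorphM. Qed.
HB.instance Definition _ :=
  GRing.isZmodMorphism.Build F graph_field graph_in graph_in_zmod.
HB.instance Definition _ :=
  GRing.isMonoidMorphism.Build F graph_field graph_in graph_in_monoid.

Lemma graph_img_in a : graph_img (graph_in a) = iota a.
Proof. by apply: (graph_fun gG (graph_imgP _)); apply: graph_base. Qed.

Hypothesis sep_alg : forall x : L, exists2 p : {poly F},
  separable_poly p & root (map_poly iota p) x.
Hypothesis sep_closed : forall p : {poly L}, separable_poly p ->
  (1 < size p)%N -> exists x, root p x.

(** Send x to another root of its conjugated minimal polynomial over the domain. The clause y != x
    makes fixed elements rational in [galois_fixed]. *)
Lemma graph_step x : ~ (exists y, G x y) ->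
  exists G' y, [/\ field_graph G', forall u v, G u v -> G' u v, G' x y & y != x].
Proof.
move=> Gx; have [f sep_f fx] := sep_alg x.
pose fE : {poly graph_field} := map_poly graph_in f.
have fEval : map_poly val fE = map_poly iota f.
  by rewrite -map_poly_comp; apply: eq_map_poly.
have fEimg : map_poly graph_img fE = map_poly iota f.
  by rewrite -map_poly_comp; apply: eq_map_poly => a /=; rewrite graph_img_in.
have [||p [p_irr pf px]] := @irreducible_root _ _ val x fE.
- by rewrite map_poly_eq0 separable_poly_neq0.
- by rewrite fEval.
(* A linear p would place x in the domain of G. *)
have sz_p : (2 < size p)%N.
  rewrite ltnNge; apply/negP => sz2; have [sz1 _] := p_irr.
  have sz : size p = 2 by apply/eqP; rewrite eqn_leq sz2 sz1.
  have := px; rewrite /root horner_coef size_map_poly sz !big_ord_recl big_ord0.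
  rewrite !coef_map expr0 mulr1 addr0 expr1 addrC addr_eq0 => /eqP px0.
  have p1 : val p`_1 != 0.
    rewrite fmorph_eq0; have := lead_coef_eq0 p; rewrite lead_coefE sz => ->.
    by rewrite -size_poly_gt0 sz.
  have Ex : x = val (- p`_0 / p`_1).
    by apply: (mulfI p1); rewrite px0 fmorph_div rmorphN /= mulrC mulfVK.
  by apply: Gx; rewrite Ex; apply: graph_field_ex.
have [||y py yx] := @separable_other_root _ (map_poly graph_img p) x sep_closed.
- apply: (@dvdp_separable _ (map_poly graph_img fE)); first by rewrite dvdp_map.
  by rewrite fEimg separable_map.
- by rewrite size_map_poly.
exists (adjoin_graph val graph_img x y), y; split=> //; last exact: adjoin_graphX.
  split.
  - move=> a; have := adjoin_graphC val graph_img x y (graph_in a).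
    by rewrite /= graph_img_in.
  - exact: adjoin_graphB.
  - exact: adjoin_graphM.
  - exact: (adjoin_graphV p_irr px py).
  - exact: (adjoin_graph0 p_irr px py).
move=> u v Guv; have uP : u \in graph_dom by apply/asboolP; exists v.
have <- : graph_img (GraphField uP) = v by apply: (graph_fun gG (graph_imgP _)).
exact: (adjoin_graphC val graph_img x y (GraphField uP)).
Qed.

End Domain.

Section Extension.
Hypothesis sep_alg : forall x : L, exists2 p : {poly F},
  separable_poly p & root (map_poly iota p) x.
Hypothesis sep_closed : forall p : {poly L}, separable_poly p ->
  (1 < size p)%N -> exists x, root p x.

Lemma graph_maximal G : field_graph G ->
  exists G', [/\ field_graph G', forall x y, G x y -> G' x y &
    forall G'', field_graph G'' -> (forall x y, G' x y -> G'' x y) ->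
      forall x y, G'' x y -> G' x y].
Proof.
move=> gG.
(* Zorn is applied to what is added to G, so that the empty chain is bounded by G itself. *)
pose ext (X : set (L * L)) x y := G x y \/ X (x, y).
have [|X [gX maxX]] := @Zorn_bigcup (L * L)%type (fun X => field_graph (ext X)).
  move=> C CP totC; have [[X0 CX0]|C0] := pselect (exists X, C X); last first.
    suff -> : (\bigcup_(X in C) X)%classic = classical_sets.set0.
      have -> // : ext classical_sets.set0 = G.
      by apply/funext => x; apply/funext => y; apply/propext; split=> [[]|] //; left.
    by apply/seteqP; split=> // z [X CX]; case: C0; exists X.
  set Y := (\bigcup_(X in C) X)%classic.
  have extY x y : ext Y x y -> exists2 X, C X & ext X x y.
    by case=> [Gxy|[X CX Xxy]]; [exists X0 => //; left | exists X => //; right].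
  have extS X x y : C X -> ext X x y -> ext Y x y.
    by move=> CX [?|?]; [left|right; exists X].
  have ext2 x y x' y' : ext Y x y -> ext Y x' y' ->
      exists X, [/\ C X, ext X x y & ext X x' y'].
    move=> /extY[X CX Xxy] /extY[X' CX' Xxy'].
    have [XX'|X'X] := totC _ _ CX CX'.
      by exists X'; split=> //; case: Xxy => [|/XX']; [left|right].
    by exists X; split=> //; case: Xxy' => [|/X'X]; [left|right].
  split.
  - by move=> a; left; apply: graph_base.
  - move=> x y x' y' /ext2/[apply] -[X [CX Xxy Xxy']].
    by apply: (extS X) => //; apply: (graphB (CP _ CX)).
  - move=> x y x' y' /ext2/[apply] -[X [CX Xxy Xxy']].
    by apply: (extS X) => //; apply: (graphM (CP _ CX)).
  - move=> x y /extY[X CX Xxy].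
    by apply: (extS X) => //; apply: (graphV (CP _ CX)).
  - by move=> x y /extY[X CX Xxy]; apply: (graph0 (CP _ CX)).
exists (ext X); split=> // [x y Gxy|G'' gG'' sub x y G''xy]; first by left.
apply: contrapT => Xxy; pose X' z := G'' z.1 z.2.
apply: (maxX X'); last first.
  suff -> : ext X' = G'' by [].
  apply/funext => u; apply/funext => v; apply/propext; split=> [[Guv|//]|]; last by right.
  by apply: sub; left.
split=> [[u v] Xuv|X'X]; first by apply: sub; right.
by apply: Xxy; right; apply: X'X.
Qed.

(** A maximal graph is total by [graph_step], and onto by [graph_step] applied to its transpose. *)
Lemma graph_total G : field_graph G ->
  exists G', [/\ field_graph G', forall x y, G x y -> G' x y,
    forall x, exists y, G' x y & forall y, exists x, G' x y].
Proof.
move=> /graph_maximal[G' [gG' sub maxG']]; exists G'; split=> // x.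
  apply: contrapT => G'x.
  have [G'' [y [gG'' sub' G''xy _]]] := graph_step gG' sep_alg sep_closed G'x.
  by apply: G'x; exists y; apply: (maxG' G'').
apply: contrapT => G'x.
have [G'' [y [gG'' sub' G''xy _]]] :=
  graph_step (field_graph_sym gG') sep_alg sep_closed G'x.
apply: G'x; exists y; apply: (maxG' (fun x y => G'' y x)) => //.
  exact: field_graph_sym.
by move=> u v; apply: sub'.
Qed.

Lemma graph_morphism G : field_graph G ->
  exists s : {rmorphism L -> L}, [/\ bijective s,
    forall a, s (iota a) = iota a & forall x y, G x y -> s x = y].
Proof.
move=> /graph_total[G' [gG' sub totl totr]].
have [f fP] := choice totl; have [g gP] := choice totr.
have fE x y : G' x y -> f x = y by apply: (graph_fun gG').
have f_zmod : zmod_morphism f by move=> x y; apply: fE; apply: graphB.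
have f_mon : monoid_morphism f.
  by split=> [|x y]; apply: fE; [apply: graph_1 | apply: graphM].
pose fz := GRing.isZmodMorphism.Build L L f f_zmod.
pose fm := GRing.isMonoidMorphism.Build L L f f_mon.
pose s : {rmorphism L -> L} := HB.pack f fz fm.
exists s; split=> /= [|a|x y Gxy].
- exists g => x; last exact: fE.
  by apply: (graph_fun (field_graph_sym gG') (gP _)).
- by apply: fE; apply: graph_base.
- by apply: fE; apply: sub.
Qed.

End Extension.
End FieldGraph.

Section SeparableClosure.
Context {k : finFieldType} {L : fieldType} (iota : {rmorphism ratfun k -> L}).
Hypothesis Lsep : separable_closure iota.

Lemma galois_extend G : field_graph iota G ->
  exists s : galaut iota, forall x y, G x y -> s x = y.
Proof.
case: Lsep => alg closed /graph_morphism[] // s [sbij sfix sG].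
by exists (GalAut sbij sfix).
Qed.

(** If x lies outside F(nu), the identity of F(nu) extends to an automorphism that moves x. Elements
    of F(nu) are polynomials in nu because nu is algebraic. *)
Lemma galois_fixed nu x :
  (forall s : galaut iota, s nu = nu -> s x = x) ->
  exists f : {poly ratfun k}, x = (map_poly iota f).[nu].
Proof.
case: (Lsep) => alg closed fix_x; have [f /separable_poly_neq0 f0 fnu] := alg nu.
have [p [p_irr _ pnu]] := irreducible_root f0 fnu.
have gG : field_graph iota (adjoin_graph iota iota nu nu).
  split.
  - exact: adjoin_graphC.
  - exact: adjoin_graphB.
  - exact: adjoin_graphM.
  - exact: (adjoin_graphV p_irr pnu pnu).
  - exact: (adjoin_graph0 p_irr pnu pnu).
have [[y [g [-> _]]]|] := pselect (exists y, adjoin_graph iota iota nu nu x y).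
  by exists g.
move=> /(graph_step gG alg closed)[G' [y [gG' sub G'xy /eqP[]]]].
have [s sG'] := galois_extend gG'; rewrite -(sG' _ _ G'xy); apply: fix_x.
by apply: sG'; apply: sub; apply: adjoin_graphX.
Qed.

Lemma galaut_comp (s t : galaut iota) : exists u : galaut iota, u =1 s \o t.
Proof.
have fixst a : (s \o t) (iota a) = iota a by rewrite /= !gal_fix.
by exists (GalAut (bij_comp (gal_bij s) (gal_bij t)) fixst).
Qed.

(** The inverse given by [gal_bij] is only a function; the transposed graph of s is extended to get
    a morphism. *)
Lemma galaut_inv (s : galaut iota) : exists t : galaut iota, cancel s t /\ cancel t s.
Proof.
have [f sK fK] := gal_bij s.
have gG : field_graph iota (fun x y => s y = x).
  split=> [a|x y x' y' <- <-|x y x' y' <- <-|x y <-|x y <-].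
  - exact: gal_fix.
  - exact: rmorphB.
  - exact: rmorphM.
  - exact: fmorphV.
  - exact: fmorph_eq0.
have [t tG] := galois_extend gG; exists t; split=> x; first exact: tG.
by rewrite -{1}(fK x) (tG _ (f x)).
Qed.

End SeparableClosure.

(** * Valuation rings *)

Section ValuationRing.
Context {L : fieldType}.

Record subring (R : L -> Prop) : Prop := Subring {
  subring1 : R 1;
  subringB : forall x y, R x -> R y -> R (x - y);
  subringM : forall x y, R x -> R y -> R (x * y) }.

Section Subring.
Context (R : L -> Prop) (subR : subring R).
Lemma subring0 : R 0. Proof. by rewrite -(subrr 1); apply: subringB => //; apply: subring1. Qed.
Lemma subringN x : R x -> R (- x).
Proof. by move=> Rx; rewrite -sub0r; apply: subringB => //; apply: subring0. Qed.
Lemma subringD x y : R x -> R y -> R (x + y).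
Proof. by move=> Rx Ry; rewrite -(opprK y); apply: subringB => //; apply: subringN. Qed.
Lemma subringX x n : R x -> R (x ^+ n).
Proof.
move=> Rx; elim: n => [|n IHn]; first by rewrite expr0; apply: subring1.
by rewrite exprS; apply: subringM.
Qed.
Lemma subring_sum I (r : seq I) (P : pred I) (E : I -> L) :
  (forall i, P i -> R (E i)) -> R (\sum_(i <- r | P i) E i).
Proof. by move=> RE; elim/big_ind: _ => //; [apply: subring0 | apply: subringD]. Qed.

Definition over (p : {poly L}) := forall i, R p`_i.

Lemma overC c : R c -> over c%:P.
Proof. by move=> Rc i; rewrite coefC; case: ifP => // _; apply: subring0. Qed.
Lemma overX : over 'X.
Proof. by move=> i; rewrite coefX; case: eqP => _; [apply: subring1 | apply: subring0]. Qed.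
Lemma overB p q : over p -> over q -> over (p - q).
Proof. by move=> Rp Rq i; rewrite coefB; apply: subringB. Qed.
Lemma overM p q : over p -> over q -> over (p * q).
Proof. by move=> Rp Rq i; rewrite coefM; apply: subring_sum => j _; apply: subringM. Qed.

Definition adjoin y z := exists2 p, over p & z = p.[y].

Lemma adjoin_subring y : subring (adjoin y).
Proof.
split=> [|_ _ [p Rp ->] [q Rq ->]|_ _ [p Rp ->] [q Rq ->]].
- by exists 1%:P; rewrite ?hornerC //; apply: overC; apply: subring1.
- by exists (p - q); rewrite ?hornerE //; apply: overB.
- by exists (p * q); rewrite ?hornerE //; apply: overM.
Qed.

End Subring.

Section Maximal.
Context (R0 : L -> Prop) (pi : L).
Hypotheses (subR0 : subring R0) (R0pi : R0 pi) (R0piV : ~ R0 pi^-1).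

Lemma subring_maximal : exists R, [/\ subring R, forall x, R0 x -> R x, ~ R pi^-1 &
  forall R', subring R' -> (forall x, R x -> R' x) -> ~ R' pi^-1 ->
    forall x, R' x -> R x].
Proof.
pose ext (X : set L) x := R0 x \/ X x.
have [|X [[sX XV] maxX]] :=
    @Zorn_bigcup L (fun X => subring (ext X) /\ ~ ext X pi^-1).
  move=> C CP totC; have [[X0 CX0]|C0] := pselect (exists X, C X); last first.
    suff -> : (\bigcup_(X in C) X)%classic = classical_sets.set0.
      suff -> : ext classical_sets.set0 = R0 by [].
      by apply/funext => x; apply/propext; split=> [[]|] //; left.
    by apply/seteqP; split=> // z [X CX]; case: C0; exists X.
  set Y := (\bigcup_(X in C) X)%classic.
  have extY x : ext Y x -> exists2 X, C X & ext X x.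
    by case=> [Rx|[X CX Xx]]; [exists X0 => //; left | exists X => //; right].
  have extS X x : C X -> ext X x -> ext Y x.
    by move=> CX [?|?]; [left|right; exists X].
  have ext2 x y : ext Y x -> ext Y y -> exists X, [/\ C X, ext X x & ext X y].
    move=> /extY[X CX Xx] /extY[X' CX' Xy].
    have [XX'|X'X] := totC _ _ CX CX'.
      by exists X'; split=> //; case: Xx => [|/XX']; [left|right].
    by exists X; split=> //; case: Xy => [|/X'X]; [left|right].
  split; last by move=> /extY[X CX]; have [] := CP _ CX.
  split.
  - by left; apply: subring1.
  - move=> x y /ext2/[apply] -[X [CX Xx Xy]].
    by apply: (extS X) => //; apply: (subringB (CP _ CX).1).
  - move=> x y /ext2/[apply] -[X [CX Xx Xy]].
    by apply: (extS X) => //; apply: (subringM (CP _ CX).1).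
exists (ext X); split=> // [x Rx|R' sR' sub R'V x R'x]; first by left.
apply: contrapT => Xx; apply: (maxX R'); last first.
  suff -> : ext R' = R' by [].
  apply/funext => u; apply/propext; split=> [[R0u|//]|]; last by right.
  by apply: sub; left.
split=> [u Xu|R'X]; first by apply: sub; right.
by apply: Xx; right; apply: R'X.
Qed.

(* A maximal subring in which pi is not invertible is a valuation ring. *)
Lemma valuation_ring_exists : exists R,
  [/\ subring R, forall x, R0 x -> R x, ~ R pi^-1 & forall x, R x \/ R x^-1].
Proof.
have [R [sR R0R RV maxR]] := subring_maximal; exists R; split=> //.
have pi0 : pi != 0.
  by apply: contra_notN RV => /eqP ->; rewrite invr0; apply: subring0.
(* By maximality, adjoining any y outside R makes pi invertible. *)
have adj y : ~ R y -> adjoin R y pi^-1.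
  move=> Ry; apply: contrapT => adjV; apply: Ry.
  apply: (maxR (adjoin R y)) => //; first exact: adjoin_subring.
    by move=> x Rx; exists x%:P; rewrite ?hornerC //; apply: overC.
  by exists 'X; rewrite ?hornerX //; apply: overX.
have Rpi : R pi by apply: R0R.
(* Otherwise pi^-1 is a polynomial in d^-1; multiplying by a power of d, which is again 1 modulo pi,
   puts pi^-1 in R. *)
have unit1 r : R r -> R (1 + pi * r)^-1.
  move=> Rr; apply: contrapT => /[dup] RdV /adj[p Rp].
  set d := 1 + pi * r in RdV *; have Rd : R d by apply: subringD => //; [apply: subring1 | apply: subringM].
  have d0 : d != 0.
    by apply: contra_notN RdV => /eqP ->; rewrite invr0; apply: subring0.
  have [r' Rr' dE] : exists2 r', R r' & d ^+ size p = 1 + pi * r'.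
    elim: (size p) => [|n [r' Rr' dE]]; first by exists 0; [apply: subring0 | rewrite mulr0 addr0].
    exists (r' + r + pi * r * r'); last by rewrite exprS dE /d; ring.
    by apply: subringD => //; [apply: subringD | apply: subringM => //; apply: subringM].
  rewrite horner_coef => /(congr1 (fun z => d ^+ size p * z)).
  rewrite mulr_sumr {1}dE mulrDl mul1r mulrAC mulfV // mul1r => pE.
  apply: RV; rewrite -[pi^-1](addrK r') pE; apply: subringB => //; apply: subring_sum => // i _.
  rewrite mulrCA; apply: subringM => //; rewrite exprVn -expfB //; exact: subringX.
(* If neither x nor x^-1 is in R, then pi^-1 is a polynomial in each; infinite descent on the total
   size of the two polynomials. *)
suff noboth N (p q : {poly L}) x : (size p + size q <= N)%N -> over R p -> over R q -> x != 0 ->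
    p.[x] = pi^-1 -> q.[x^-1] = pi^-1 -> False.
  move=> x; have [->|x0] := eqVneq x 0; first by left; apply: subring0.
  apply: contrapT => /not_orP[/adj[p Rp pE] /adj[q Rq qE]].
  by apply: (noboth _ p q x (leqnn _)).
elim: N p q x => [|N IHN] p q x.
  rewrite leqn0 addn_eq0 size_poly_eq0 => /andP[/eqP -> _] _ _ _.
  by rewrite horner0 => /esym/eqP; rewrite invr_eq0 (negPf pi0).
wlog le_qp : p q x / (size q <= size p)%N.
  move=> wl le_N Rp Rq x0 pE qE; have [le_qp|/ltnW le_pq] := leqP (size q) (size p).
    exact: (wl p q x).
  by apply: (wl q p x^-1); rewrite ?invrK ?invr_eq0 // addnC.
move=> le_N Rp Rq x0 pE qE.
have p0 : (0 < size p)%N.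
  rewrite lt0n size_poly_eq0; apply: contra_eqN pE => /eqP ->.
  by rewrite horner0 eq_sym invr_eq0.
have q0 : (0 < size q)%N.
  rewrite lt0n size_poly_eq0; apply: contra_eqN qE => /eqP ->.
  by rewrite horner0 eq_sym invr_eq0.
have [n szp] : exists n, size p = n.+1 by exists (size p).-1; rewrite prednK.
have [m szq] : exists m, size q = m.+1 by exists (size q).-1; rewrite prednK.
rewrite szp szq ltnS in le_qp le_N.
pose c := (1 - pi * q`_0)^-1.
have Rc : R c by rewrite /c -mulrN; apply: unit1; apply: subringN.
have c0 : 1 - pi * q`_0 != 0.
  apply: contra_notN RV; rewrite subr_eq0 => /eqP q1.
  have -> : pi^-1 = q`_0 by apply: (mulfI pi0); rewrite mulfV.
  exact: Rq.
(* The relation pi q(x^-1) = 1 has the invertible part 1 - pi q_0, so x^n is an R-combination of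
   lower powers and the leading term of p can be replaced. *)
have xn : x ^+ n = \sum_(j < m) c * pi * q`_j.+1 * x ^+ (n - j.+1).
  have : pi * q.[x^-1] = 1 by rewrite qE mulfV.
  rewrite horner_coef szq big_ord_recl expr0 mulr1 mulrDr => q1.
  rewrite -[LHS]mul1r -{1}(mulVf c0) -/c -mulrA.
  have -> : 1 - pi * q`_0 = pi * \sum_(j < m) q`_j.+1 * x^-1 ^+ j.+1.
    by rewrite -[X in X - _]q1 addrC addKr.
  rewrite mulr_sumr mulr_suml mulr_sumr; apply: eq_bigr => j _.
  have jn : (j.+1 <= n)%N by exact: leq_trans (ltn_ord j) le_qp.
  rewrite -[in x ^+ n](subnK jn) exprD exprVn.
  by have : x ^+ j.+1 != 0 by [rewrite expf_neq0]; set y := x ^+ j.+1 => y0; field.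
pose p' := \poly_(i < n) p`_i +
  \sum_(j < m) (p`_n * (c * pi * q`_j.+1))%:P * 'X^(n - j.+1).
have sz_p' : (size p' <= n)%N.
  rewrite (leq_trans (size_polyD _ _)) // geq_max size_poly /=.
  rewrite (leq_trans (size_sum _ _ _)) //; apply/bigmax_leqP => j _.
  rewrite mul_polyC (leq_trans (size_scale_leq _ _)) // size_polyXn.
  by have := leq_trans (ltn_ord j) le_qp; lia.
apply: (IHN p' q x) => //; first by rewrite szq; move: le_N sz_p'; lia.
  move=> i; rewrite coefD coef_poly coef_sum; apply: subringD => //.
    by case: ifP => // _; apply: subring0.
  apply: subring_sum => // j _; rewrite coefCM coefXn; apply: subringM => //.
    by apply: subringM => //; apply: subringM => //; apply: subringM.
  by case: eqP => _; [apply: subring1 | apply: subring0].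
rewrite -pE hornerD horner_poly horner_sum [in RHS]horner_coef szp big_ord_recr /=.
congr (_ + _); rewrite xn mulr_sumr; apply: eq_bigr => j _.
by rewrite hornerM hornerC hornerXn; ring.
Qed.

End Maximal.
End ValuationRing.

Section Units.
Context {L : fieldType} (O : L -> Prop).
Hypotheses (subO : subring O) (O_total : forall x, O x \/ O x^-1).

Definition vunit x := [/\ x != 0, O x & O x^-1].
(** The maximal ideal of O. Zero has its own clause because 0^-1 = 0 belongs to O. *)
Definition vmax x := x = 0 \/ ~ O x^-1.

Lemma vmaxO x : vmax x -> O x.
Proof. by case=> [->|xV]; [apply: subring0 | case: (O_total x)]. Qed.

Lemma vmax0 : vmax 0. Proof. by left. Qed.

Lemma vmaxMl x y : O x -> vmax y -> vmax (x * y).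
Proof.
move=> Ox; have [->|x0] := eqVneq x 0; first by rewrite mul0r; left.
case=> [->|yV]; [by left; rewrite mulr0 | right=> xyV; apply: yV].
have -> : y^-1 = x * (x * y)^-1 by rewrite invfM mulVKf.
exact: subringM.
Qed.

Lemma vmaxMr x y : vmax x -> O y -> vmax (x * y).
Proof. by move=> mx Oy; rewrite mulrC; apply: vmaxMl. Qed.

Lemma vmaxN x : vmax x -> vmax (- x).
Proof.
by move=> mx; rewrite -mulN1r; apply: vmaxMl => //; apply: subringN => //; apply: subring1.
Qed.

Lemma vmaxD x y : vmax x -> vmax y -> vmax (x + y).
Proof.
have [->|x0] := eqVneq x 0; first by rewrite add0r.
have [->|y0] := eqVneq y 0; first by rewrite addr0.
move=> mx my; have [xy|yx] := O_total (x / y).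
  have -> : x + y = (x / y + 1) * y by rewrite mulrDl mul1r divfK.
  by apply: vmaxMl => //; apply: subringD => //; apply: subring1.
have -> : x + y = ((x / y)^-1 + 1) * x by rewrite invf_div mulrDl mul1r divfK // addrC.
by apply: vmaxMl => //; apply: subringD => //; apply: subring1.
Qed.

Lemma vmaxB x y : vmax x -> vmax y -> vmax (x - y).
Proof. by move=> mx my; apply: vmaxD => //; apply: vmaxN. Qed.

Lemma vmax_sum I (r : seq I) (P : pred I) (E : I -> L) :
  (forall i, P i -> vmax (E i)) -> vmax (\sum_(i <- r | P i) E i).
Proof. by move=> mE; elim/big_ind: _ => //; [apply: vmax0 | apply: vmaxD]. Qed.

Lemma vunit1 : vunit 1.
Proof. by split; rewrite ?invr1 ?oner_eq0 //; apply: subring1. Qed.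
Lemma vunitM x y : vunit x -> vunit y -> vunit (x * y).
Proof.
by move=> [x0 Ox OxV] [y0 Oy OyV]; split; rewrite ?mulf_neq0 ?invfM //; apply: subringM.
Qed.
Lemma vunitV x : vunit x -> vunit x^-1.
Proof. by move=> [x0 Ox OxV]; split; rewrite ?invr_eq0 ?invrK. Qed.
Lemma vunitX x n : vunit x -> vunit (x ^+ n).
Proof.
move=> Ux; elim: n => [|n IHn]; first by rewrite expr0; apply: vunit1.
by rewrite exprS; apply: vunitM.
Qed.
Lemma vunitN x : vunit x -> vunit (- x).
Proof.
by case=> x0 Ox OxV; split; rewrite ?oppr_eq0 ?invrN //; apply: subringN.
Qed.
Lemma vunitO x : vunit x -> O x. Proof. by case. Qed.

Lemma vmax1 : ~ vmax 1.
Proof.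
by case=> [/eqP|]; [rewrite oner_eq0 | apply; rewrite invr1; apply: subring1].
Qed.

Lemma vunit_vmax x : vunit x -> ~ vmax x.
Proof. by move=> [x0 Ox OxV] [/eqP|//]; apply/negP. Qed.

Lemma vunitP x : O x -> ~ vmax x -> vunit x.
Proof.
move=> Ox /not_orP[/eqP x0 /contrapT OxV]; by split.
Qed.

Lemma vmaxV x : ~ O x -> vmax x^-1.
Proof. by right; rewrite invrK. Qed.

Lemma vunitDm u x : vunit u -> vmax x -> vunit (u + x).
Proof.
move=> Uu mx; apply: vunitP => [|mux].
  by apply: subringD => //; [apply: vunitO | apply: vmaxO].
by apply: (vunit_vmax Uu); rewrite -[u](addrK x); apply: vmaxB.
Qed.

Lemma vmax_prime x y : O x -> O y -> vmax (x * y) -> vmax x \/ vmax y.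
Proof.
move=> Ox Oy mxy; apply: contrapT => /not_orP[mx my].
by apply: (vunit_vmax _ mxy); apply: vunitM; apply: vunitP.
Qed.

Lemma vmax_prod (I : eqType) (r : seq I) (E : I -> L) :
  (forall i, O (E i)) -> vmax (\prod_(i <- r) E i) -> exists i, vmax (E i).
Proof.
move=> OE; elim: r => [|i r IHr]; first by rewrite big_nil => /vmax1.
rewrite big_cons => /vmax_prime[//| |mi|//]; last by exists i.
by elim/big_ind: _ => //; [apply: subring1 | apply: subringM].
Qed.

Lemma vmaxXn x n : vmax (x ^+ n) -> vmax x.
Proof.
move=> mxn; apply: contrapT => /not_orP[/eqP x0 /contrapT OxV].
case: mxn => [/eqP|]; first by rewrite expf_eq0 (negPf x0) andbF.
by apply; rewrite -exprVn; apply: subringX.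
Qed.

Lemma vmaxX x n : (0 < n)%N -> vmax x -> vmax (x ^+ n).
Proof.
by case: n => // n _ mx; rewrite exprS; apply: vmaxMr => //; apply: subringX => //; apply: vmaxO.
Qed.

Lemma O_max_elt (s : seq L) : s != [::] -> all (fun x => x != 0) s ->
  exists2 t, t \in s & forall u, u \in s -> O (u / t).
Proof.
elim: s => // x s IHs _ /= /andP[x0 s0]; have [->|sn0] := eqVneq s [::].
  by exists x; rewrite ?inE // => u; rewrite inE => /eqP ->; rewrite divff //; apply: subring1.
have [t ts tmax] := IHs sn0 s0; have t0 : t != 0 by apply: (allP s0).
have [xt|tx] := O_total (x / t).
  by exists t; [rewrite inE ts orbT | move=> u; rewrite inE => /orP[/eqP -> //|/tmax]].
exists x; rewrite ?inE ?eqxx // => u; rewrite inE => /orP[/eqP ->|/tmax ut].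
  by rewrite divff //; apply: subring1.
have -> : u / x = (u / t) * (x / t)^-1 by rewrite invf_div mulrA divfK.
exact: subringM.
Qed.

Context (pi : L).
Hypothesis OpiV : ~ O pi^-1.

Lemma pi_neq0 : pi != 0.
Proof. by apply: contra_notN OpiV => /eqP ->; rewrite invr0; apply: subring0. Qed.
Lemma vmax_pi : vmax pi. Proof. by right. Qed.

(** The nonzero elements of integer valuation, with pi of valuation 1; O itself need not be
    discrete. *)
Definition intval (z : L) := exists (e : int) (u : L), vunit u /\ z = pi ^ e * u.

Lemma intval_pi_inj (a b : int) u v :
  vunit u -> vunit v -> pi ^ a * u = pi ^ b * v -> a = b.
Proof.
wlog ab : a b u v / (a <= b)%R.
  move=> wl Uu Uv E; have [ab|/Order.POrderTheory.ltW ba] := Order.TotalTheory.leP a b.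
    exact: (wl a b u v).
  by apply/esym/(wl b a v u).
move=> Uu Uv; rewrite -(subrK a b) expfzDr ?pi_neq0 // mulrAC [_ * u]mulrC.
move=> /(mulIf (expfz_neq0 _ pi_neq0)) uE.
have : (0 <= b - a)%R by rewrite Num.Theory.subr_ge0.
case: (b - a) uE => [[|n]|] // uE _; last 1 first.
  case: (@vunit_vmax u) => //; rewrite uE -exprnP; apply: vmaxMr; last exact: vunitO.
  by apply: vmaxX => //; apply: vmax_pi.
by rewrite add0r.
Qed.

Lemma intvalM x y : intval x -> intval y -> intval (x * y).
Proof.
move=> [a [u [Uu ->]]] [b [v [Uv ->]]]; exists (a + b), (u * v).
by split; [apply: vunitM | rewrite expfzDr ?pi_neq0 //; ring].
Qed.
Lemma intvalV x : intval x -> intval x^-1.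
Proof.
move=> [a [u [Uu ->]]]; exists (- a), u^-1; split; first exact: vunitV.
by rewrite invfM invr_expz.
Qed.
Lemma intval_unit u : vunit u -> intval u.
Proof. by exists 0, u; rewrite expr0z mul1r. Qed.
Lemma intval_pi : intval pi.
Proof. by exists 1, 1; split; [apply: vunit1 | rewrite mulr1]. Qed.

(* Two terms of a vanishing sum must have the same, largest, size. *)
Lemma ramified_degree (p : {poly L}) (x : L) D : p != 0 ->
  (forall i, p`_i != 0 -> intval p`_i) -> root p x -> vunit (x ^+ D / pi) ->
  (D < size p)%N.
Proof.
move=> p0 ip px Ux; have [->|D0] := posnP D; first by rewrite size_poly_gt0.
have xD0 : x ^+ D != 0 by case: Ux; rewrite mulf_eq0 negb_or => /andP[].
have x0 : x != 0 by move: xD0; rewrite expf_eq0 D0.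
pose t i := p`_i * x ^+ i.
pose s := [seq t i | i <- iota 0 (size p) & p`_i != 0].
have [||_ /mapP[i + ->] tmax] := @O_max_elt s.
- apply/eqP => /(congr1 (mem^~ (t (size p).-1))) /=; rewrite /mem in_nil => /negP[].
  apply: map_f; rewrite mem_filter mem_iota -lead_coefE lead_coef_eq0 p0 /=.
  by rewrite prednK ?leqnn ?size_poly_gt0.
- by apply/allP => _ /mapP[i + ->]; rewrite mem_filter => /andP[pi0 _]; rewrite mulf_neq0 ?expf_neq0.
rewrite mem_filter mem_iota /= add0n => /andP[pi0 szi].
have ti0 : t i != 0 by rewrite mulf_neq0 ?expf_neq0.
(* If t_i strictly dominated all other terms, p(x) / t_i would be a unit instead of 0. *)
have [j [szj ji tj]] : exists j, [/\ (j < size p)%N, j != i & ~ vmax (t j / t i)].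
  apply: contrapT => no; suff : vunit (p.[x] / t i).
    by rewrite (rootP px) mul0r => -[]; rewrite eqxx.
  rewrite horner_coef mulr_suml (bigD1 (Ordinal szi)) //= -/(t i) divff //.
  apply: vunitDm; first exact: vunit1.
  apply: vmax_sum => j ji; apply: contrapT => tj; apply: no.
  by exists j; split=> //; apply: contra ji => /eqP ji; apply/eqP/val_inj.
have pj0 : p`_j != 0.
  by apply: contra_notN tj => /eqP pj0; rewrite /t pj0 !mul0r; left.
have Uji : vunit (t j / t i).
  apply: vunitP => //; apply: tmax; apply: map_f.
  by rewrite mem_filter pj0 mem_iota.
have [a [u [Uu pjE]]] := ip _ pj0; have [b [v [Uv piE]]] := ip _ pi0.
set w := x ^+ D / pi in Ux; have xE : x ^+ D = pi * w by rewrite mulrC divfK // pi_neq0.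
set r := t j / t i in Uji; have tjE : t j = r * t i by rewrite divfK.
clearbody w r.
(* This is D times the equality of valuations of t_j and t_i, where x has valuation 1/D. Hence D
   divides the nonzero difference of i and j. *)
have eqv : a * D%:Z + j%:Z = b * D%:Z + i%:Z.
  apply: (@intval_pi_inj _ _ (u ^+ D * w ^+ j) (r ^+ D * v ^+ D * w ^+ i)).
  - by apply: vunitM; apply: vunitX.
  - by do ?apply: vunitM; apply: vunitX.
  have pz c : pi ^ (c * D%:Z) = (pi ^ c) ^+ D by rewrite exprnP exprz_exp.
  have := congr1 (fun z => z ^+ D) tjE; rewrite /t pjE piE !exprMn -!exprM.
  rewrite ![(_ * D)%N]mulnC !exprM xE !exprMn !expfzDr ?pi_neq0 // !pz -!exprnP.
  by move=> E; rewrite mulrACA E; ring.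
have [ij|ij|ij] := ltngtP i j; last by rewrite ij eqxx in ji.
- apply: leq_ltn_trans (leq_trans _ (leq_subr i j)) szj.
  have : (D%:Z * (b - a) = (j - i)%N%:Z)%R.
    by rewrite -subzn ?(ltnW ij) //; move: eqv; clear; nia.
  move=> E; apply: dvdn_leq; first by rewrite subn_gt0.
  by have := dvdz_mulr (b - a) (dvdzz D%:Z); rewrite E dvdzE.
- apply: leq_ltn_trans (leq_trans _ (leq_subr j i)) szi.
  have : (D%:Z * (a - b) = (i - j)%N%:Z)%R.
    by rewrite -subzn ?(ltnW ij) //; move: eqv; clear; nia.
  move=> E; apply: dvdn_leq; first by rewrite subn_gt0.
  by have := dvdz_mulr (a - b) (dvdzz D%:Z); rewrite E dvdzE.
Qed.

End Units.

(** * Places of F_q[T] *)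

Lemma fraction_numden (R : idomainType) (x : {fraction R}) :
  exists n d : R, d != 0 /\ x = tofrac n / tofrac d.
Proof.
elim/quotW: x => x; exists (frac x).1, (frac x).2; split; first exact: denom_ratioP.
have d0 : tofrac (frac x).2 != 0 :> {fraction R} by rewrite tofrac_eq0 denom_ratioP.
apply: (mulIf d0); rewrite divfK //; unlock FracField.tofrac.
rewrite -[LHS]FracField.pi_mul; apply/eqmodP; rewrite /= FracField.equivfE /FracField.mulf.
by rewrite !numden_Ratio ?(oner_eq0, mulf_neq0, denom_ratioP) // !mulr1 mulrC.
Qed.

Fact clear_denominators_aux (R : comNzRingType) (E E' D P X N : R) :
  E * E' = 1 -> E * (D * P) * X + D * N = D * E * (P * X + N * E').
Proof. by move=> EE'; rewrite -[D * N]mulr1 -EE'; ring. Qed.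

Section Place.
Local Notation tf := (@FracField.tofrac _).
Context {k : finFieldType} {L : fieldType} (iota : {rmorphism ratfun k -> L}).

Definition polyL : {poly k} -> L := iota \o @FracField.tofrac {poly k}.
HB.instance Definition _ := GRing.RMorphism.on polyL.

Definition constL : k -> L := polyL \o polyC.
HB.instance Definition _ := GRing.RMorphism.on constL.

Lemma polyL_eq0 a : (polyL a == 0) = (a == 0).
Proof. by rewrite /polyL /= fmorph_eq0 tofrac_eq0. Qed.

Lemma polyL_inj : injective polyL.
Proof. by apply: raddf_inj => a /eqP; rewrite polyL_eq0 => /eqP. Qed.

Lemma constL_eq0 c : (constL c == 0) = (c == 0).
Proof. exact: fmorph_eq0. Qed.

(* A valuation ring of L extending the local ring of A at the prime T - a. *)
Record place (a : k) (O : L -> Prop) : Prop := Place {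
  place_subring : subring O;
  place_total : forall x, O x \/ O x^-1;
  place_poly : forall b, O (polyL b);
  place_pi : ~ O (polyL ('X - a%:P))^-1 }.

(** Start from the ring A, where evaluation at a shows that T - a has no inverse. *)
Lemma place_exists a : exists O, place a O.
Proof.
pose R0 x := exists b, x = polyL b.
have [|||R [sR R0R RV Rtot]] := @valuation_ring_exists L R0 (polyL ('X - a%:P)).
- split=> [|_ _ [b ->] [c ->]|_ _ [b ->] [c ->]].
  + by exists 1; rewrite rmorph1.
  + by exists (b - c); rewrite rmorphB.
  + by exists (b * c); rewrite rmorphM.
- by exists ('X - a%:P).
- move=> [b bE]; have : ('X - a%:P) * b = 1.
    apply: polyL_inj; rewrite rmorphM rmorph1 /= -bE divff //.
    by rewrite polyL_eq0 polyXsubC_eq0.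
  move=> /(congr1 (horner^~ a)) /eqP.
  by rewrite !hornerE subrr mul0r eq_sym oner_eq0.
by exists R; split=> // b; apply: R0R; exists b.
Qed.

Section AtPlace.
Context (a : k) (O : L -> Prop) (plO : place a O).
Local Notation pi := (polyL ('X - a%:P)).
Local Notation U := (vunit O).
Local Notation m := (vmax O).
Let sO := place_subring plO.
Let tO := place_total plO.

Lemma constL_unit c : c != 0 -> U (constL c).
Proof.
move=> c0; split; rewrite ?constL_eq0 //; first exact: (place_poly plO).
by rewrite -fmorphV; apply: (place_poly plO).
Qed.

Lemma polyL_decomp b : exists c, polyL b = constL b.[a] + pi * polyL c.
Proof.
have : root (b - b.[a]%:P) a by rewrite /root !hornerE subrr.
move=> /factor_theorem[c bE]; exists c.
have -> : b = b.[a]%:P + ('X - a%:P) * c by rewrite mulrC -bE addrC subrK.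
rewrite rmorphD rmorphM /=; congr (constL _ + _).
by rewrite hornerD hornerC hornerM hornerXsubC subrr mul0r addr0.
Qed.

Lemma polyL_unit b : b.[a] != 0 -> U (polyL b).
Proof.
have [c ->] := polyL_decomp b => b0; apply: vunitDm => //; first exact: constL_unit.
apply: vmaxMr => //; last exact: (place_poly plO).
by right; apply: place_pi plO.
Qed.

Lemma polyL_intval b : b != 0 -> intval O pi (polyL b).
Proof.
have [n [c + bE]] := multiplicity_XsubC b a.
move=> + b0; rewrite b0 /= => ca; exists n, (polyL c); split; first exact: polyL_unit.
by rewrite bE rmorphM rmorphXn mulrC.
Qed.

Let OpiV := place_pi plO.

Lemma iota_intval z : iota z != 0 -> intval O pi (iota z).
Proof.
have [n [d [d0 ->]]] := fraction_numden z; rewrite fmorph_div mulf_eq0 negb_or.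
move=> /andP[n0 _]; apply: intvalM => //; first by apply: polyL_intval; rewrite -polyL_eq0.
by apply: intvalV => //; apply: polyL_intval.
Qed.

Section Unramified.
Context (f : {poly {poly k}}) (nu : L) (c : k).
Hypotheses (fnu : root (map_poly polyL f) nu) (Onu : O nu) (c0 : c != 0).
Hypothesis f_sep : (map_poly (horner_eval a) f)^`() = c%:P.

Local Notation ev b := ((map_poly polyL b).[nu]).
Local Notation red b := (map_poly (horner_eval a) b).
Local Notation evk h := ((map_poly constL h).[nu]).

(** The expansion b = b(a) + (T - a) c, applied to each coefficient of a polynomial over A. *)
Lemma red_decomp (b : {poly {poly k}}) :
  exists b', ev b = evk (red b) + pi * ev b'.
Proof.
pose F0 (c : {poly k}) := (c - c.[a]%:P) %/ ('X - a%:P).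
have F00 : F0 0 = 0 by rewrite /F0 horner0 subr0 div0p.
exists (map_poly F0 b).
have <- : ev (map_poly polyC (red b)) = evk (red b).
  by rewrite -map_poly_comp.
rewrite -[pi](hornerC _ nu) -[_%:P](map_polyC polyL) -hornerM -hornerD -rmorphM -rmorphD /=.
congr (_.[nu]); congr map_poly; apply/polyP => i.
rewrite coefD coefCM (coef_map_id0 b i F00) !coef_map /= /F0 mulrC divpK ?subrKC //.
by rewrite dvdp_XsubCl /root !hornerE subrr.
Qed.

Lemma O_evk h : O (evk h).
Proof.
rewrite horner_coef; apply: subring_sum => // i _; apply: subringM => //; last exact: subringX.
by rewrite coef_map; apply: (place_poly plO).
Qed.

Lemma O_ev b : O (ev b).
Proof.
rewrite horner_coef; apply: subring_sum => // i _; apply: subringM => //; last exact: subringX.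
by rewrite coef_map; apply: (place_poly plO).
Qed.

Let mpi : m pi. Proof. by right. Qed.

(** Here g is the minimal polynomial over k of the residue of nu. If h also vanished there, g^2
    would divide the reduction of f, so g would divide its derivative, a nonzero constant. *)
Lemma residue_minpoly : exists g h : {poly k},
  [/\ forall b, m (evk b) -> g %| b, red f = g * h & ~ m (evk h)].
Proof.
have red0 : red f != 0.
  by apply: contraNneq c0 => r0; move: f_sep; rewrite r0 deriv0 => /esym/eqP; rewrite polyC_eq0.
have mf : m (evk (red f)).
  have [b' /eqP] := red_decomp f; rewrite (rootP fnu) eq_sym addr_eq0 => /eqP ->.
  by apply: vmaxN => //; apply: vmaxMr => //; apply: O_ev.
pose P n := `[< exists p : {poly k}, [/\ p != 0, size p = n & m (evk p)] >].
have exP : exists n, P n by exists (size (red f)); apply/asboolP; exists (red f).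
case: (ex_minnP exP) => n /asboolP[g [g0 <- mg]] ming.
have gdvd b : m (evk b) -> g %| b.
  move=> mb; rewrite /dvdp; apply: contraT => r0.
  have : P (size (b %% g)).
    apply/asboolP; exists (b %% g); split=> //.
    have -> : b %% g = b - b %/ g * g by rewrite {2}(divp_eq b g) addrC addKr.
    rewrite rmorphB rmorphM !hornerE; apply: vmaxB => //; apply: vmaxMl => //.
    exact: O_evk.
  by move=> /ming; rewrite leqNgt ltn_modp g0.
have /dvdpP[h fE] := gdvd _ mf; exists g, h; split; rewrite ?fE 1?mulrC // => mh.
have /dvdpP[h' hE] := gdvd _ mh.
have : g %| c%:P.
  rewrite -f_sep fE hE !derivM; apply: dvdp_add; last by rewrite dvdp_mulr // dvdp_mull.
  by rewrite dvdp_mull.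
move=> /dvdp_leq; rewrite polyC_eq0 size_polyC c0 => /(_ isT)/size1_polyC gE.
apply: (vunit_vmax _ mg); rewrite gE map_polyC hornerC; apply: constL_unit.
by rewrite -polyC_eq0 -gE.
Qed.

(** If b(nu) is not a unit, a factor pi can be extracted with a cofactor still in A[nu], up to the
    unit h(nu). The bound N makes this stop, since O is not known to be discrete. *)
Lemma ev_intval_bounded N b : (forall y, O y -> ev b <> pi ^+ N * y) ->
  ev b != 0 -> intval O pi (ev b).
Proof.
have [g [h [gdvd fE mh]]] := residue_minpoly.
have evC p : ev (map_poly polyC p) = evk p by rewrite -map_poly_comp.
have Uh : U (evk h) by apply: vunitP => //; apply: O_evk.
have h0 : evk h != 0 by case: Uh.
elim: N b => [|N IHN] b bN b0; first by case: (bN (ev b)); [apply: O_ev | rewrite mul1r].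
have [b' bE] := red_decomp b.
have [mb|mb] := pselect (m (evk (red b))); last first.
  apply: intval_unit; rewrite bE; apply: vunitDm => //; first exact: (vunitP (O_evk _)).
  by apply: vmaxMr => //; apply: O_ev.
have /dvdpP[b1 b1E] := gdvd _ mb; have [f' ff'] := red_decomp f.
pose b2 := b' * map_poly polyC h - f' * map_poly polyC b1.
(* The reduction of b is b1 g, and f(nu) = 0 gives g(nu) h(nu) = - pi f'(nu), where f' is the
   cofactor from [red_decomp] and not a derivative. *)
have b2E : ev b = pi * ev b2 / evk h.
  apply: (mulIf h0); rewrite divfK //.
  have -> : ev b2 = ev b' * evk h - ev f' * evk b1.
    by rewrite /b2 rmorphB hornerD hornerN !rmorphM !hornerM !evC.
  rewrite bE b1E rmorphM hornerM.
  move: ff'; rewrite (rootP fnu) fE rmorphM hornerM => ff'.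
  apply/eqP; rewrite -subr_eq0 -(mulr0 (evk b1)) ff'; apply/eqP; ring.
rewrite b2E; apply: intvalM => //; last by apply: intval_unit; apply: vunitV.
apply: intvalM => //; first exact: intval_pi.
apply: IHN => [y Oy yE|]; last by apply: contraNneq b0 => b20; rewrite b2E b20 mulr0 mul0r.
apply: (bN (y / evk h)); last by rewrite b2E yE exprS; ring.
by apply: subringM => //; case: Uh.
Qed.

End Unramified.
End AtPlace.

Lemma clear_denominators (p : {poly ratfun k}) :
  exists (d : {poly k}) (P : {poly {poly k}}), d != 0 /\ 
    map_poly tf P = (tf d)%:P * p.
Proof.
elim/poly_ind: p => [|p z [d [P [d0 PE]]]].
  by exists 1, 0; rewrite rmorph0 mulr0 oner_eq0.
have [n [e [e0 zE]]] := fraction_numden z.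
exists (d * e), (e%:P * P * 'X + (d * n)%:P); rewrite mulf_neq0 //; split=> //.
rewrite rmorphD !rmorphM /= !map_polyC map_polyX /= PE zE !rmorphM /=.
have te0 : tofrac e != 0 :> ratfun k by rewrite tofrac_eq0.
have : (tofrac e)%:P * ((tofrac e)^-1)%:P = 1 :> {poly ratfun k}.
  by rewrite -rmorphM divff.
exact: clear_denominators_aux.
Qed.

Section Algebraic.
Hypothesis Lsep : separable_closure iota.

Lemma algebraic_const z : z != 0 -> exists P : {poly {poly k}},
  P`_0 != 0 /\ root (map_poly polyL P) z.
Proof.
move=> z0; case: Lsep => alg _; have [p /separable_poly_neq0 p0 pz] := alg z.
have [d [P [d0 PE]]] := clear_denominators p.
have [n [Q + QE]] := multiplicity_XsubC P 0; have P0 : P != 0.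
  rewrite -(map_poly_eq0_id0 (f := @FracField.tofrac {poly k})) ?PE ?mulf_neq0 ?polyC_eq0 ?tofrac_eq0 //.
  by rewrite lead_coef_eq0; apply: contraNneq p0 => P0; move: PE; rewrite P0 rmorph0 => /esym/eqP; rewrite mulf_eq0 polyC_eq0 tofrac_eq0 (negPf d0).
rewrite P0 /= => Q0; exists Q; split; first by rewrite -horner_coef0.
have : root (map_poly polyL P) z.
  have -> : map_poly polyL P = map_poly iota (map_poly tf P).
    by rewrite -map_poly_comp.
  by rewrite PE rmorphM rootM pz orbT.
rewrite QE polyC0 subr0 rmorphM rmorphXn /= map_polyX rootM.
by rewrite /root !hornerE expf_eq0 (negPf z0) andbF orbF.
Qed.

(** After clearing denominators, take z in A[nu]. It divides, within O, the nonzero constant term of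
    an annihilating polynomial over A; the valuation of that constant bounds the divisibility of z
    by pi. *)
Lemma unramified a O f nu c : place a O -> root (map_poly polyL f) nu -> O nu ->
  c != 0 -> (map_poly (horner_eval a) f)^`() = c%:P ->
  forall p : {poly ratfun k}, (map_poly iota p).[nu] != 0 ->
    intval O (polyL ('X - a%:P)) (map_poly iota p).[nu].
Proof.
move=> plO fnu Onu c0 f_sep p.
have sO := place_subring plO; have tO := place_total plO.
have Opi := place_poly plO ('X - a%:P); have OpiV := place_pi plO.
have [d [P [d0 PE]]] := clear_denominators p.
have evE : (map_poly polyL P).[nu] = polyL d * (map_poly iota p).[nu].
  have -> : map_poly polyL P = map_poly iota (map_poly tf P).
    by rewrite -map_poly_comp.
  by rewrite PE rmorphM /= map_polyC hornerM hornerC.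
have Ld0 : polyL d != 0 by rewrite polyL_eq0.
move=> pnu; have -> : (map_poly iota p).[nu] = (map_poly polyL P).[nu] / polyL d.
  by rewrite evE mulrC mulKf.
have Pnu0 : (map_poly polyL P).[nu] != 0 by rewrite evE mulf_neq0.
apply: intvalM => //; last by apply: intvalV => //; apply: polyL_intval plO _ _.
have [Q [Q0 Qz]] := algebraic_const Pnu0.
have [e [u [Uu ue]]] := polyL_intval plO Q0.
apply: (ev_intval_bounded plO fnu Onu c0 f_sep (N := `|e|%N.+1)) => // y Oy yE.
set z := (map_poly polyL P).[nu] in yE Qz Pnu0.
have Oz : O z by rewrite yE; apply: subringM => //; apply: subringX.
have [r Or QE] : exists2 r, O r & polyL Q`_0 = - (z * r).
  have szQ : size (map_poly polyL Q) = (size Q).-1.+1.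
    rewrite size_map_inj_poly ?rmorph0 //; last exact: polyL_inj.
    by rewrite prednK // size_poly_gt0; apply: contraNneq Q0 => ->; rewrite coef0.
  exists (\sum_(i < (size Q).-1) polyL Q`_i.+1 * z ^+ i).
    apply: subring_sum => // i _; apply: subringM => //; first exact: (place_poly plO).
    exact: subringX.
  move: (rootP Qz); rewrite horner_coef szQ big_ord_recl coef_map expr0 mulr1 => /eqP.
  rewrite addr_eq0 => /eqP ->; congr (- _); rewrite mulr_sumr; apply: eq_bigr => i _.
  by rewrite coef_map /= exprS mulrCA.
apply: (vunit_vmax Uu); have pi0 := pi_neq0 sO OpiV.
have uE : u = polyL ('X - a%:P) ^ (`|e|%N.+1%:Z - e) * - (y * r).
  apply: (mulfI (expfz_neq0 e pi0)); rewrite -ue QE yE mulrA -expfzDr //.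
  by rewrite subrKC -exprnP; ring.
have : (0 < `|e|%N.+1%:Z - e)%R by lia.
case: (_ - e) uE => [[//|n]|//] -> _; apply: vmaxMr => //; first by apply: vmaxX => //; right.
by apply: subringN => //; apply: subringM.
Qed.

(** The orbit polynomial of x over F(nu) has coefficients fixed by the stabilizer of nu, hence in
    F(nu) and of integer valuation; [ramified_degree] then bounds its degree. *)
Lemma orbit_size a O nu x D (r : seq L) : place a O ->
  (forall p : {poly ratfun k}, (map_poly iota p).[nu] != 0 ->
    intval O (polyL ('X - a%:P)) (map_poly iota p).[nu]) ->
  vunit O (x ^+ D / polyL ('X - a%:P)) ->
  (forall s : galaut iota, s nu = nu -> s x \in r) -> (D <= size r)%N.
Proof.
move=> plO int_nu Ux xr.
pose orb z := `[< exists2 s : galaut iota, s nu = nu & z = s x >].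
pose r' := undup [seq z <- r | orb z].
have r'P z : (z \in r') = orb z.
  rewrite mem_undup mem_filter; apply: andb_idr => /asboolP[s snu ->]; exact: xr.
have ur' : uniq r' by apply: undup_uniq.
pose p := \prod_(z <- r') ('X - z%:P).
have sp (s : galaut iota) : s nu = nu -> map_poly s p = p.
  move=> snu; rewrite rmorph_prod /=.
  have -> : \prod_(z <- r') map_poly s ('X - z%:P) = \prod_(z <- map s r') ('X - z%:P).
    by rewrite big_map; apply: eq_bigr => z _; rewrite rmorphB /= map_polyX map_polyC.
  apply: perm_big; apply: uniq_perm => //; first by rewrite map_inj_uniq //; apply: fmorph_inj.
  have sub : {subset map s r' <= r'}.
    move=> _ /mapP[z + ->]; rewrite !r'P => /asboolP[t tnu ->].
    have [u uE] := galaut_comp s t; apply/asboolP; exists u; rewrite uE //=.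
    by rewrite tnu.
  by apply: (uniq_min_size _ sub _).2; rewrite ?size_map ?map_inj_uniq //; apply: fmorph_inj.
(* This is where Galois theory enters: invariant coefficients are polynomials in nu. *)
have pint i : p`_i != 0 -> intval O (polyL ('X - a%:P)) p`_i.
  have [|f ->] := @galois_fixed _ _ _ Lsep nu p`_i; last exact: int_nu.
  by move=> s /sp {2}<-; rewrite coef_map.
have [[sO tO] OpiV] :=
  (place_subring plO, place_total plO, place_pi plO).
have := ramified_degree sO tO OpiV _ pint _ Ux.
rewrite size_prod_XsubC ltnS => D_r'; apply: leq_trans (D_r' _ _) _.
- by rewrite monic_neq0 ?monic_prod_XsubC.
- rewrite root_prod_XsubC r'P; apply/asboolP.
  by exists (@GalAut k L iota idfun (Bijective (fun=> erefl) (fun=> erefl)) (fun=> erefl)).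
- by rewrite (leq_trans (size_undup _)) // size_filter count_size.
Qed.

End Algebraic.
End Place.

(** * Subgroups of GL_2 over a discrete valuation ring *)

Definition mx2 (R : Type) (a b c d : R) : 'M[R]_2 :=
  \matrix_(i, j) (if i == 0 then (if j == 0 then a else b) else (if j == 0 then c else d)).

Lemma ord2P (i : 'I_2) : i = 0 \/ i = 1.
Proof. by case: i => [[|[]]//] p; [left|right]; apply: val_inj. Qed.

Lemma mx2_eta (R : Type) (M : 'M[R]_2) : M = mx2 (M 0 0) (M 0 1) (M 1 0) (M 1 1).
Proof. by apply/matrixP => i j; rewrite mxE; case: (ord2P i) (ord2P j) => -> [] ->. Qed.

Lemma mx2E (R : Type) (a b c d : R) :
  ((mx2 a b c d 0 0 = a) * (mx2 a b c d 0 1 = b) *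
   (mx2 a b c d 1 0 = c) * (mx2 a b c d 1 1 = d))%type.
Proof. by rewrite !mxE. Qed.

Lemma sum_ord2 (V : nmodType) (E : 'I_2 -> V) : \sum_i E i = E 0 + E 1.
Proof. by rewrite !big_ord_recl big_ord0 addr0; congr (E _ + E _); apply: val_inj. Qed.

Section Mx2Ring.
Context {R : comNzRingType}.
Implicit Types a b c d : R.

Lemma mx2M a b c d a' b' c' d' : mx2 a b c d *m mx2 a' b' c' d' =
  mx2 (a * a' + b * c') (a * b' + b * d') (c * a' + d * c') (c * b' + d * d').
Proof.
apply/matrixP => i j; rewrite !mxE sum_ord2 !mxE.
by case: (ord2P i) (ord2P j) => -> [] ->.
Qed.

Lemma mx2D a b c d a' b' c' d' : mx2 a b c d + mx2 a' b' c' d' =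
  mx2 (a + a') (b + b') (c + c') (d + d').
Proof.
by apply/matrixP => i j; rewrite !mxE; case: (ord2P i) (ord2P j) => -> [] ->.
Qed.

Lemma mx2N a b c d : - mx2 a b c d = mx2 (- a) (- b) (- c) (- d).
Proof.
by apply/matrixP => i j; rewrite !mxE; case: (ord2P i) (ord2P j) => -> [] ->.
Qed.

Lemma mx2Z e a b c d : e *: mx2 a b c d = mx2 (e * a) (e * b) (e * c) (e * d).
Proof.
by apply/matrixP => i j; rewrite !mxE; case: (ord2P i) (ord2P j) => -> [] ->.
Qed.

Lemma mx2_1 : 1%:M = mx2 1 0 0 1 :> 'M[R]_2.
Proof.
by apply/matrixP => i j; rewrite !mxE; case: (ord2P i) (ord2P j) => -> [] ->.
Qed.

Lemma det_mx2 a b c d : \det (mx2 a b c d) = a * d - b * c.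
Proof.
rewrite (expand_det_row _ 0) sum_ord2 /cofactor !det_mx11 !mxE /=.
rewrite !addn0 !expr0 !mul1r expr1 mulN1r mulrN; congr (_ - _).
Qed.

End Mx2Ring.

Lemma map_mx2 (R S : Type) (f : R -> S) a b c d :
  map_mx f (mx2 a b c d) = mx2 (f a) (f b) (f c) (f d).
Proof.
by apply/matrixP => i j; rewrite !mxE; case: (ord2P i) (ord2P j) => -> [] ->.
Qed.

Section FullSubgroup.
Context {k : fieldType} {R : comUnitRingType}.
Context (ev : {rmorphism R -> k}) (cst : {rmorphism k -> R}) (t : R).
Hypotheses (cstK : cancel cst ev) (ev_t : ev t = 0).
Hypothesis ev_eq0 : forall f, ev f = 0 -> exists g, f = t * g.
Hypothesis ev_unit : forall f, ev f != 0 -> f \is a GRing.unit.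
Hypothesis t_reg : forall f g, t * f = t * g -> f = g.

Implicit Types (M N X Y h : 'M[R]_2).

Definition cong n M N := exists X, M = N + t ^+ n *: X.

Lemma cong_refl n M : cong n M M.
Proof. by exists 0; rewrite scaler0 addr0. Qed.
Lemma cong_sym n M N : cong n M N -> cong n N M.
Proof. by case=> X ->; exists (- X); rewrite scalerN addrK. Qed.
Lemma cong_trans n M N P : cong n M N -> cong n N P -> cong n M P.
Proof. by case=> X -> [Y ->]; exists (Y + X); rewrite scalerDr addrA. Qed.
Lemma congM n M N M' N' : cong n M N -> cong n M' N' -> cong n (M *m M') (N *m N').
Proof.
case=> X -> [Y ->]; exists (N *m Y + X *m (N' + t ^+ n *: Y)).
rewrite mulmxDl mulmxDr -addrA; congr (_ + _).
by rewrite -scalemxAr -scalemxAl scalerDr.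
Qed.
Lemma congV n M N : M \in unitmx -> N \in unitmx -> cong n M N ->
  cong n (invmx M) (invmx N).
Proof.
move=> uM uN [X ME]; exists (- (invmx M *m X *m invmx N)).
have : t ^+ n *: X = M - N by rewrite ME addrC addKr.
move=> /(congr1 (fun Z => invmx M *m Z *m invmx N)).
rewrite -scalemxAr -scalemxAl mulmxBr mulmxBl mulVmx // mul1mx mulmxK // => E.
by rewrite scalerN E opprB addrC subrK.
Qed.

Lemma map_ev_cong M N : map_mx ev M = map_mx ev N -> cong 1 M N.
Proof.
move=> /matrixP E; have /choice[f fE] (ij : 'I_2 * 'I_2) :
    exists g, M ij.1 ij.2 - N ij.1 ij.2 = t * g.
  by apply: ev_eq0; have := E ij.1 ij.2; rewrite !mxE rmorphB => ->; rewrite subrr.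
exists (\matrix_(i, j) f (i, j)); apply/matrixP => i j; rewrite !mxE expr1 -(fE (i, j)) /=.
by rewrite addrC subrK.
Qed.

Lemma cong_map_ev n M N : cong n.+1 M N -> map_mx ev M = map_mx ev N.
Proof.
case=> X ->; rewrite map_mxD map_mxZ rmorphXn ev_t.
by rewrite expr0n scale0r addr0.
Qed.

Lemma ev_unitmx M : map_mx ev M \in unitmx -> M \in unitmx.
Proof. by rewrite !unitmxE det_map_mx unitfE => /ev_unit. Qed.

Lemma ev_texp n : (0 < n)%N -> ev (t ^+ n) = 0.
Proof. by case: n => // n _; rewrite rmorphXn ev_t expr0n. Qed.

Lemma t_regX n f g : t ^+ n * f = t ^+ n * g -> f = g.
Proof. by elim: n => [|n IHn]; rewrite ?mul1r // exprS -!mulrA => /t_reg. Qed.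

Context (H : 'M[R]_2 -> Prop).
Hypotheses (H1 : H 1%:M) (HM : forall g h, H g -> H h -> H (g *m h)).
Hypotheses (HV : forall h, H h -> H (invmx h)) (HU : forall h, H h -> h \in unitmx).

(** H surjects onto GL_2(R / t^n). *)
Definition full n := forall M, M \in unitmx -> exists2 h, H h & cong n h M.

Section Level1.
Hypothesis Hborel : forall a b : k, a != 0 -> exists2 h, H h & map_mx ev h = mx2 1 b 0 a.
Hypothesis Hmove : exists2 h, H h & ev (h 1 0) != 0.

Let H0 (X : 'M[k]_2) := exists2 h, H h & map_mx ev h = X.

Let H0M (X Y : 'M[k]_2) : H0 X -> H0 Y -> H0 (X *m Y).
Proof. by move=> [h Hh <-] [g Hg <-]; exists (h *m g); [apply: HM | rewrite map_mxM]. Qed.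

Lemma level1_full : full 1.
Proof.
have [h Hh hc] := Hmove.
(* Any matrix with nonzero lower left entry lies in the double coset of h: the left factor adjusts
   the first column, then the right one adjusts the second without changing the first. *)
have big (x y z w : k) : z != 0 -> x * w - y * z != 0 -> H0 (mx2 x y z w).
  move=> z0 det0.
  pose hk := map_mx ev h; have Hk : H0 hk by exists h.
  have hkE : hk = mx2 (hk 0 0) (hk 0 1) (hk 1 0) (hk 1 1) by apply: mx2_eta.
  have c0 : hk 1 0 != 0 by rewrite mxE.
  have hdet : hk 0 0 * hk 1 1 - hk 0 1 * hk 1 0 != 0.
    by rewrite -det_mx2 -hkE det_map_mx -unitfE rmorph_unit // -unitmxE HU.
  move: (hk 0 0) (hk 0 1) (hk 1 0) (hk 1 1) hkE c0 hdet => a b c d hkE c0 hdet.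
  have a'0 : z / c != 0 by rewrite mulf_neq0 ?invr_eq0.
  have Hl : H0 (mx2 1 ((x - a) / c) 0 (z / c) *m hk).
    by apply: H0M => //; apply: Hborel.
  pose D := (a * d - b * c) * (z / c).
  have D0 : D != 0 by rewrite mulf_neq0.
  pose e := (x * w - y * z) / D; have e0 : e != 0 by rewrite mulf_neq0 ?invr_eq0.
  pose f := (w - z / c * d * e) / z.
  suff <- : mx2 1 ((x - a) / c) 0 (z / c) *m hk *m mx2 1 f 0 e = mx2 x y z w.
    by apply: H0M => //; apply: Hborel.
  rewrite hkE !mx2M /f /e /D; congr mx2; field; rewrite ?z0 ?c0 ?hdet //.
have surj (X : 'M[k]_2) : X \in unitmx -> H0 X.
  rewrite unitmxE unitfE [X]mx2_eta det_mx2.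
  move: (X 0 0) (X 0 1) (X 1 0) (X 1 1) => a b c d det0.
  have [c0|c0] := eqVneq c 0; last exact: big.
  move: det0; rewrite c0 mulr0 subr0 mulf_eq0 negb_or => /andP[a0 d0].
  (* Swapping columns writes an upper triangular matrix as a product of two matrices with nonzero
     lower left entry. *)
  have <- : mx2 b a d 0 *m mx2 0 1 1 0 = mx2 a b 0 d by rewrite mx2M; congr mx2; ring.
  apply: H0M; apply: big; rewrite ?oner_eq0 // ?mulr0 ?mul0r ?sub0r ?oppr_eq0 ?mulf_neq0 ?oner_eq0 //.
move=> M uM; have [|g Hg gE] := surj (map_mx ev M); last by exists g => //; apply: map_ev_cong.
by rewrite unitmxE det_map_mx rmorph_unit // -unitmxE.
Qed.

End Level1.

Hypothesis det_full : forall n d, d \is a GRing.unit ->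
  exists h c, H h /\ \det h = d + t ^+ n * c.
Hypothesis full1 : full 1.
Hypothesis H_nonscalar : exists h X, [/\ H h, h = 1%:M + t *: X &
  exists b d : k, map_mx ev X = mx2 0 b 0 d /\ (b != 0) || (d != 0)].
Context (a0 : k).
Hypotheses (a0_neq0 : a0 != 0) (a0_neq1 : a0 != 1).

(** The n-th graded piece of the congruence filtration of H. For n > 0 it is an additive subgroup of
    M_2(k), stable under conjugation by GL_2(k) because of [full1]. *)
Definition layer n (X : 'M[k]_2) :=
  exists h Y, [/\ H h, h = 1%:M + t ^+ n *: Y & map_mx ev Y = X].

Lemma layerD n (X X' : 'M[k]_2) :
  (0 < n)%N -> layer n X -> layer n X' -> layer n (X + X').
Proof.
move=> n0 [h [Y [Hh hE YE]]] [g [Z [Hg gE ZE]]].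
exists (h *m g), (Y + Z + t ^+ n *: (Y *m Z)).
split; first exact: HM.
  rewrite hE gE mulmxDl mul1mx mulmxDr mulmx1 -scalemxAl -scalemxAr !scalerDr.
  by rewrite -!addrA; congr (_ + _); rewrite addrCA.
by rewrite !map_mxD map_mxZ ev_texp // scale0r addr0 YE ZE.
Qed.

Lemma map_ev_inv h (A B : 'M[k]_2) : h \in unitmx -> map_mx ev h = A ->
  A *m B = 1%:M -> map_mx ev (invmx h) = B.
Proof.
move=> uh hA AB; rewrite -[LHS]mulmx1 -AB mulmxA -hA -map_mxM mulVmx //.
by rewrite map_mx1 mul1mx.
Qed.

Lemma layerN n (X : 'M[k]_2) : (0 < n)%N -> layer n X -> layer n (- X).
Proof.
move=> n0 [h [Y [Hh hE YE]]]; exists (invmx h), (- (Y *m invmx h)).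
have uh := HU Hh; split; first exact: HV.
  have := mulmxV uh; rewrite {1}hE mulmxDl mul1mx -scalemxAl => /(canRL (addrK _)).
  by rewrite scalerN.
rewrite map_mxN map_mxM YE (@map_ev_inv h 1%:M 1%:M) ?mulmx1 //.
by rewrite hE map_mxD map_mxZ ev_texp // scale0r addr0 map_mx1.
Qed.

Lemma layer_conj n (X g g' : 'M[k]_2) : g *m g' = 1%:M -> layer n X ->
  layer n (g *m X *m g').
Proof.
move=> gg' [h [Y [Hh hE YE]]].
have evg : map_mx ev (map_mx cst g) = g by apply/matrixP => i j; rewrite !mxE cstK.
have [|u Hu /cong_map_ev uE] := full1 (M := map_mx cst g).
  by apply: ev_unitmx; rewrite evg; have [] := mulmx1_unit gg'.
have uu := HU Hu; exists (u *m h *m invmx u), (u *m Y *m invmx u); split.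
- by do ?apply: HM => //; apply: HV.
- rewrite hE mulmxDr mulmx1 mulmxDl mulmxV // -scalemxAr -scalemxAl //.
- by rewrite !map_mxM YE uE evg (@map_ev_inv u g g') // uE.
Qed.

(** The group commutator of 1 + t^(n-1) X' and 1 + t Y' is 1 + t^n (X'Y' - Y'X') up to a factor that
    is 1 modulo t. Fullness at level n is just enough to find such elements in H with prescribed
    residues X and Y. *)
Lemma layer_comm n (X Y : 'M[k]_2) : (1 < n)%N -> full n ->
  layer n (X *m Y - Y *m X).
Proof.
move=> n1 fn; have ev_lift (A : 'M[k]_2) : map_mx ev (map_mx cst A) = A.
  by apply/matrixP => i j; rewrite !mxE cstK.
have lift m (A : 'M[k]_2) : (0 < m < n)%N ->
    exists h A', [/\ H h, h = 1%:M + t ^+ m *: A' & map_mx ev A' = A].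
  move=> /andP[m0 mn]; have [|h Hh [Z hE]] := fn (1%:M + t ^+ m *: map_mx cst A).
    apply: ev_unitmx; rewrite map_mxD map_mxZ ev_texp // scale0r addr0 map_mx1.
    exact: unitmx1.
  exists h, (map_mx cst A + t ^+ (n - m) *: Z); split=> //.
    by rewrite hE scalerDr scalerA -exprD subnKC ?(ltnW mn) // addrA.
  by rewrite map_mxD map_mxZ ev_texp ?subn_gt0 // scale0r addr0 ev_lift.
have [|h [X' [Hh hE XE]]] := lift n.-1 X; first by lia.
have [|g [Y' [Hg gE YE]]] := lift 1%N Y; first by lia.
have [uh ug] := (HU Hh, HU Hg).
pose w := invmx h *m invmx g; have gh : g *m h *m w = 1%:M.
  by rewrite /w mulmxA mulmxK // mulmxV.
exists (h *m g *m w), ((X' *m Y' - Y' *m X') *m w); split.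
- by rewrite /w; do ?apply: HM => //; apply: HV.
- have E : h *m g = g *m h + t ^+ n *: (X' *m Y' - Y' *m X').
    rewrite hE gE expr1 !(mulmxDl, mulmxDr) !(mulmx1, mul1mx) -!scalemxAl -!scalemxAr.
    rewrite !scalerA -exprSr -exprS prednK ?(ltnW n1) // scalerBr.
    set a := _ *: X'; set b := t *: Y'; set c := _ *: _; set d := _ *: _.
    rewrite -!addrA; congr (_ + _); rewrite addrCA; congr (_ + _); congr (_ + _).
    by rewrite addrC subrK.
  by rewrite {1}E mulmxDl gh -scalemxAl.
- suff w1 : map_mx ev w = 1%:M.
    by rewrite map_mxM w1 mulmx1 map_mxB !map_mxM XE YE.
  have ev1 (m : nat) (A : 'M[R]_2) u : (0 < m)%N -> u \in unitmx ->
      u = 1%:M + t ^+ m *: A -> map_mx ev (invmx u) = 1%:M.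
    move=> m0 uu uE; apply: (@map_ev_inv u 1%:M); rewrite ?mulmx1 //.
    by rewrite uE map_mxD map_mxZ ev_texp // scale0r addr0 map_mx1.
  by rewrite /w map_mxM (ev1 _ _ _ _ uh hE) ?(ev1 _ _ _ _ ug gE) ?mulmx1 //; lia.
Qed.

(** Conjugates of multiples of E12 span the trace zero matrices; the nilpotent (-d d; -d d) provides
    the diagonal part in every characteristic. *)
Lemma layer_sl n : (0 < n)%N -> (forall c, layer n (mx2 0 c 0 0)) ->
  forall X : 'M[k]_2, X 0 0 + X 1 1 = 0 -> layer n X.
Proof.
move=> n0 E12 X; rewrite [X]mx2_eta !mx2E.
move: (X 0 0) (X 0 1) (X 1 0) (X 1 1) => a b c d /eqP; rewrite addr_eq0 => /eqP ->.
have E21 e : layer n (mx2 0 0 e 0).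
  have -> : mx2 0 0 e 0 = mx2 0 1 1 0 *m mx2 0 e 0 0 *m mx2 0 1 1 0 :> 'M[k]_2.
    by rewrite !mx2M; congr mx2; ring.
  by apply: layer_conj => //; rewrite mx2M mx2_1; congr mx2; ring.
have dg : layer n (mx2 (- d) d (- d) d).
  have -> : mx2 (- d) d (- d) d = mx2 1 0 1 1 *m mx2 0 d 0 0 *m mx2 1 0 (- 1) 1.
    by rewrite !mx2M; congr mx2; ring.
  by apply: layer_conj => //; rewrite mx2M mx2_1; congr mx2; ring.
have -> : mx2 (- d) b c d = mx2 (- d) d (- d) d + mx2 0 (b - d) 0 0 + mx2 0 0 (c + d) 0.
  by rewrite !mx2D; congr mx2; ring.
by do 2?apply: layerD.
Qed.

Lemma layer_E12 n c : (0 < n)%N -> full n -> layer n (mx2 0 c 0 0).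
Proof.
case: n => [//|[|n]] _ fn; last first.
  have -> : mx2 0 c 0 0 = mx2 1 0 0 0 *m mx2 0 c 0 0 - mx2 0 c 0 0 *m mx2 1 0 0 0 :> 'M[k]_2.
    by rewrite !mx2M mx2N mx2D; congr mx2; ring.
  exact: layer_comm.
have [h [X [Hh hE [b [d [XE bd]]]]]] := H_nonscalar.
have L1 : layer 1 (mx2 0 b 0 d) by exists h, X; rewrite expr1.
have [d0|d0] := eqVneq d 0.
  move: bd L1; rewrite d0 eqxx orbF => b0 L1.
  have [->|c0] := eqVneq c 0.
    have -> : mx2 0 0 0 0 = mx2 0 b 0 0 + - mx2 0 b 0 0 :> 'M[k]_2.
      by rewrite mx2N mx2D; congr mx2; ring.
    by apply: layerD => //; apply: layerN.
  have -> : mx2 0 c 0 0 = mx2 (c / b) 0 0 1 *m mx2 0 b 0 0 *m mx2 (b / c) 0 0 1.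
    by rewrite !mx2M; congr mx2; field; rewrite ?b0 ?c0.
  by apply: layer_conj => //; rewrite mx2M mx2_1; congr mx2; field; rewrite ?b0 ?c0.
have -> : mx2 0 c 0 0 =
    mx2 1 (c / d) 0 1 *m mx2 0 b 0 d *m mx2 1 (- (c / d)) 0 1 + - mx2 0 b 0 d.
  by rewrite !mx2M mx2N mx2D; congr mx2; field; rewrite ?d0.
apply: layerD => //; last exact: layerN.
by apply: layer_conj => //; rewrite mx2M mx2_1; congr mx2; ring.
Qed.

Section Step.
Context (n : nat).
Hypotheses (n_gt0 : (0 < n)%N) (full_n : full n).

(** M h^-1 = 1 + t^n X has determinant 1, so X has trace zero modulo t and [layer_sl] provides the
    correction. *)
Lemma lift_det1 M h : \det M = 1 -> H h -> \det h = 1 -> cong n h M ->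
  exists2 g, H g & cong n.+1 g M.
Proof.
move=> dM Hh dh hM; have uh := HU Hh.
have uM : M \in unitmx by rewrite unitmxE dM unitr1.
have [X XE] : cong n (M *m invmx h) 1%:M.
  by rewrite -(mulmxV uh); apply: congM; [apply: cong_sym | apply: cong_refl].
have trX : ev (X 0 0) + ev (X 1 1) = 0.
  have := congr1 determinant XE; rewrite det_mulmx det_inv dM dh invr1 mulr1.
  rewrite [X]mx2_eta mx2_1 mx2Z mx2D det_mx2 !mx2E.
  move: (X 0 0) (X 0 1) (X 1 0) (X 1 1) => a b c d E.
  have : t ^+ n * (a + d + t ^+ n * (a * d - b * c)) = t ^+ n * 0.
    rewrite mulr0; transitivity ((1 + t ^+ n * a) * (1 + t ^+ n * d) -
      (0 + t ^+ n * b) * (0 + t ^+ n * c) - 1); first by ring.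
    by rewrite -E subrr.
  move=> /t_regX/(congr1 ev); rewrite !rmorphD rmorphM ev_texp // mul0r addr0 rmorph0.
  by [].
have [|g [Y [Hg gE YX]]] := layer_sl n_gt0 (fun c => layer_E12 c n_gt0 full_n) (X := map_mx ev X).
  by rewrite !mxE.
exists (g *m h); first exact: HM.
have -> : M = M *m invmx h *m h by rewrite mulmxKV.
apply: congM (cong_refl _ _); rewrite XE gE.
have [Z ->] : cong 1 Y X by apply: map_ev_cong.
by exists Z; rewrite scalerDr scalerA -exprD addn1 addrA.
Qed.

(** Commutators of approximations have determinant exactly 1, as [lift_det1] demands. *)
Lemma lift_commutator M g1 g2 : \det M = 1 -> g1 \in unitmx -> g2 \in unitmx ->
  M = g1 *m g2 *m (invmx g1 *m invmx g2) -> exists2 g, H g & cong n.+1 g M.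
Proof.
move=> dM u1 u2 ME.
have [h1 Hh1 c1] := full_n u1; have [h2 Hh2 c2] := full_n u2.
have [v1 v2] := (HU Hh1, HU Hh2).
apply: (@lift_det1 M (h1 *m h2 *m (invmx h1 *m invmx h2))) => //.
- by do ?apply: HM => //; apply: HV.
- rewrite !det_mulmx !det_inv mulrACA !mulrV ?mulr1 -?unitmxE //.
- by rewrite ME; do ?apply: congM => //; apply: congV.
Qed.

(** A unipotent matrix is the commutator of diag(a0, 1) and a unipotent one; dividing by a0 - 1
    requires a0 different from 1. *)
Lemma lift_E12 b : exists2 g, H g & cong n.+1 g (mx2 1 b 0 1).
Proof.
have u0 : cst a0 \is a GRing.unit by apply: ev_unit; rewrite cstK.
have u1 : cst a0 - 1 \is a GRing.unit.
  by apply: ev_unit; rewrite rmorphB rmorph1 cstK subr_eq0.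
pose c := b / (cst a0 - 1).
have inv1 : mx2 (cst a0) 0 0 1 *m mx2 (cst a0)^-1 0 0 1 = 1%:M.
  by rewrite mx2M mx2_1 mulrV //; congr mx2; ring.
have inv2 : mx2 1 c 0 1 *m mx2 1 (- c) 0 1 = 1%:M by rewrite mx2M mx2_1; congr mx2; ring.
have [uA _] := mulmx1_unit inv1; have [uB _] := mulmx1_unit inv2.
apply: (@lift_commutator _ (mx2 (cst a0) 0 0 1) (mx2 1 c 0 1)) => //.
  by rewrite det_mx2; ring.
have -> : invmx (mx2 (cst a0) 0 0 1) = mx2 (cst a0)^-1 0 0 1.
  by rewrite -[RHS]mul1mx -(mulVmx uA) -mulmxA inv1 mulmx1.
have -> : invmx (mx2 1 c 0 1) = mx2 1 (- c) 0 1.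
  by rewrite -[RHS]mul1mx -(mulVmx uB) -mulmxA inv2 mulmx1.
have bE : b = c * (cst a0 - 1) by rewrite divrK.
have := mulrV u0; move: (cst a0)^-1 => a' aa'; rewrite !mx2M bE; clearbody c.
congr mx2; [transitivity (cst a0 * a') => // | | |]; try by ring.
transitivity (cst a0 * c - cst a0 * a' * c); last by ring.
by rewrite aa'; ring.
Qed.

Lemma lift_E21 b : exists2 g, H g & cong n.+1 g (mx2 1 0 b 1).
Proof.
have u0 : cst a0 \is a GRing.unit by apply: ev_unit; rewrite cstK.
have u1 : cst a0 - 1 \is a GRing.unit.
  by apply: ev_unit; rewrite rmorphB rmorph1 cstK subr_eq0.
pose c := b / (cst a0 - 1).
have inv1 : mx2 1 0 0 (cst a0) *m mx2 1 0 0 (cst a0)^-1 = 1%:M.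
  by rewrite mx2M mx2_1 mulrV //; congr mx2; ring.
have inv2 : mx2 1 0 c 1 *m mx2 1 0 (- c) 1 = 1%:M by rewrite mx2M mx2_1; congr mx2; ring.
have [uA _] := mulmx1_unit inv1; have [uB _] := mulmx1_unit inv2.
apply: (@lift_commutator _ (mx2 1 0 0 (cst a0)) (mx2 1 0 c 1)) => //.
  by rewrite det_mx2; ring.
have -> : invmx (mx2 1 0 0 (cst a0)) = mx2 1 0 0 (cst a0)^-1.
  by rewrite -[RHS]mul1mx -(mulVmx uA) -mulmxA inv1 mulmx1.
have -> : invmx (mx2 1 0 c 1) = mx2 1 0 (- c) 1.
  by rewrite -[RHS]mul1mx -(mulVmx uB) -mulmxA inv2 mulmx1.
have bE : b = c * (cst a0 - 1) by rewrite divrK.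
have := mulrV u0; move: (cst a0)^-1 => a' aa'; rewrite !mx2M bE; clearbody c.
congr mx2; [| | |transitivity (cst a0 * a') => //]; try by ring.
transitivity (cst a0 * c - cst a0 * a' * c); last by ring.
by rewrite aa'; ring.
Qed.

(** When the lower left entry is a unit, M is upper times lower times upper unipotent, up to an
    error t^(n+1) in the upper right entry. *)
Lemma lift_SL2 M c : \det M = 1 + t ^+ n.+1 * c -> exists2 g, H g & cong n.+1 g M.
Proof.
have mul A B : (exists2 g, H g & cong n.+1 g A) -> (exists2 g, H g & cong n.+1 g B) ->
    exists2 g, H g & cong n.+1 g (A *m B).
  by move=> [g Hg gA] [h Hh hB]; exists (g *m h); [apply: HM | apply: congM].
(* Otherwise the upper left entry is a unit, the determinant being 1 modulo t; add the first row to
   the second. *)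
wlog uc : M / M 1 0 \is a GRing.unit => [wl detM|].
  have [|nuc] := boolP (M 1 0 \is a GRing.unit); first by move=> /wl; apply.
  have -> : M = mx2 1 0 (- 1) 1 *m (mx2 1 0 1 1 *m M).
    rewrite mulmxA mx2M (_ : mx2 _ _ _ _ = 1%:M) ?mul1mx //.
    by rewrite mx2_1; congr mx2; ring.
  apply: mul; first exact: lift_E21.
  apply: wl; last by rewrite det_mulmx detM det_mx2; ring.
  rewrite [M]mx2_eta mx2M !mx2E !mul1r; apply: ev_unit.
  have ec : ev (M 1 0) = 0 by apply/eqP; apply: contraNT nuc => /ev_unit.
  rewrite rmorphD ec addr0; apply: contraTneq isT => ea.
  have := congr1 ev detM; rewrite [M]mx2_eta det_mx2 rmorphB !rmorphM ea ec mul0r mulr0.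
  rewrite subrr rmorphD rmorph1 rmorphM ev_texp // mul0r addr0 => /esym/eqP.
  by rewrite oner_eq0.
rewrite [M]mx2_eta mx2E in uc *; rewrite det_mx2.
move: (M 0 0) (M 0 1) (M 1 0) (M 1 1) uc => a b e d uc detM.
pose x := (a - 1) / e; pose y := (d - 1) / e.
have xe : x * e = a - 1 by rewrite divrK.
have ey : e * y = d - 1 by rewrite mulrC divrK.
clearbody x y.
pose N := mx2 1 x 0 1 *m mx2 1 0 e 1 *m mx2 1 y 0 1.
have [g Hg gN] : exists2 g, H g & cong n.+1 g N.
  by rewrite /N; apply: (mul); [apply: (mul); [apply: lift_E12 | apply: lift_E21] | apply: lift_E12].
exists g => //; apply: cong_trans gN _.
exists (mx2 0 (c / e) 0 0); rewrite /N !mx2M mx2Z mx2D; congr mx2.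
- by rewrite !(mul1r, mulr1, mulr0, addr0) xe; ring.
- apply: (mulIr uc); transitivity ((1 + x * e) * (e * y) + x * e); first by ring.
  rewrite xe ey [RHS]mulrDl -[_ * (c / e) * e]mulrA divrK //.
  transitivity (a * d - 1); first by ring.
  by rewrite -[a * d](subrK (b * e)) detM; ring.
- by ring.
- rewrite !(mul1r, mulr1, mulr0, addr0, mul0r, add0r) ey; ring.
Qed.

(** Divide M by an element of H with the same determinant modulo t^(n+1), then apply [lift_SL2]. *)
Lemma full_step : full n.+1.
Proof.
move=> M uM; have [d [c [Hd dE]]] : exists d c, H d /\ \det d = \det M + t ^+ n.+1 * c.
  by apply: det_full; rewrite -unitmxE.
have ud := HU Hd; have udet : \det d \is a GRing.unit by rewrite -unitmxE.
have [|g Hg gE] := @lift_SL2 (M *m invmx d) (- c / \det d).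
  rewrite det_mulmx det_inv -[\det M](addrK (t ^+ n.+1 * c)) -dE mulrBl mulrV //.
  by ring.
exists (g *m d); first exact: HM.
by rewrite -[M](mulmxKV ud); apply: congM gE (cong_refl _ _).
Qed.

End Step.

Theorem subgroup_full n : full n.
Proof.
case: n => [M _|n].
  by exists 1%:M => //; exists (1%:M - M); rewrite expr0 scale1r addrC subrK.
by elim: n => // n IHn; apply: full_step.
Qed.

End FullSubgroup.

(** * Power series, the Tate module and the Weil pairing *)

Section PowSerTheory.
Context {k : finFieldType}.
Implicit Types f g : powser k.

Definition ps_t : powser k := PowSer (fun n => (n == 1%N)%:R).
Definition ps_const (c : k) : powser k := PowSer (fun n => if n == 0%N then c else 0).
Definition ps_ev f : k := f 0%N.

Lemma psM f g n : (f * g) n = \sum_(i < n.+1) f i * g (n - i)%N.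
Proof. by []. Qed.

Lemma psD f g n : (f + g) n = f n + g n. Proof. by []. Qed.
Lemma psN f n : (- f) n = - f n. Proof. by []. Qed.

Fact ps_ev_zmod : zmod_morphism ps_ev. Proof. by []. Qed.
Fact ps_ev_monoid : monoid_morphism ps_ev.
Proof. by split=> // f g; rewrite /ps_ev psM big_ord1. Qed.
HB.instance Definition _ := GRing.isZmodMorphism.Build _ _ ps_ev ps_ev_zmod.
HB.instance Definition _ := GRing.isMonoidMorphism.Build _ _ ps_ev ps_ev_monoid.

Fact ps_const_zmod : zmod_morphism ps_const.
Proof. by move=> a b; apply/powserP => -[|n] //=; rewrite subr0. Qed.
Fact ps_const_monoid : monoid_morphism ps_const.
Proof.
split=> [|a b]; first by apply/powserP => -[].
apply/powserP => n; rewrite psM big_ord_recl /= subn0 big1 ?addr0; last first.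
  by move=> i _; rewrite mul0r.
by case: n => //= n; rewrite mulr0.
Qed.
HB.instance Definition _ := GRing.isZmodMorphism.Build _ _ ps_const ps_const_zmod.
HB.instance Definition _ := GRing.isMonoidMorphism.Build _ _ ps_const ps_const_monoid.

Lemma ps_constK : cancel ps_const ps_ev. Proof. by []. Qed.
Lemma ps_ev_t : ps_ev ps_t = 0. Proof. by []. Qed.

Lemma ps_tM0 f : (ps_t * f) 0%N = 0.
Proof. by rewrite psM big_ord1 mul0r. Qed.
Lemma ps_tMS f n : (ps_t * f) n.+1 = f n.
Proof.
rewrite psM big_ord_recl mul0r add0r big_ord_recl /= mul1r big1 ?addr0 ?subSS ?subn0 //.
by move=> i _; rewrite mul0r.
Qed.

Lemma ps_tXM n f m : (ps_t ^+ n * f) m = if (m < n)%N then 0 else f (m - n)%N.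
Proof.
elim: n m => [|n IHn] m; first by rewrite expr0 mul1r subn0.
rewrite exprS -mulrA; case: m => [|m]; first by rewrite ps_tM0.
by rewrite ps_tMS IHn ltnS subSS.
Qed.

Lemma ps_congP n f g : (forall m, (m < n)%N -> f m = g m) -> exists h, f = g + ps_t ^+ n * h.
Proof.
move=> fg; exists (PowSer (fun m => f (m + n)%N - g (m + n)%N)); apply/powserP => m.
rewrite psD ps_tXM /=; case: ltnP => [/fg ->|nm].
  by rewrite addr0.
by rewrite subnK // addrC subrK.
Qed.

Lemma ps_cong n f g h m : f = g + ps_t ^+ n * h -> (m < n)%N -> f m = g m.
Proof.
by move=> -> mn; rewrite psD ps_tXM mn addr0.
Qed.

Lemma ps_ev_eq0 f : ps_ev f = 0 -> exists g, f = ps_t * g.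
Proof.
move=> f0; have [|h fE] := @ps_congP 1 f 0; first by case.
by exists h; rewrite fE add0r expr1.
Qed.

Lemma ps_t_reg f g : ps_t * f = ps_t * g -> f = g.
Proof. by move=> E; apply/powserP => n; rewrite -ps_tMS E ps_tMS. Qed.

(** The geometric series in t f converges coefficientwise: coefficient n is already final in the
    partial sum of n + 1 terms. *)
Lemma ps_geometric f : exists g, g * (1 - ps_t * f) = 1.
Proof.
pose S n := \sum_(i < n) (ps_t * f) ^+ i.
have tfX i n : (n < i)%N -> ((ps_t * f) ^+ i) n = 0.
  by move=> ni; rewrite exprMn ps_tXM ni.
have SE n m : (n < m)%N -> S m n = S n.+1 n.
  move=> /subnK <-; elim: (m - n.+1)%N => [//|d IHd]; rewrite -IHd /S addSn big_ord_recr.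
  by rewrite psD tfX ?addr0 // ltn_addl.
exists (PowSer (fun n => S n.+1 n)); apply/powserP => n.
transitivity ((S n.+1 * (1 - ps_t * f)) n).
  rewrite !psM; apply: eq_bigr => i _ /=; congr (_ * _); rewrite [RHS]SE //.
have -> : S n.+1 * (1 - ps_t * f) = 1 - (ps_t * f) ^+ n.+1.
  by rewrite -[RHS]opprB subrX1 -[RHS]mulNr [in RHS]opprB mulrC.
by rewrite psD psN tfX // subr0.
Qed.

Lemma ps_ev_unit f : ps_ev f != 0 -> f \is a GRing.unit.
Proof.
move=> f0; have [|h fE] := @ps_ev_eq0 (ps_const (ps_ev f)^-1 * f - 1).
  by rewrite /ps_ev psD psN psM big_ord1 /= mulVf ?subrr.
have [g gE] := ps_geometric (- h); apply/unitrP.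
exists (g * ps_const (ps_ev f)^-1); split; last rewrite mulrC.
all: by rewrite -mulrA -(subrK 1 (_ * f)) fE addrC -[ps_t * h]opprK -mulrN.
Qed.

End PowSerTheory.

Lemma triangle_sym (V : nmodType) (G : nat -> nat -> V) n :
  \sum_(j < n) \sum_(l < n - j) G j l = \sum_(j < n) \sum_(l < n - j) G l j.
Proof.
rewrite -[LHS](sum_triangle G) -[RHS](sum_triangle (fun j l => G l j)).
apply: eq_bigr => i _; rewrite [LHS](reindex_inj rev_ord_inj); apply: eq_bigr => j _ /=.
by rewrite subSS subKn // -ltnS.
Qed.

Section TateCalculus.
Context {k : finFieldType} {L : fieldType} (iota : {rmorphism ratfun k -> L}).
Context (g1 g2 : {poly k}).
Local Notation q := #|k|.
Local Notation phi := (drinfeld2 g1 g2).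
Local Notation tateM := (tate iota phi).
Local Notation kL := (constL iota).
Local Notation aL := (polyL iota).

Lemma exprqL i (x y : L) : (x + y) ^+ (q ^ i) = x ^+ (q ^ i) + y ^+ (q ^ i).
Proof. exact: (exprqD kL). Qed.

Lemma exprqD1 (x y : L) : (x + y) ^+ q = x ^+ q + y ^+ q.
Proof. by have := exprqL 1 x y; rewrite expn1. Qed.

Lemma exprq_sum1 I (r : seq I) (P : pred I) (E : I -> L) :
  (\sum_(j <- r | P j) E j) ^+ q = \sum_(j <- r | P j) E j ^+ q.
Proof. by have := exprq_sum kL 1 r P E; rewrite expn1. Qed.

Lemma q_gt0 : (0 < q)%N. Proof. by rewrite (leq_trans _ (finNzRing_gt1 k)). Qed.

Lemma exprqN1 (x : L) : (- x) ^+ q = - x ^+ q.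
Proof.
apply/eqP; rewrite -subr_eq0 opprK addrC -exprqD1 subrr expr0n.
by rewrite gtn_eqF ?q_gt0.
Qed.

Lemma constLq c i : kL c ^+ (q ^ i) = kL c.
Proof.
rewrite -rmorphXn /=; congr kL; elim: i => [|i IHi]; first by rewrite expn0 expr1.
by rewrite expnS exprM expf_card.
Qed.

Definition phiT (x : L) : L := aL 'X * x + aL g1 * x ^+ q + aL g2 * x ^+ (q ^ 2).

Lemma tweval_twC z x : tweval iota (twC (@frob k) z) x = iota z * x.
Proof.
by rewrite (@twevalE _ _ _ 1) ?size_polyC ?leq_b1 // big_ord1 /= coefC expr1.
Qed.

Lemma tweval_tau x : tweval iota (tau (@frob k)) x = x ^+ q.
Proof.
rewrite (@twevalE _ _ _ 2) /= ?size_polyX // !big_ord_recl big_ord0 /= !coefX /=.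
by rewrite rmorph0 rmorph1 mul0r add0r mul1r addr0 expn1.
Qed.

Lemma actX x : drinfeld_act iota phi 'X x = phiT x.
Proof.
rewrite /drinfeld_act.
have -> : drinfeld2 g1 g2 'X = twC (@frob k) (@FracField.tofrac _ 'X) +
    twC (@frob k) (@FracField.tofrac _ g1) * tau (@frob k) +
    twC (@frob k) (@FracField.tofrac _ g2) * tau (@frob k) ^+ 2.
  exact: drinfeldX.
have twCM z u : tweval iota (twC (@frob k) z * u) x = iota z * tweval iota u x.
  by rewrite (twevalM iota) (tweval_twC z).
rewrite (twevalDl iota) (twevalDl iota) (tweval_twC (@FracField.tofrac _ 'X)).
rewrite (twCM (@FracField.tofrac _ g1)) (twCM (@FracField.tofrac _ g2)).
rewrite (twevalM iota (tau (@frob k)) (tau (@frob k))) !tweval_tau.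
by rewrite -exprM mulnn.
Qed.

Lemma actC c x : drinfeld_act iota phi c%:P x = kL c * x.
Proof.
rewrite /drinfeld_act /drinfeld2 /= /drinfeld horner_morphC; exact: tweval_twC.
Qed.

Lemma phiTD x y : phiT (x + y) = phiT x + phiT y.
Proof. by rewrite -!actX drinfeld_actDr. Qed.
Lemma phiTN x : phiT (- x) = - phiT x.
Proof. by rewrite -!actX drinfeld_actNr. Qed.
Lemma phiTB x y : phiT (x - y) = phiT x - phiT y.
Proof. by rewrite phiTD phiTN. Qed.
Lemma phiTZ c x : phiT (kL c * x) = kL c * phiT x.
Proof. by rewrite -!actX -!actC drinfeld_actC. Qed.

Lemma gal_phiT (s : galaut iota) x : s (phiT x) = phiT (s x).
Proof. by rewrite -!actX; apply: gal_tweval. Qed.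

Lemma gal_const (s : galaut iota) c : s (kL c) = kL c.
Proof. exact: gal_fix. Qed.

Implicit Types (x y : tateM) (f : powser k).

Lemma tate_phiT x n : phiT (x n.+1) = x n.
Proof. by rewrite -actX tate_compat. Qed.

Lemma tate_actX x l n : (l <= n)%N -> drinfeld_act iota phi 'X^l (x n) = x (n - l)%N.
Proof.
elim: l => [|l IHl] ln; first by rewrite expr0 drinfeld_act1 subn0.
by rewrite exprS drinfeld_actM IHl ?(ltnW ln) // actX -(subnSK ln) tate_phiT.
Qed.

(** The operator phi_(T^l) sends the level n component to the level n - l component. *)
Lemma tate_scaleE f x n : (f *: x) n = \sum_(l < n) kL (f l) * x (n - l)%N.
Proof.
transitivity (drinfeld_act iota phi (ps_trunc n f) (x n)); first by [].
have trE m : ps_trunc m f = \sum_(l < m) (f l)%:P * 'X^l.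
  by elim: m => [|m IHm]; [rewrite big_ord0; apply/polyP => i; rewrite coef_ps_trunc coef0
    | rewrite ps_truncS IHm big_ord_recr].
have actS (I : Type) (r : seq I) (E : I -> {poly k}) z :
    drinfeld_act iota phi (\sum_(i <- r) E i) z = \sum_(i <- r) drinfeld_act iota phi (E i) z.
  apply: (big_morph (fun b => drinfeld_act iota phi b z)) => [b c|].
    exact: drinfeld_actDl.
  exact: drinfeld_act0l.
rewrite trE actS; apply: eq_bigr => l _.
by rewrite drinfeld_actM actC tate_actX // ltnW.
Qed.

Lemma tate_tS x n : (@ps_t k *: x) n.+1 = x n.
Proof.
have t0 (i : nat) : i != 1%N -> kL (@ps_t k i) = 0.
  by move=> /negPf i1; rewrite /ps_t /= i1 rmorph0.
have t1 : kL (@ps_t k 1%N) = 1 by rewrite /ps_t /= rmorph1.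
rewrite tate_scaleE; case: n => [|n].
  by rewrite big_ord1 [kL _]t0 // mul0r tate0n.
rewrite !big_ord_recl [kL _]t0 // mul0r add0r [kL _]t1 mul1r.
rewrite big1 ?addr0 ?subn1 // => i _.
by rewrite mul0r.
Qed.

(** The kernel of projection to phi[T] is t times the Tate module: shift the sequence by one. *)
Lemma tate_divt x : x 1%N = 0 -> exists y : tateM, x = @ps_t k *: y.
Proof.
move=> x1.
have yt n : Ttorsion iota phi n (x n.+1).
  by apply/TtorsionP; rewrite tate_actX // subSnn.
have yc n : drinfeld_act iota phi 'X (x n.+2) = x n.+1 by apply: tate_compat.
exists (@Tate k L iota phi (fun n => x n.+1) yt yc); apply/tateP => -[|n].
  by rewrite !tate0n.
by rewrite tate_tS.
Qed.

Section Lift.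
Hypothesis Lsep : separable_closure iota.

(** The polynomial phi_T(X) - y is separable, its derivative being the nonzero constant T. *)
Lemma phiT_surj (y : L) : exists x : L, phiT x = y.
Proof.
pose p : {poly L} := (aL 'X) *: 'X + (aL g1) *: 'X^q + (aL g2) *: 'X^(q ^ 2) - y%:P.
have pchar_q i : (0 < i)%N -> (q ^ i)%:R = 0 :> L.
  move=> i0; have pq : pdiv q \in [pchar L].
    by apply: (pnatPpi (pchar_card kL)); rewrite pi_pdiv (finNzRing_gt1 k).
  by apply/eqP; rewrite -(dvdn_pcharf pq) dvdn_exp // pdiv_dvd.
have dp : p^`() = (aL 'X)%:P.
  have dX i : (0 < i)%N -> ('X^(q ^ i) : {poly L})^`() = 0.
    by move=> i0; rewrite derivXn -mulr_natr -polyC_natr pchar_q // mulr0.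
  have dX1 : ('X^q : {poly L})^`() = 0 by have := dX 1%N isT; rewrite expn1.
  rewrite /p derivB derivC subr0 !derivD !derivZ derivX dX1 (dX 2) //.
  by rewrite !scaler0 !addr0 -mul_polyC mulr1.
have [||x px] := Lsep.2 p.
- rewrite unlock dp; apply/Bezout_eq1_coprimepP; exists (0, ((aL 'X)^-1)%:P).
  by rewrite /= mul0r add0r -polyCM mulVf // polyL_eq0 polyX_eq0.
- rewrite ltnNge; apply/negP => /size1_polyC pE; move: dp; rewrite pE derivC => /esym/eqP.
  by rewrite polyC_eq0 polyL_eq0 polyX_eq0.
exists x; apply/eqP; rewrite -subr_eq0; move: px.
by rewrite /root /p !hornerE.
Qed.

(** Apply phi_T below level n and choose preimages above it. *)
Lemma tate_lift n (y : L) : drinfeld_act iota phi 'X^n y = 0 -> exists x : tateM, x n = y.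
Proof.
move=> yn; have [f fE] := choice phiT_surj.
pose x m := if (m <= n)%N then drinfeld_act iota phi 'X^(n - m) y else iter (m - n) f y.
have xc m : drinfeld_act iota phi 'X (x m.+1) = x m.
  rewrite actX /x; case: (ltngtP m n) => mn.
  - by rewrite -actX -drinfeld_actM -exprS subnSK.
  - by rewrite subSn ?(ltnW mn) // iterS fE.
  - by rewrite mn subSnn subnn /= fE expr0 drinfeld_act1.
have x0 : x 0%N = 0 by rewrite /x subn0.
have xt m : Ttorsion iota phi m (x m).
  apply/TtorsionP; elim: m => [|m IHm]; first by rewrite x0 drinfeld_act0r.
  by rewrite exprSr drinfeld_actM xc.
by exists (@Tate k L iota phi x xt xc); rewrite /= /x leqnn subnn expr0 drinfeld_act1.
Qed.

End Lift.

Lemma tateD x y n : (x + y) n = x n + y n.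
Proof. by []. Qed.

Section Basis.
Context (e : 'I_2 -> tateM) (eB : tate_basis e).

Lemma basis_inj (c d : 'I_2 -> powser k) :
  \sum_i c i *: e i = \sum_i d i *: e i -> c =1 d.
Proof.
move=> cd i; have /(tate_coord_uniq eB) : \sum_i c i *: e i = \sum_i (\col_i c i) i 0 *: e i.
  by apply: eq_bigr => j _; rewrite mxE.
have /(tate_coord_uniq eB) -> : \sum_i c i *: e i = \sum_i (\col_i d i) i 0 *: e i.
  by rewrite cd; apply: eq_bigr => j _; rewrite mxE.
by move=> /matrixP/(_ i 0); rewrite !mxE.
Qed.

Lemma basis_level1 (c : 'I_2 -> powser k) :
  (\sum_i c i *: e i) 1%N = 0 -> forall i, ps_ev (c i) = 0.
Proof.
move=> /tate_divt[y yE] i; rewrite [y](tate_coordE eB) scaler_sumr in yE.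
have -> : c i = ps_t * tate_coord eB y i 0.
  by apply: (@basis_inj c (fun i => ps_t * tate_coord eB y i 0)); rewrite yE;
    apply: eq_bigr => j _; rewrite scalerA.
by rewrite /ps_ev ps_tM0.
Qed.

Lemma level1_free (c d : k) : kL c * e 0 1%N + kL d * e 1 1%N = 0 -> c = 0 /\ d = 0.
Proof.
move=> cd; have E : (\sum_i (if i == 0 then ps_const c else ps_const d) *: e i) 1%N = 0.
  rewrite sum_ord2 tateD !tate_scaleE.
  by rewrite !big_ord1 !subn0.
have E' := basis_level1 E; split; first exact: (E' 0).
exact: (E' 1).
Qed.

End Basis.

Definition moore (u v : L) : L := u * v ^+ q - u ^+ q * v.

Lemma mooreDl u u' v : moore (u + u') v = moore u v + moore u' v.
Proof. by rewrite /moore exprqD1; ring. Qed.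
Lemma mooreDr u v v' : moore u (v + v') = moore u v + moore u v'.
Proof. by rewrite /moore exprqD1; ring. Qed.
Lemma mooreC u v : moore u v = - moore v u.
Proof. by rewrite /moore; ring. Qed.
Lemma mooreZl c u v : moore (kL c * u) v = kL c * moore u v.
Proof. by have := constLq c 1; rewrite /moore expn1 exprMn => ->; ring. Qed.
Lemma mooreZr c u v : moore u (kL c * v) = kL c * moore u v.
Proof. by have := constLq c 1; rewrite /moore expn1 exprMn => ->; ring. Qed.
Lemma moore0l v : moore 0 v = 0.
Proof. by rewrite /moore expr0n gtn_eqF ?q_gt0 // !mul0r subrr. Qed.
Lemma moore0r u : moore u 0 = 0.
Proof. by rewrite mooreC moore0l oppr0. Qed.
Lemma moore_suml I (r : seq I) (E : I -> L) v :
  moore (\sum_(i <- r) E i) v = \sum_(i <- r) moore (E i) v.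
Proof. by apply: (big_morph (moore^~ v)) => [a b|]; [apply: mooreDl | apply: moore0l]. Qed.
Lemma moore_sumr I (r : seq I) (E : I -> L) u :
  moore u (\sum_(i <- r) E i) = \sum_(i <- r) moore u (E i).
Proof. by apply: (big_morph (moore u)) => [a b|]; [apply: mooreDr | apply: moore0r]. Qed.

Lemma prod_constL (z : L) : z ^+ q - z = \prod_(c : k) (z - kL c).
Proof.
have := congr1 (fun p => (map_poly kL p).[z]) (finField_genPoly k).
rewrite /= rmorphB rmorph_prod /= map_polyXn map_polyX hornerD hornerN hornerXn hornerX.
move=> ->; rewrite horner_prod; apply: eq_bigr => c _.
by rewrite rmorphB /= map_polyX map_polyC !hornerE.
Qed.

(** The ratio z = v / u satisfies z^q = z, hence lies in k. *)
Lemma moore_eq0 u v : u != 0 -> moore u v = 0 -> exists c, v = kL c * u.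
Proof.
move=> u0 m0; have : (v / u) ^+ q - v / u = 0.
  have uq : u ^+ q != 0 by rewrite expf_neq0.
  rewrite expr_div_n; apply: (mulfI (mulf_neq0 u0 uq)).
  by rewrite mulr0 -[RHS]m0 /moore; field; rewrite u0 uq.
move=> /eqP; rewrite prod_constL prodf_seq_eq0 => /hasP[c _]; rewrite subr_eq0 => /eqP vu.
by exists c; rewrite -vu divfK.
Qed.

(* The Moore determinant turns phi into the rank one module with T |-> T - g2 tau. *)
Lemma moore_phiT u v : phiT u * v ^+ q - u ^+ q * phiT v =
  aL 'X * moore u v - aL g2 * moore u v ^+ q.
Proof.
rewrite [moore u v ^+ q]exprqD1 exprqN1 !exprMn -!exprM !mulnn /moore /phiT.
by ring.
Qed.

(* An explicit form of the Weil pairing on phi[T^n]. *)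
Definition weil n x y : L := \sum_(i < n) moore (x (n - i)%N) (y i.+1).

Lemma weil1 x y : weil 1 x y = moore (x 1%N) (y 1%N).
Proof. by rewrite /weil big_ord1. Qed.

(** The values form a compatible system of torsion points for psi_T = T - g2 tau. By [moore_phiT]
    the sum splits into two whose boundary terms contain x_0 = 0 or y_0 = 0, and what remains is the
    pairing one level lower. *)
Lemma weil_psi n x y : aL 'X * weil n.+1 x y - aL g2 * weil n.+1 x y ^+ q = weil n x y.
Proof.
have -> : aL 'X * weil n.+1 x y - aL g2 * weil n.+1 x y ^+ q =
    \sum_(i < n.+1) (x (n - i)%N * y i.+1 ^+ q) - \sum_(i < n.+1) (x (n.+1 - i)%N ^+ q * y i).
  rewrite /weil exprq_sum1 !mulr_sumr -!sumrB; apply: eq_bigr => i _.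
  by rewrite -moore_phiT tate_phiT subSn ?tate_phiT // -ltnS.
rewrite big_ord_recr big_ord_recl /= subnn !tate0n mul0r mulr0 addr0 add0r -sumrB.
by [].
Qed.

Lemma weilDl n x x' y : weil n (x + x') y = weil n x y + weil n x' y.
Proof. by rewrite /weil -big_split; apply: eq_bigr => i _; apply: mooreDl. Qed.
Lemma weilDr n x y y' : weil n x (y + y') = weil n x y + weil n x y'.
Proof. by rewrite /weil -big_split; apply: eq_bigr => i _; apply: mooreDr. Qed.
Lemma weilC n x y : weil n x y = - weil n y x.
Proof.
rewrite /weil (reindex_inj rev_ord_inj) -sumrN; apply: eq_bigr => i _ /=.
by rewrite mooreC subKn // subnSK.
Qed.

Lemma weilZl n f x y : weil n (f *: x) y = \sum_(l < n) kL (f l) * weil (n - l) x y.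
Proof.
pose G i l := kL (f l) * moore (x (n - l - i)%N) (y i.+1).
transitivity (\sum_(i < n) \sum_(l < n - i) G i l).
  apply: eq_bigr => i _; rewrite tate_scaleE moore_suml; apply: eq_bigr => l _.
  by rewrite mooreZl /G subnAC.
by rewrite triangle_sym; apply: eq_bigr => l _; rewrite mulr_sumr.
Qed.

(** The same expansion as in [weilZl]: power series are self-adjoint for the pairing. *)
Lemma weilZr n f x y : weil n x (f *: y) = \sum_(l < n) kL (f l) * weil (n - l) x y.
Proof.
pose G l i := kL (f l) * moore (x (n - l - i)%N) (y i.+1).
transitivity (\sum_(i < n) \sum_(l < i.+1) G l (i - l)%N).
  apply: eq_bigr => i _; rewrite tate_scaleE moore_sumr; apply: eq_bigr => l _.
  have li : (l <= i)%N by rewrite -ltnS.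
  by rewrite mooreZr /G -subnDA subnKC // subSn.
by rewrite sum_triangle; apply: eq_bigr => l _; rewrite mulr_sumr.
Qed.

Lemma weil_gal (s : galaut iota) n x y :
  s (weil n x y) = weil n (tate_gal s x) (tate_gal s y).
Proof.
rewrite /weil rmorph_sum; apply: eq_bigr => i _.
by rewrite /moore rmorphB !rmorphM !rmorphXn.
Qed.

Section Odd.
Hypothesis q_odd : odd q.

(** Self-adjointness and antisymmetry make the value its own opposite, and 2 is invertible since q
    is odd. *)
Lemma weilZZ n f x : weil n (f *: x) x = 0.
Proof.
have : weil n (f *: x) x = - weil n (f *: x) x by rewrite {2}weilZl -weilZr -weilC.
move=> /eqP; rewrite -addr_eq0 -mulr2n -mulr_natl mulf_eq0 => /orP[|/eqP //].
have q2 : pdiv q \in [pchar L].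
  by apply: (pnatPpi (pchar_card kL)); rewrite pi_pdiv (finNzRing_gt1 k).
rewrite -(dvdn_pcharf q2) => p2; have p0 := pdiv_prime (finNzRing_gt1 k).
have pE : pdiv q = 2 by apply/eqP; rewrite -dvdn_prime2.
by have := pdiv_dvd q; rewrite pE dvdn2 q_odd.
Qed.

Lemma weil_det n (N : 'M[powser k]_2) (e : 'I_2 -> tateM) :
  weil n (\sum_i N i 0 *: e i) (\sum_i N i 1 *: e i) = weil n (\det N *: e 0) (e 1).
Proof.
rewrite !sum_ord2 [N]mx2_eta det_mx2 !mx2E.
move: (N 0 0) (N 0 1) (N 1 0) (N 1 1) => a b c d.
have bal f x y : weil n x (f *: y) = weil n (f *: x) y by rewrite weilZr -weilZl.
have swap : weil n ((b * c) *: e 1) (e 0) = - weil n ((b * c) *: e 0) (e 1).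
  by rewrite weilC bal.
rewrite weilDl !weilDr !bal !scalerA !weilZZ add0r addr0 swap.
apply: (addIr (weil n ((b * c) *: e 0) (e 1))).
by rewrite subrK -weilDl -scalerDl subrK mulrC.
Qed.

End Odd.

End TateCalculus.

(** * Torsion points at T - a2 *)

Section BadPlace.
Context {k : finFieldType} {L : fieldType} (iota : {rmorphism ratfun k -> L}).
Hypothesis Lsep : separable_closure iota.
Context (g1 g2 h2 : {poly k}) (a2 : k) (O : L -> Prop).
Local Notation q := #|k|.
Local Notation phi := (drinfeld2 g1 g2).
Local Notation kL := (constL iota).
Local Notation aL := (polyL iota).
Local Notation PT := (phiT iota g1 g2).
Local Notation pi := (polyL iota ('X - a2%:P)).
Local Notation MM := (@moore k L).
Local Notation U := (vunit O).
Local Notation m := (vmax O).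
Hypotheses (a2_neq0 : a2 != 0) (g1a2 : g1.[a2] != 0).
Hypotheses (g2E : g2 = ('X - a2%:P) * h2) (h2a2 : h2.[a2] != 0).
Hypothesis plO : place iota a2 O.
Context (e : 'I_2 -> tate iota phi) (eB : tate_basis e).

Let sO := place_subring plO.
Let tO := place_total plO.
Let OpiV := place_pi plO.
Let pi0 : pi != 0. Proof. exact: (pi_neq0 sO OpiV). Qed.
Let mpi : m pi. Proof. by right. Qed.
Let UX : U (aL 'X). Proof. by apply: (polyL_unit plO); rewrite hornerX. Qed.
Let Ug1 : U (aL g1). Proof. exact: (polyL_unit plO). Qed.
Let Uh2 : U (aL h2). Proof. exact: (polyL_unit plO). Qed.
Let Lg2E : aL g2 = pi * aL h2. Proof. by rewrite g2E rmorphM. Qed.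
Let q_gt1 : (1 < q)%N. Proof. exact: finNzRing_gt1. Qed.
Let qq : (q ^ 2 = (q ^ 2 - q) + q)%N.
Proof. by rewrite subnK // -{1}(expn1 q) leq_exp2l. Qed.
Let q1 : (q = q.-1 + 1)%N. Proof. by rewrite addn1 prednK // ltnW. Qed.
Let Xqq (x : L) : x ^+ (q ^ 2) = x ^+ (q ^ 2 - q) * x ^+ q.
Proof. by rewrite -exprD -qq. Qed.
Let Xq (x : L) : x ^+ q = x ^+ q.-1 * x.
Proof. by rewrite {1}q1 exprD expr1. Qed.
Let XqV (x : L) : x != 0 -> x^-1 ^+ q.-1 * x ^+ q = x.
Proof. by move=> x0; rewrite Xq mulrA exprVn mulVf ?mul1r // expf_neq0. Qed.
Let qq_gt0 : (0 < q ^ 2 - q)%N.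
Proof. by rewrite subn_gt0 -{1}(expn1 q) ltn_exp2l. Qed.
Let mV x : ~ O x -> m x^-1. Proof. exact: vmaxV. Qed.
Let neq0 x : ~ O x -> x != 0.
Proof. by move=> Ox; apply: contra_notN Ox => /eqP ->; apply: subring0. Qed.

(** Divide phi_T(x) = 0 by x^q: when x is a pole the term T x^(1-q) is negligible, so g2 x^(q^2-q)
    is a unit. *)
Lemma torsion_pole x : PT x = 0 -> ~ O x -> U (x ^+ (q ^ 2 - q) * pi).
Proof.
move=> px Ox; have x0 := neq0 Ox.
have xE : x ^+ (q ^ 2 - q) * pi * aL h2 = - aL g1 - aL 'X * x^-1 ^+ q.-1.
  have xq0 : x ^+ q != 0 by rewrite expf_neq0.
  apply: (mulIf xq0); move: px; rewrite /phiT Lg2E Xqq => px.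
  have -> : (- aL g1 - aL 'X * x^-1 ^+ q.-1) * x ^+ q = - aL g1 * x ^+ q - aL 'X * x.
    by rewrite mulrBl -mulrA XqV.
  apply/eqP; rewrite -subr_eq0 -px; apply/eqP; ring.
have UxE : U (x ^+ (q ^ 2 - q) * pi * aL h2).
  rewrite xE; apply: vunitDm => //; first exact: vunitN.
  apply: vmaxN => //; apply: vmaxMl => //; first exact: vunitO.
  by apply: vmaxX => //; [rewrite -ltnS prednK // ltnW | apply: mV].
have h0 : aL h2 != 0 by case: Uh2.
by rewrite -[_ * pi](mulfK h0); apply: vunitM => //; apply: vunitV.
Qed.

Lemma basis1_moore : MM (e 0 1%N) (e 1 1%N) != 0.
Proof.
apply/eqP => m0; have e00 : e 0 1%N != 0.
  apply/eqP => e00; have [] := @level1_free _ _ _ _ _ _ eB 1 0; first by rewrite e00 mulr0 rmorph0 mul0r addr0.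
  by move/eqP; rewrite oner_eq0.
have [c cE] := moore_eq0 iota e00 m0.
have [] := @level1_free _ _ _ _ _ _ eB (- c) 1; first by rewrite rmorphN rmorph1 mul1r cE mulNr addNr.
by move=> _ /eqP; rewrite oner_eq0.
Qed.

(** The Moore determinant M of a basis of phi[T] satisfies T = g2 M^(q-1). If the basis were
    integral, the unit T would lie in the maximal ideal. *)
Lemma pole_exists : exists2 x, PT x = 0 & ~ O x.
Proof.
have pe i : PT (e i 1%N) = 0 by rewrite tate_phiT tate0n.
have [O0|O0] := pselect (O (e 0 1%N)); last by exists (e 0 1%N).
have [O1|O1] := pselect (O (e 1 1%N)); last by exists (e 1 1%N).
have := basis1_moore; set M := MM _ _ => M0.
have OM : O M.
  by apply: subringB => //; apply: subringM => //; apply: subringX.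
have := moore_phiT iota g1 g2 (e 0 1%N) (e 1 1%N); rewrite !pe mul0r mulr0 subrr -/M.
move=> /esym/eqP; rewrite subr_eq0 => /eqP XM.
case: (vunit_vmax UX); have -> : aL 'X = aL g2 * M ^+ q.-1.
  by apply: (mulIf M0); rewrite XM Xq mulrA.
by rewrite Lg2E -mulrA; apply: vmaxMr => //; apply: subringM => //; [apply: vunitO | apply: subringX].
Qed.

Section Approx.
Context (mu : L) (pmu : PT mu = 0) (Omu : ~ O mu).
Let mu0 := neq0 Omu.
Let u := aL g2 * mu ^+ (q ^ 2 - q).
Let Uu : U u.
Proof.
have -> : u = aL h2 * (mu ^+ (q ^ 2 - q) * pi) by rewrite /u Lg2E; ring.
by apply: vunitM => //; apply: torsion_pole.
Qed.
Let u0 : u != 0. Proof. by case: Uu. Qed.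

(** In the variable z = z0 / mu the equation reduces to z^(q^2) = z^q in the residue field, so z is
    congruent to an element of k. *)
Lemma approx_mod z0 : O (PT z0 / mu) -> exists c, m ((z0 - kL c * mu) / mu).
Proof.
move=> Oy; set y := PT z0 in Oy.
have [z z0E] : exists z, z0 = z * mu by exists (z0 / mu); rewrite divfK.
have muq := XqV mu0.
have mq : m (mu^-1 ^+ q.-1).
  by apply: vmaxX => //; [rewrite -ltnS prednK // ltnW | apply: mV].
pose b := aL 'X / u * mu^-1 ^+ q.-1; pose w := (y / mu) / u * mu^-1 ^+ q.-1.
have mb : m b by apply: vmaxMl => //; apply: vunitO; apply: vunitM => //; apply: vunitV.
have mw : m w by apply: vmaxMl => //; apply: subringM => //; apply: vunitO; apply: vunitV.
have muq0 : mu ^+ q != 0 by rewrite expf_neq0.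
have bE : b * (u * mu ^+ q) = aL 'X * mu by rewrite /b mulrACA divfK // muq.
have wE : w * (u * mu ^+ q) = y by rewrite /w mulrACA divfK // muq divfK.
have u2 : aL g2 * mu ^+ (q ^ 2) = u * mu ^+ q by rewrite Xqq mulrA.
have gE : aL g1 * mu ^+ q = - (1 + b) * (u * mu ^+ q).
  move: pmu; rewrite /phiT u2 -bE => /eqP; rewrite addrAC addr_eq0 => /eqP.
  by move=> E; rewrite -[LHS]opprK -E; ring.
have zE : z ^+ (q ^ 2) - (1 + b) * z ^+ q + b * z = w.
  apply: (mulIf (mulf_neq0 u0 muq0)); rewrite wE /y /phiT.
  rewrite z0E !exprMn; transitivity (z * (aL 'X * mu) + z ^+ q * (aL g1 * mu ^+ q) +
    z ^+ (q ^ 2) * (aL g2 * mu ^+ (q ^ 2))); last by ring.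
  by rewrite u2 gE -bE; ring.
have Oz : O z.
  apply: contrapT => Oz; have z00 := neq0 Oz; have mz := mV Oz.
  apply: (@vmax1 _ O) => //.
  (* This is [zE] divided by z^(q^2); were z a pole, the right side would lie in the maximal
     ideal. *)
  have -> : 1 = w * z^-1 ^+ (q ^ 2) + (1 + b) * z^-1 ^+ (q ^ 2 - q) - b * (z^-1 ^+ (q ^ 2 - q) * z^-1 ^+ q.-1).
    have zq : z ^+ (q ^ 2 - q) * z^-1 ^+ (q ^ 2 - q) = 1 by rewrite -exprMn mulfV ?expr1n.
    have zp : z ^+ q.-1 * z^-1 ^+ q.-1 = 1 by rewrite -exprMn mulfV ?expr1n.
    rewrite -zE (Xqq z) (Xqq z^-1) (Xq z) (Xq z^-1).
    move: zq zp (mulfV z00).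
    move: (z ^+ (q ^ 2 - q)) (z ^+ q.-1) (z^-1 ^+ (q ^ 2 - q)) (z^-1 ^+ q.-1).
    move=> A B A' B'; move: z^-1 => C AA BB CC.
    transitivity ((A * A') * (B * B') * (z * C) - (1 + b) * (B * B') * (z * C) * A'
      + b * (z * C) * A' * B' + (1 + b) * A' - b * (A' * B')); last by ring.
    by rewrite AA BB CC; ring.
  apply: vmaxB => //; first apply: vmaxD => //.
  - by apply: vmaxMr => //; apply: subringX => //; apply: vmaxO.
  - apply: vmaxMl => //; last exact: vmaxX.
    by apply: subringD => //; [apply: subring1 | apply: vmaxO].
  - by apply: vmaxMr => //; apply: vmaxO => //; apply: vmaxMr; rewrite //; [apply: vmaxX | apply: subringX => //; apply: vmaxO].
have : m (\prod_(c : k) (z - kL c)).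
  rewrite -prod_constL; apply: (@vmaxXn _ O sO _ q); rewrite (exprqD1 iota) (exprqN1 iota) -exprM mulnn.
  have -> : z ^+ (q ^ 2) - z ^+ q = w + b * (z ^+ q - z) by rewrite -zE; ring.
  apply: vmaxD => //; apply: vmaxMr => //; apply: subringB => //; exact: subringX.
move=> /(vmax_prod sO)[c|c mc]; first by apply: subringB => //; apply: (place_poly plO).
by exists c; rewrite z0E -mulrBl mulfK.
Qed.

Lemma approx_torsion y : O (y / mu) -> exists2 x, PT x = y & m (x / mu).
Proof.
move=> Oy; have [z0 z0E] := phiT_surj g1 g2 Lsep y.
have [|c mc] := @approx_mod z0; first by rewrite z0E.
by exists (z0 - kL c * mu) => //; rewrite phiTB phiTZ pmu mulr0 subr0.
Qed.

(** Below the size of mu, the top term g2 x^(q^2) is negligible against g1 x^q. *)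
Lemma phiT_small x : m (x / mu) -> exists2 v, U v & PT x = aL 'X * x + x ^+ q * v.
Proof.
move=> mx; exists (aL g1 + aL g2 * x ^+ (q ^ 2 - q)).
  apply: vunitDm => //; have -> : x = (x / mu) * mu by rewrite divfK.
  rewrite exprMn mulrCA; apply: vmaxMr; rewrite //; first exact: vmaxX.
  exact: vunitO.
by rewrite /phiT Xqq; ring.
Qed.

(** Subtract a multiple of mu from a torsion point off the line k mu to get one smaller than mu. By
    [torsion_pole] all poles in phi[T] have the same size, so this point is integral. *)
Lemma unramified_point : exists2 nu, nu != 0 & PT nu = 0 /\ O nu.
Proof.
have pe i : PT (e i 1%N) = 0 by rewrite tate_phiT tate0n.
suff [x px xmu] : exists2 x, PT x = 0 & forall c, x != kL c * mu.
  have [|c mc] := @approx_mod x; first by rewrite px mul0r; apply: subring0.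
  exists (x - kL c * mu); first by rewrite subr_eq0.
  have pnu : PT (x - kL c * mu) = 0 by rewrite phiTB phiTZ px pmu mulr0 subr0.
  split=> //; apply: contrapT => Onu; apply: (vunit_vmax _ (vmaxX sO tO qq_gt0 mc)).
  have -> : ((x - kL c * mu) / mu) ^+ (q ^ 2 - q) =
      ((x - kL c * mu) ^+ (q ^ 2 - q) * pi) * (mu ^+ (q ^ 2 - q) * pi)^-1.
    by rewrite expr_div_n invfM mulrACA divff // mulr1.
  by apply: vunitM => //; [|apply: vunitV]; apply: torsion_pole.
apply: contrapT => no; have line i : exists c, e i 1%N = kL c * mu.
  apply: contrapT => noc; apply: no; exists (e i 1%N) => // c; apply/eqP => E.
  by apply: noc; exists c.
have [[c cE] [d dE]] := (line 0, line 1); have /eqP[] := basis1_moore.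
by rewrite cE dE mooreZl mooreZr /moore [mu * _]mulrC subrr !mulr0.
Qed.

End Approx.

Lemma bad_place_points : exists nu1 nu2 mu lam : L,
  [/\ nu1 != 0, PT nu1 = 0, PT nu2 = nu1, O nu1 & O nu2] /\
  [/\ PT mu = 0, PT lam = mu, ~ O mu,
      U (mu^-1 ^+ (q ^ 2 - q) / pi) & U (lam^-1 ^+ (q * (q ^ 2 - q)) / pi)].
Proof.
have [mu pmu Omu] := pole_exists; have mu0 := neq0 Omu.
have [nu1 nu10 [pnu1 Onu1]] := unramified_point pmu Omu.
have OmuV : O mu^-1 by apply: vmaxO => //; apply: mV.
have [|nu2 pnu2 mnu2] := @approx_torsion mu pmu Omu nu1; first exact: subringM.
have [|lam plam mlam] := @approx_torsion mu pmu Omu mu.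
  by rewrite divff //; apply: subring1.
have Onu2 : O nu2.
  have [v Uv vE] := phiT_small pmu Omu mnu2; apply: contrapT => On2.
  have n0 := neq0 On2; have mn := mV On2; apply: (vunit_vmax Uv).
  have -> : v = nu1 * nu2^-1 ^+ q - aL 'X * nu2^-1 ^+ q.-1.
    have nq0 : nu2 ^+ q != 0 by rewrite expf_neq0.
    apply: (mulfI nq0); transitivity ((nu2 ^+ q * nu2^-1 ^+ q) * nu1 -
      aL 'X * (nu2^-1 ^+ q.-1 * nu2 ^+ q)); last by ring.
    by rewrite XqV // exprVn mulfV // mul1r -pnu2 vE; ring.
  apply: vmaxB => //; apply: vmaxMl => //; first by apply: vmaxX => //; apply: ltnW.
    exact: vunitO.
  by apply: vmaxX => //; rewrite -ltnS prednK // ltnW.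
(* Since lam is smaller than mu, phi_T(lam) = mu reads lam^q v = mu - T lam with a dominant mu: lam
   contributes another ramification factor q. *)
have Ulam : U (lam ^+ q / mu).
  have [v Uv vE] := phiT_small pmu Omu mlam.
  have v0 : v != 0 by case: Uv.
  have -> : lam ^+ q / mu = (1 - aL 'X * (lam / mu)) / v.
    have -> : lam ^+ q = (mu - aL 'X * lam) / v.
      by rewrite -{1}plam vE addrC addKr mulfK.
    by field; rewrite v0 mu0.
  apply: vunitM => //; last exact: vunitV.
  apply: vunitDm => //; first exact: vunit1.
  by apply: vmaxN => //; apply: vmaxMl => //; apply: vunitO.
exists nu1, nu2, mu, lam; split; split=> //.
  rewrite exprVn -invfM; apply: vunitV; exact: torsion_pole.
rewrite exprVn -invfM; apply: vunitV.
have -> : lam ^+ (q * (q ^ 2 - q)) * pi =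
    (lam ^+ q / mu) ^+ (q ^ 2 - q) * (mu ^+ (q ^ 2 - q) * pi).
  by rewrite exprM expr_div_n mulrA divfK // expf_neq0.
by apply: vunitM => //; [apply: vunitX | apply: torsion_pole].
Qed.

(** Modulo T - a2 the polynomial phi_T(phi_T(X)) has derivative a2^2, a nonzero constant. *)
Lemma unramified_field nu : PT (PT nu) = 0 -> O nu ->
  forall p : {poly ratfun k}, (map_poly iota p).[nu] != 0 ->
    intval O pi (map_poly iota p).[nu].
Proof.
move=> pnu Onu.
pose F (R : comNzRingType) (t a b : R) : {poly R} := t%:P * 'X + a%:P * 'X^q + b%:P * 'X^(q ^ 2).
pose f := F _ 'X g1 g2 \Po F _ 'X g1 g2.
have mapF (R S : comNzRingType) (r : {rmorphism R -> S}) t a b :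
    map_poly r (F R t a b) = F S (r t) (r a) (r b).
  by rewrite /F !rmorphD !rmorphM /= !map_polyC map_polyX !map_polyXn.
apply: (@unramified _ _ _ Lsep a2 O f nu (a2 * a2)) => //; last 2 first.
- by rewrite mulf_neq0.
- rewrite map_comp_poly mapF /= /horner_eval hornerX deriv_comp.
  have dX i : (0 < i)%N -> ('X^(q ^ i) : {poly k})^`() = 0.
    move=> i0; rewrite derivXn -mulr_natr -polyC_natr.
    have pq : pdiv q \in [pchar k].
      by apply: (pnatPpi (pchar_card (@idfun k))); rewrite pi_pdiv.
    have -> : (q ^ i)%:R = 0 :> k.
      by apply/eqP; rewrite -(dvdn_pcharf pq) dvdn_exp // pdiv_dvd.
    by rewrite mulr0.
  have dX1 : ('X^q : {poly k})^`() = 0 by have := dX 1%N isT; rewrite expn1.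
  have dF : (F k a2 g1.[a2] g2.[a2])^`() = a2%:P.
    by rewrite /F !derivD !derivM !derivC derivX dX1 (dX 2) // !mul0r !add0r !mulr0 !addr0 mulr1.
  by rewrite dF comp_polyC -polyCM.
rewrite map_comp_poly mapF /root horner_comp.
have FE x : (F L (aL 'X) (aL g1) (aL g2)).[x] = PT x by rewrite /F !hornerE.
by rewrite !FE pnu.
Qed.

End BadPlace.

(** * The image of Galois *)

Section Representation.
Context {k : finFieldType} {L : fieldType} (iota : {rmorphism ratfun k -> L}).
Hypothesis Lsep : separable_closure iota.
Context (g1 g2 : {poly k}).
Local Notation q := #|k|.
Local Notation phi := (drinfeld2 g1 g2).
Local Notation kL := (constL iota).
Local Notation aL := (polyL iota).

Section Basis.
Context (e : 'I_2 -> tate iota phi) (eB : tate_basis e).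
Local Notation rhoM := (rho_mx eB).

Lemma rho_mx_eq (s : galaut iota) (M : 'M[powser k]_2) :
  (forall j n, s (e j n) = (\sum_i M i j *: e i) n) -> rhoM s = M.
Proof.
move=> sM; apply/matrixP => i j; rewrite mxE.
rewrite (@tate_coord_uniq _ _ _ _ _ eB _ (\col_i M i j)) ?mxE //.
apply/tateP => n; rewrite [LHS]sM; congr (tseq _ n).
by apply: eq_bigr => l _; rewrite mxE.
Qed.

Lemma rho_mx_level (s : galaut iota) j n : s (e j n) = (\sum_i rhoM s i j *: e i) n.
Proof. by rewrite -rho_mxE. Qed.

Lemma rho_mx_comp (s t u : galaut iota) : u =1 s \o t -> rhoM u = rhoM s *m rhoM t.
Proof.
move=> uE; apply/matrixP => i j; rewrite mxE.
have -> : tate_gal u (e j) = tate_gal s (tate_gal t (e j)) by apply/tateP => n; apply: uE.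
by rewrite rho_mx_coord !mxE; apply: eq_bigr => l _; rewrite !mxE.
Qed.

Lemma rho_mx_id (s : galaut iota) : s =1 id -> rhoM s = 1%:M.
Proof.
move=> sE; apply: rho_mx_eq => j n; rewrite sE; congr (tseq _ n).
rewrite (bigD1 j) //= mxE eqxx scale1r big1 ?addr0 // => i /negPf ij.
by rewrite mxE ij scale0r.
Qed.

Let H M := exists s, rhoM s = M.

Lemma rho_image1 : H 1%:M.
Proof.
pose s := @GalAut k L iota idfun (Bijective (fun=> erefl) (fun=> erefl)) (fun=> erefl).
by exists s; apply: rho_mx_id.
Qed.
Lemma rho_imageM M N : H M -> H N -> H (M *m N).
Proof.
by move=> [s <-] [t <-]; have [u uE] := galaut_comp s t; exists u; apply: rho_mx_comp.
Qed.
Lemma rho_imageV M : H M -> H (invmx M).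
Proof.
move=> [s <-]; have [t [stK tsK]] := galaut_inv Lsep s; exists t.
have [u uE] := galaut_comp t s; have ts : rhoM t *m rhoM s = 1%:M.
  by rewrite -(rho_mx_comp uE); apply: rho_mx_id => x; rewrite uE /= stK.
by rewrite -[RHS]mul1mx -ts mulmxK // rho_mx_unit.
Qed.
Lemma rho_imageU M : H M -> M \in unitmx.
Proof. by move=> [s <-]; apply: rho_mx_unit. Qed.

Lemma rho_level1 (s : galaut iota) j :
  s (e j 1%N) = kL (ps_ev (rhoM s 0 j)) * e 0 1%N + kL (ps_ev (rhoM s 1 j)) * e 1 1%N.
Proof.
rewrite rho_mx_level sum_ord2 tateD !tate_scaleE.
by rewrite !big_ord1 !subn0.
Qed.

Lemma rho_level2 (s : galaut iota) j : s (e j 2%N) =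
  kL (rhoM s 0 j 0%N) * e 0 2%N + kL (rhoM s 0 j 1%N) * e 0 1%N +
  (kL (rhoM s 1 j 0%N) * e 1 2%N + kL (rhoM s 1 j 1%N) * e 1 1%N).
Proof.
rewrite rho_mx_level sum_ord2 tateD !tate_scaleE.
by rewrite !big_ord_recl !big_ord0 !addr0.
Qed.

Lemma level1_inj (c d c' d' : k) :
  kL c * e 0 1%N + kL d * e 1 1%N = kL c' * e 0 1%N + kL d' * e 1 1%N -> c = c' /\ d = d'.
Proof.
move=> /eqP; rewrite -subr_eq0 => /eqP E.
have [|/eqP + /eqP] := @level1_free _ _ _ _ _ _ eB (c - c') (d - d').
  by rewrite -[RHS]E !rmorphB; ring.
by rewrite !subr_eq0 => /eqP -> /eqP ->.
Qed.

Section Limit.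
Hypothesis dense : forall n M, M \in unitmx ->
  exists2 h, H h & cong (@ps_t k) n h M.

(* Automorphisms approximating M are eventually constant on each torsion point, so
   the limit exists on the field they generate, and then extends. *)
Lemma rho_closed M : M \in unitmx -> H M.
Proof.
move=> uM; have ex n : exists s, cong (@ps_t k) n (rhoM s) M.
  by have [_ [s <-] sM] := dense n uM; exists s.
have [S SE] := choice ex.
pose G x y := exists n0, forall n, (n0 <= n)%N -> S n x = y.
have gG : field_graph iota G.
  split.
  - by move=> a; exists 0%N => n _; apply: gal_fix.
  - move=> x y x' y' [m mE] [n nE]; exists (maxn m n) => l; rewrite geq_max => /andP[ml nl].
    by rewrite rmorphB mE // nE.
  - move=> x y x' y' [m mE] [n nE]; exists (maxn m n) => l; rewrite geq_max => /andP[ml nl].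
    by rewrite rmorphM mE // nE.
  - by move=> x y [m mE]; exists m => n mn; rewrite fmorphV mE.
  - by move=> x y [m mE]; rewrite -(mE m) // fmorph_eq0.
have [s sE] := galois_extend Lsep gG; exists s; apply: rho_mx_eq => j n.
apply: sE; exists n => m nm; rewrite rho_mx_level !sum_ord2 !tateD !tate_scaleE.
have [X ME] := SE m.
have entry i (l : 'I_n) : rhoM (S m) i j l = M i j l.
  rewrite ME !mxE; apply: (ps_cong (n := m) (erefl _)).
  exact: leq_trans (ltn_ord l) nm.
have -> : forall i, \sum_(l < n) kL (rhoM (S m) i j l) * e i (n - l)%N =
    \sum_(l < n) kL (M i j l) * e i (n - l)%N.
  by move=> i; apply: eq_bigr => l _; rewrite entry.
by have -> : \sum_(l < n) kL (rhoM (S m) 1 j l) * e 1 (n - l)%N =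
    \sum_(l < n) kL (M 1 j l) * e 1 (n - l)%N by apply: eq_bigr => l _; rewrite entry.
Qed.

End Limit.

Section Determinant.
Hypotheses (q_odd : odd q) (g20 : g2.[0] != 0).
Local Notation w n := (weil n (e 0) (e 1)).

(** Induction along psi_T(z) = y. At T the coefficient g2 is a unit, and y divides T in O, so T z is
    negligible against y and z^q has the size of y; the base case is T = g2 w_1^(q-1). *)
Lemma weil_ramified O n : place iota 0 O ->
  vunit O (w n.+1 ^+ (q ^ n * q.-1) / aL 'X).
Proof.
move=> plO; have [[sO tO] OpiV] := (place_subring plO, place_total plO, place_pi plO).
rewrite polyC0 subr0 in OpiV.
have X0 : aL 'X != 0 by rewrite polyL_eq0 polyX_eq0.
have mX : vmax O (aL 'X) by right.
have Ug2 : vunit O (aL g2) by apply: (polyL_unit plO).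
have g20' : aL g2 != 0 by case: Ug2.
have q_gt1 : (1 < q)%N := finNzRing_gt1 k.
have Xq x : x ^+ q = x ^+ q.-1 * x :> L by rewrite -exprSr prednK // ltnW.
elim: n => [|n IHn].
  rewrite expn0 mul1n; have w0 : w 1 != 0 by rewrite weil1; apply: basis1_moore.
  have := weil_psi 0 (e 0) (e 1); rewrite {3}/weil big_ord0 => /eqP.
  rewrite subr_eq0 Xq mulrA => /eqP/(mulIf w0) ->.
  have -> : w 1 ^+ q.-1 / (aL g2 * w 1 ^+ q.-1) = (aL g2)^-1.
    by rewrite invfM mulrCA mulfV ?mulr1 // expf_neq0.
  exact: vunitV.
set y := w n.+1 in IHn; set z := w n.+2; have yE : aL 'X * z - aL g2 * z ^+ q = y.
  exact: weil_psi.
set D := (q ^ n * q.-1)%N in IHn.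
have D0 : (0 < D)%N by rewrite muln_gt0 expn_gt0 ltnW //= -ltnS prednK // ltnW.
have yD0 : y ^+ D / aL 'X != 0 by case: IHn.
have y0 : y != 0.
  by apply: contraNneq yD0 => ->; rewrite expr0n gtn_eqF // mul0r.
have my : vmax O y.
  apply: (@vmaxXn _ O sO _ D); rewrite -[_ ^+ D](divfK X0).
  by apply: vmaxMl => //; apply: vunitO.
have OXy : O (aL 'X / y).
  have -> : aL 'X / y = (y ^+ D / aL 'X)^-1 * y ^+ D.-1.
    rewrite invf_div -mulrA; congr (_ * _); rewrite -{1}(prednK D0) exprS invfM.
    by rewrite -mulrA mulVf ?mulr1 // expf_neq0.
  by apply: subringM => //; [case: IHn | apply: subringX => //; apply: vmaxO].
have Oz : O z.
  apply: contrapT => Oz; have mz : vmax O z^-1 by apply: vmaxV.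
  have z0 : z != 0 by apply: contra_notN Oz => /eqP ->; apply: subring0.
  apply: (vunit_vmax Ug2); have zq0 : z ^+ q.-1 != 0 by rewrite expf_neq0.
  have -> : aL g2 = aL 'X * z^-1 ^+ q.-1 - y * (z^-1 ^+ q.-1 * z^-1).
    by rewrite -yE Xq exprVn; field; rewrite z0 zq0.
  have mzq : vmax O (z^-1 ^+ q.-1) by apply: vmaxX => //; rewrite -ltnS prednK // ltnW.
  apply: vmaxB => //; first by apply: vmaxMr => //; apply: vmaxO.
  by apply: vmaxMr => //; apply: subringM => //; apply: vmaxO.
have zqE : z ^+ q = y * (aL 'X / y * z - 1) / aL g2.
  apply: (mulIf g20'); rewrite divfK //.
  by transitivity (aL 'X * z - y); [rewrite -yE; ring | field].
have mz : vmax O z.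
  apply: (@vmaxXn _ O sO _ q); rewrite zqE; apply: vmaxMr => //; last first.
    by apply: vunitO; apply: vunitV.
  by apply: vmaxMr => //; apply: subringB => //; [apply: subringM | apply: subring1].
have Uzy : vunit O (z ^+ q / y).
  have -> : z ^+ q / y = (-1 + aL 'X / y * z) / aL g2.
    by rewrite zqE; field; rewrite g20' y0.
  apply: vunitM => //; last exact: vunitV.
  by apply: vunitDm => //; [apply/vunitN => //; apply: vunit1 | apply: vmaxMl].
have -> : z ^+ (q ^ n.+1 * q.-1) / aL 'X = (z ^+ q / y) ^+ D * (y ^+ D / aL 'X).
  rewrite expnS -mulnA exprM -/D expr_div_n mulrA divfK //.
  by rewrite expf_neq0.
by apply: vunitM => //; apply: vunitX.
Qed.

Lemma iota_horner0 (p : {poly ratfun k}) : (map_poly iota p).[0] = iota p.[0].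
Proof. by rewrite -(rmorph0 iota) horner_map. Qed.

(** Conjugates of the level n + 1 pairing value depend only on det rho modulo t^(n+1). Ramification
    gives at least q^n (q-1) of them, which is the number of units modulo t^(n+1). *)
Lemma det_dense n (d : powser k) : d \is a GRing.unit ->
  exists h c, H h /\ \det h = d + ps_t ^+ n * c.
Proof.
case: n => [|n] ud.
  by exists 1%:M, (1 - d); split; [apply: rho_image1 | rewrite det1 expr0 mul1r addrC subrK].
have [O plO] := place_exists iota 0.
pose tr (f : powser k) : {ffun 'I_n.+1 -> k} := [ffun i : 'I_n.+1 => f i].
pose ps (f : {ffun 'I_n.+1 -> k}) : powser k :=
  PowSer (fun i => if insub i is Some j then f j else 0).
have trK f (i : 'I_n.+1) : ps (tr f) i = f i by rewrite /= valK ffunE.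
pose S := finset (fun f => `[< exists s, tr (\det (rhoM s)) = f >]).
pose Un := finset (fun f : {ffun 'I_n.+1 -> k} => f 0 != 0).
have unit0 (f : powser k) : f \is a GRing.unit -> f 0%N != 0.
  by move=> /(rmorph_unit (@ps_ev k)); rewrite unitfE.
have SUn : S \subset Un.
  apply/subsetP => f; rewrite !inE => /asboolP[s <-]; rewrite ffunE.
  by apply: unit0; rewrite -unitmxE rho_mx_unit.
have cardS : (q ^ n * q.-1 <= #|S|)%N.
  (* The orbit bound is used over F itself, generated by nu = 0. *)
  rewrite cardE -(size_map (fun f => weil n.+1 (ps f *: e 0) (e 1))).
  apply: (@orbit_size _ _ _ Lsep 0 O 0 (w n.+1) _ _ plO).
  - by move=> p; rewrite iota_horner0; apply: (iota_intval plO).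
  - by rewrite polyC0 subr0; apply: weil_ramified.
  move=> s _; rewrite weil_gal !(rho_mxE eB) weil_det //.
  apply/mapP; exists (tr (\det (rhoM s))).
    by rewrite mem_enum inE; apply/asboolP; exists s.
  by rewrite !weilZl; apply: eq_bigr => l _; rewrite trK.
have cardUn : (#|Un| <= q ^ n * q.-1)%N.
  pose F (i : 'I_n.+1) : {pred k} := if i == 0 then predC1 0 else predT.
  have -> : #|Un| = #|family F|.
    apply: eq_card => f; rewrite inE; apply/idP/familyP => [f0 i|/(_ 0)].
      by rewrite /F; case: eqP => [->|].
    by rewrite /F eqxx.
  rewrite card_family foldrE big_map big_enum big_ord_recl /= mulnC.
  rewrite /F eqxx cardC1 leq_mul2r; apply/orP; right.
  rewrite (eq_bigr (fun=> q)) => [|i _]; last by [].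
  by rewrite prod_nat_const card_ord.
have UnS : Un = S.
  by apply/esym/eqP; rewrite eqEcard SUn (leq_trans cardUn).
have : tr d \in S by rewrite -UnS inE ffunE; apply: unit0.
rewrite inE => /asboolP[s sE]; have [|c cE] := @ps_congP k n.+1 (\det (rhoM s)) d.
  move=> m mn; have := congr1 (fun f : {ffun _ -> _} => f (Ordinal mn)) sE.
  by rewrite !ffunE.
by exists (rhoM s), c; split=> //; exists s.
Qed.

End Determinant.

End Basis.
End Representation.

(** * Surjectivity in a basis adapted to the prime T - a2 *)

Section AdaptedBasis.
Context {k : finFieldType} {L : fieldType} (iota : {rmorphism ratfun k -> L}).
Hypothesis Lsep : separable_closure iota.
Context (g1 g2 : {poly k}).
Local Notation q := #|k|.
Local Notation phi := (drinfeld2 g1 g2).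
Local Notation kL := (constL iota).
Local Notation aL := (polyL iota).
Local Notation tf := (@FracField.tofrac {poly k}).
Context (e : 'I_2 -> tate iota phi) (eB : tate_basis e).
Local Notation rhoM := (rho_mx eB).
Local Notation nu1 := (e 0 1%N).
Local Notation nu2 := (e 0 2%N).
Local Notation mu := (e 1 1%N).
Local Notation lam := (e 1 2%N).
Context (a2 : k) (O : L -> Prop).
Local Notation pi := (polyL iota ('X - a2%:P)).
Hypotheses (plO : place iota a2 O) (q_odd : odd q) (g20 : g2.[0] != 0).
Hypothesis int_nu : forall p : {poly ratfun k}, (map_poly iota p).[nu2] != 0 ->
  intval O pi (map_poly iota p).[nu2].
Hypotheses (Umu : vunit O (mu^-1 ^+ (q ^ 2 - q) / pi))
  (Ulam : vunit O (lam^-1 ^+ (q * (q ^ 2 - q)) / pi)).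
Hypothesis no_line : forall b, tf 'X + tf g1 * b + tf g2 * b ^+ q.+1 <> 0.
Context (a0 : k).
Hypotheses (a0_neq0 : a0 != 0) (a0_neq1 : a0 != 1).

Let q_gt1 : (1 < q)%N. Proof. exact: finNzRing_gt1. Qed.

Let fix_nu1 (s : galaut iota) : s nu2 = nu2 -> s nu1 = nu1.
Proof. by move=> snu; rewrite -(tate_phiT (e 0) 1) gal_phiT snu. Qed.

Let S := finset (fun p : k * k => `[< exists2 s : galaut iota, s nu2 = nu2 &
  s mu = kL p.1 * nu1 + kL p.2 * mu >]).

Let cardN0 : #|finset (fun p : k * k => p.2 != 0)| = (q ^ 2 - q)%N.
Proof.
have -> : finset (fun p : k * k => p.2 != 0) = setX [set: k] [set~ 0].
  by apply/setP => -[a b]; rewrite !inE.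
by rewrite cardsX cardsT cardsC1 -mulnn -subn1 mulnBr muln1.
Qed.

Let S_sub : S \subset finset (fun p : k * k => p.2 != 0).
Proof.
apply/subsetP => -[b a]; rewrite !inE => /asboolP[s snu /= smu]; apply/eqP => a0'.
have : mu = kL b * nu1.
  apply: (fmorph_inj (galmap s)); rewrite smu a0' rmorph0 mul0r addr0 rmorphM.
  by rewrite gal_const fix_nu1.
move=> muE; have [|/eqP] := @level1_inj _ _ _ _ _ _ eB 0 1 b 0.
  by rewrite rmorph0 rmorph1 !mul0r add0r mul1r addr0.
by move=> _ /eqP; rewrite oner_eq0.
Qed.

Lemma stab_orbit (s : galaut iota) : s nu2 = nu2 ->
  (ps_ev (rhoM s 0 1), ps_ev (rhoM s 1 1)) \in S.
Proof. by move=> snu; rewrite inE; apply/asboolP; exists s => //; apply: rho_level1. Qed.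

(** The inverse of mu has valuation 1/(q^2-q) over the unramified field F(nu2), so S has at least
    q^2 - q elements, as many as the pairs allowed by injectivity of s. *)
Lemma orbit_mu : S = finset (fun p : k * k => p.2 != 0).
Proof.
apply/eqP; rewrite eqEcard S_sub cardN0 cardE.
rewrite -(size_map (fun p => (kL p.1 * nu1 + kL p.2 * mu)^-1)).
apply: (orbit_size Lsep plO int_nu Umu) => s snu; apply/mapP.
exists (ps_ev (rhoM s 0 1), ps_ev (rhoM s 1 1)); first by rewrite mem_enum stab_orbit.
by rewrite fmorphV /= rho_level1.
Qed.

Lemma stab_col0 (s : galaut iota) : s nu2 = nu2 ->
  ps_ev (rhoM s 0 0) = 1 /\ ps_ev (rhoM s 1 0) = 0.
Proof.
move=> /fix_nu1; rewrite (rho_level1 eB) => E; apply: (level1_inj eB).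
by rewrite E rmorph1 rmorph0 mul1r mul0r addr0.
Qed.

Lemma image_borel (a b : k) : a != 0 ->
  exists2 h, (exists s, rhoM s = h) & map_mx (@ps_ev k) h = mx2 1 b 0 a.
Proof.
move=> an0; have : (b, a) \in S by rewrite orbit_mu inE.
rewrite inE => /asboolP[s snu /= smu]; exists (rhoM s); first by exists s.
have [c00 c10] := stab_col0 snu.
rewrite [rhoM s]mx2_eta map_mx2; move: smu; rewrite (rho_level1 eB) => /(level1_inj eB)[c01 c11].
by congr mx2.
Qed.

(** If the line k nu1 were stable, nu1^(q-1) would be Galois invariant, since (q-1)-th powers of
    nonzero constants are 1. It would then be an element b of F excluded by [no_line]. *)
Lemma image_move : exists2 h, (exists s, rhoM s = h) & ps_ev (h 1 0) != 0.
Proof.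
apply: contrapT => no; have line (s : galaut iota) : exists c, s nu1 = kL c * nu1.
  exists (ps_ev (rhoM s 0 0)); rewrite {1}(rho_level1 eB).
  suff -> : ps_ev (rhoM s 1 0) = 0 by rewrite rmorph0 mul0r addr0.
  apply/eqP; apply: contrapT => /negP c0; apply: no.
  by exists (rhoM s) => //; exists s.
have n0 : nu1 != 0.
  apply/eqP => n0; have [|/eqP] := @level1_free _ _ _ _ _ _ eB 1 0.
    by rewrite n0 mulr0 rmorph0 mul0r addr0.
  by rewrite oner_eq0.
have [|f fE] := @galois_fixed _ _ _ Lsep 0 (nu1 ^+ q.-1).
  move=> s _; have [c cE] := line s; rewrite rmorphXn cE exprMn -rmorphXn.
  have c0 : c != 0.
    apply/eqP => c0; move: cE; rewrite c0 rmorph0 mul0r => /eqP.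
    by rewrite fmorph_eq0 (negPf n0).
  have -> : c ^+ q.-1 = 1.
    by apply: (mulIf c0); rewrite -exprSr prednK ?expf_card ?mul1r // ltnW.
  by rewrite rmorph1 mul1r.
rewrite iota_horner0 in fE; apply: (@no_line f.[0]); apply: (fmorph_inj iota).
apply: (mulIf n0); rewrite rmorph0 mul0r -[RHS](tate0n (e 0)) -[RHS]tate_phiT.
rewrite /phiT !rmorphD !rmorphM rmorphXn -fE !mulrDl -[aL 'X]/(iota (tf 'X)).
congr (_ + _ + _); rewrite -mulrA; congr (_ * _); rewrite -?exprM -exprSr.
  by rewrite prednK // ltnW.
by congr (_ ^+ _); rewrite -mulnn; move: q_gt1; case: (q) => // n _ /=; lia.
Qed.

(** An s that fixes nu2 and mu but moves lam is 1 + tX, where the first column of X vanishes modulo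
    t and the second does not. Without such s, the orbit of lam would be no larger than that of mu,
    against its extra ramification q. *)
Lemma image_nonscalar : exists h X, [/\ exists s, rhoM s = h, h = 1%:M + @ps_t k *: X &
  exists b d : k, map_mx (@ps_ev k) X = mx2 0 b 0 d /\ (b != 0) || (d != 0)].
Proof.
have [s [snu smu slam]] : exists s : galaut iota, [/\ s nu2 = nu2, s mu = mu & s lam != lam].
  apply: contrapT => no.
  have det_lam (s t : galaut iota) : s nu2 = nu2 -> t nu2 = nu2 -> s mu = t mu -> s lam = t lam.
    move=> snu tnu st; have [t' [tK t'K]] := galaut_inv Lsep t.
    have [u uE] := galaut_comp t' s.
    have : u lam = lam.
      apply: contrapT => ulam; apply: no; exists u; split; last exact/eqP.
        by rewrite uE /= snu -{1}tnu tK.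
      by rewrite uE /= st tK.
    by rewrite uE /= => E; rewrite -{2}E t'K.
  (* The value of s at lam as a function of its value at mu, with 0 as junk outside S. *)
  have Sx p : exists x, p \in S -> exists s : galaut iota,
      [/\ s nu2 = nu2, s mu = kL p.1 * nu1 + kL p.2 * mu & x = s lam].
    have [|pS] := boolP (p \in S); last by exists 0.
    by rewrite inE => /asboolP[s snu smu]; exists (s lam) => _; exists s.
  have [f fE] := choice Sx.
  have : (q * (q ^ 2 - q) <= size [seq (f p)^-1 | p <- enum S])%N.
    apply: (orbit_size Lsep plO int_nu Ulam) => s snu; apply/mapP.
    have sS := stab_orbit snu; exists (ps_ev (rhoM s 0 1), ps_ev (rhoM s 1 1)).
      by rewrite mem_enum.
    have [t [tnu tmu ->]] := fE _ sS; rewrite fmorphV (det_lam s t) //.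
    by rewrite tmu (rho_level1 eB).
  rewrite size_map -cardE orbit_mu cardN0 leqNgt ltn_Pmull //.
  by rewrite subn_gt0 -{1}(expn1 q) ltn_exp2l.
have [c00 c10] := stab_col0 snu.
have [c01 c11] : ps_ev (rhoM s 0 1) = 0 /\ ps_ev (rhoM s 1 1) = 1.
  apply: (level1_inj eB); rewrite -(rho_level1 eB) smu.
  by rewrite rmorph1 rmorph0 mul1r mul0r add0r.
have [X hE] : cong (@ps_t k) 1 (rhoM s) 1%:M.
  apply: (map_ev_cong (@ps_ev_eq0 k)); rewrite map_mx1 mx2_1 [rhoM s]mx2_eta map_mx2.
  by congr mx2.
rewrite expr1 in hE; exists (rhoM s), X; split=> //; first by exists s.
have coef0 i j : rhoM s i j 0%N = (i == j)%:R.
  rewrite hE !mxE psD ps_tM0 addr0; by case: eqP.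
have coef1 i j : rhoM s i j 1%N = ps_ev (X i j).
  rewrite hE !mxE psD ps_tMS; suff -> : ((i == j)%:R : powser k) 1%N = 0 by rewrite add0r.
  by case: eqP.
have lvl j : s (e j 2%N) = e j 2%N + (kL (ps_ev (X 0 j)) * nu1 + kL (ps_ev (X 1 j)) * mu).
  rewrite (rho_level2 eB) !coef1 !coef0.
  by case: (ord2P j) => ->; rewrite /= !rmorph1 !rmorph0 !mul1r !mul0r; ring.
exists (ps_ev (X 0 1)), (ps_ev (X 1 1)); split.
  have [|x00 x10] := @level1_free _ _ _ _ _ _ eB (ps_ev (X 0 0)) (ps_ev (X 1 0)).
    by apply: (addrI nu2); rewrite -lvl snu addr0.
  by rewrite [X]mx2_eta map_mx2 !mx2E x00 x10.
apply: contraR slam; rewrite negb_or !negbK => /andP[/eqP b0 /eqP d0].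
by rewrite lvl b0 d0 rmorph0 !mul0r !addr0.
Qed.

Theorem adapted_surjective M : M \in unitmx -> exists s, rhoM s = M.
Proof.
apply: (rho_closed Lsep) => n; apply: (@subgroup_full _ _ (@ps_ev k) (@ps_const k) ps_t).
- exact: ps_constK.
- exact: ps_ev_t.
- exact: ps_ev_eq0.
- exact: ps_ev_unit.
- exact: ps_t_reg.
- exact: rho_image1.
- exact: rho_imageM.
- exact: (rho_imageV Lsep).
- exact: rho_imageU.
- exact: (det_dense Lsep).
- apply: (@level1_full _ _ (@ps_ev k) ps_t) => //.
  + exact: ps_ev_eq0.
  + exact: rho_imageM.
  + exact: rho_imageU.
  + exact: image_borel.
  + exact: image_move.
- exact: image_nonscalar.
- exact: a0_neq0.
- exact: a0_neq1.
Qed.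

End AdaptedBasis.

(** * Change of basis of the Tate module *)

Section ChangeOfBasis.
Context {k : finFieldType} {L : fieldType} (iota : {rmorphism ratfun k -> L}).
Context (g1 g2 : {poly k}).
Local Notation phi := (drinfeld2 g1 g2).
Context (e e' : 'I_2 -> tate iota phi) (eB : tate_basis e).

Let P : 'M[powser k]_2 := \matrix_(i, j) tate_coord eB (e' j) i 0.

Let e'E j : e' j = \sum_i P i j *: e i.
Proof. by rewrite {1}[e' j](tate_coordE eB); apply: eq_bigr => i _; rewrite mxE. Qed.

Let combE (c : 'cV[powser k]_2) :
  \sum_j c j 0 *: e' j = \sum_i (P *m c) i 0 *: e i.
Proof.
under eq_bigr => j _ do rewrite e'E scaler_sumr.
rewrite exchange_big; apply: eq_bigr => i _; rewrite mxE scaler_suml.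
by apply: eq_bigr => j _; rewrite scalerA mulrC.
Qed.

(** At level 1 the pairing multiplies by det P modulo t, so a nonzero Moore determinant makes det P
    a unit. *)
Lemma new_basis_moore : odd #|k| ->
  @moore k L (e' 0 1%N) (e' 1 1%N) != 0 -> P \in unitmx.
Proof.
move=> q_odd m0; rewrite unitmxE; apply: ps_ev_unit; apply: contraNneq m0 => d0.
rewrite -weil1 !e'E weil_det // weilZl big_ord1 [_ (_ : powser k) _]d0.
by rewrite rmorph0 mul0r.
Qed.

Hypothesis uP : P \in unitmx.

Lemma new_basis : tate_basis e'.
Proof.
move=> x; exists (invmx P *m tate_coord eB x); split.
  by rewrite combE mulKVmx // -tate_coordE.
by move=> c; rewrite combE => /(tate_coord_uniq eB) ->; rewrite mulKmx.
Qed.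

(** The two matrix representations are conjugate by P. *)
Lemma change_basis_surj (e'B : tate_basis e') :
  (forall M, M \in unitmx -> exists s, rho_mx e'B s = M) ->
  forall M, M \in unitmx -> exists s, rho_mx eB s = M.
Proof.
move=> surj M uM; have [|s sE] := surj (invmx P *m M *m P).
  by rewrite !unitmx_mul unitmx_inv uP uM.
exists s; suff : rho_mx eB s *m P = M *m P.
  by move=> /(congr1 (fun Q => Q *m invmx P)); rewrite !mulmxK.
apply/matrixP => i j.
have -> : (rho_mx eB s *m P) i j = (rho_mx eB s *m tate_coord eB (e' j)) i 0.
  by rewrite !mxE; apply: eq_bigr => l _; rewrite !mxE.
rewrite -rho_mx_coord (rho_mxE e'B) sE.
have -> : \sum_i (invmx P *m M *m P) i j *: e' i =
    \sum_i (col j (invmx P *m M *m P)) i 0 *: e' i.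
  by apply: eq_bigr => l _; rewrite !mxE.
rewrite combE (tate_coord_uniq eB (c := P *m col j (invmx P *m M *m P))) //.
by rewrite colE !mulmxA mulmxV // mul1mx -colE mxE.
Qed.

End ChangeOfBasis.

(** * Absence of a stable line at T - a1, and conclusion *)

Lemma homogenize (K : fieldType) (x u v n d : K) m : d != 0 ->
  d ^+ m.+1 * (x + u * (n / d) + v * (n / d) ^+ m.+1) =
  x * d ^+ m.+1 + u * n * d ^+ m + v * n ^+ m.+1.
Proof.
move=> d0; rewrite expr_div_n exprS; have : d ^+ m != 0 by rewrite expf_neq0.
by move: (d ^+ m) (n ^+ m.+1) => D N D0; field; rewrite d0 D0.
Qed.

(** Infinite descent at T = a1 for b = n / d. There g1 vanishes and q-th powers are trivial on k, so
    n(a1)^2 = eta d(a1)^2; as eta is not a square, T - a1 divides both n and d. *)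
Lemma no_rational_line (k : finFieldType) (eta a1 : k) (g1 g2 : {poly k}) :
  (forall z : k, z ^+ 2 <> eta) -> eta != 0 -> a1 != 0 ->
  g1.[a1] = 0 -> g2.[a1] = - a1 / eta ->
  forall b : ratfun k,
    @FracField.tofrac _ 'X + @FracField.tofrac _ g1 * b
      + @FracField.tofrac _ g2 * b ^+ #|k|.+1 <> 0.
Proof.
move=> nsq eta0 a10 g1a g2a b.
have descent N (n d : {poly k}) : (size d <= N)%N -> d != 0 ->
    'X * d ^+ #|k|.+1 + g1 * n * d ^+ #|k| + g2 * n ^+ #|k|.+1 <> 0.
  elim: N n d => [|N IHN] n d; first by rewrite leqn0 size_poly_eq0 => ->.
  move=> szd d0 E; have := congr1 (horner^~ a1) E; rewrite !hornerE g1a !mul0r addr0 g2a.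
  rewrite !exprS !expf_card -!expr2 => E1.
  have sq : n.[a1] ^+ 2 = eta * d.[a1] ^+ 2.
    apply: (mulfI a10); rewrite [RHS]mulrCA.
    have -> : a1 * d.[a1] ^+ 2 = a1 / eta * n.[a1] ^+ 2.
      by apply/eqP; rewrite -subr_eq0 -[X in _ == X]E1; apply/eqP; ring.
    by field.
  have da : d.[a1] = 0.
    apply/eqP; apply: contrapT => /negP da; apply: (nsq (n.[a1] / d.[a1])).
    by rewrite expr_div_n sq mulfK // expf_neq0.
  have na : n.[a1] = 0.
    by move/eqP: sq; rewrite da expr0n mulr0 expf_eq0 => /eqP.
  have /factor_theorem[d' dE] : root d a1 by apply/eqP.
  have /factor_theorem[n' nE] : root n a1 by apply/eqP.
  have d'0 : d' != 0 by apply: contraNneq d0 => d'0; rewrite dE d'0 mul0r.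
  apply: (IHN n' d') => //.
    by move: szd; rewrite dE size_Mmonic ?monicXsubC // size_XsubC addn2.
  have X0 : ('X - a1%:P) ^+ #|k|.+1 != 0 by rewrite expf_neq0 ?polyXsubC_eq0.
  apply: (mulIf X0); rewrite mul0r -[RHS]E dE nE !exprMn !exprS.
  by move: ('X - a1%:P) => Y; ring.
have [n [d [d0 ->]]] := fraction_numden b => E; apply: (descent _ n d (leqnn _) d0).
apply/eqP; rewrite -(tofrac_eq0); apply/eqP.
have td0 : @FracField.tofrac _ d != 0 by rewrite tofrac_eq0.
rewrite !rmorphD !rmorphM !rmorphXn.
transitivity (@FracField.tofrac _ d ^+ #|k|.+1 * 0); last exact: mulr0.
by rewrite -E homogenize.
Qed.

Theorem theorem3p1
  (k : finFieldType) (q_ge5 : (5 <= #|k|)%N) (q_odd : odd #|k|)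
  (eta a1 a2 : k)
  (eta_neq0 : eta != 0) (eta_nonsquare : forall z : k, z ^+ 2 <> eta)
  (a1_neq0 : a1 != 0) (a2_neq0 : a2 != 0) (a1_neq_a2 : a1 != a2)
  (g1 g2 : {poly k}) (g2_neq0 : g2 != 0)
  (h1 : 'X - a1%:P %| g1)
  (h2 : coprimep g1 ('X * ('X - a2%:P)))
  (h3 : ('X - a2%:P %| g2) && ~~ (('X - a2%:P) ^+ 2 %| g2))
  (h4 : g2 %% ('X - a1%:P) = (- a1 * eta^-1)%:P %% ('X - a1%:P))
  (h5 : coprimep g2 'X)
  (Fsep : fieldType) (iota : {rmorphism ratfun k -> Fsep})
  (Fsep_closure : separable_closure iota)
  (e : 'I_2 -> tate iota (drinfeld2 g1 g2)) (e_basis : tate_basis e) :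
  forall M : GL 2 (powser k), exists s : galaut iota, rho e_basis s = M.
Proof.
have g1a1 : g1.[a1] = 0 by apply/eqP; rewrite -[_ == 0]/(root g1 a1) -dvdp_XsubCl.
have g1a2 : g1.[a2] != 0.
  by move: h2; rewrite coprimepMr => /andP[_]; rewrite coprimep_XsubC.
have /andP[/dvdpP[f g2E] nsq] := h3; rewrite mulrC in g2E.
have fa2 : f.[a2] != 0.
  apply: contra nsq => fa2; rewrite g2E expr2 dvdp_mul2l ?polyXsubC_eq0 //.
  by rewrite dvdp_XsubCl.
have g20 : g2.[0] != 0.
  by move: h5; rewrite -['X]subr0 -polyC0 coprimep_XsubC.
have g2a1 : g2.[a1] = - a1 / eta.
  by move: h4; rewrite !modp_XsubC hornerC => /polyC_inj.
have [O plO] := place_exists iota a2.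
have [nu1 [nu2 [mu [lam [[n0 pnu1 pnu2 On1 On2] [pmu plam Omu Umu Ulam]]]]]] :=
  bad_place_points Fsep_closure a2_neq0 g1a2 g2E fa2 plO e_basis.
have tors x : phiT iota g1 g2 (phiT iota g1 g2 x) = 0 ->
    drinfeld_act iota (drinfeld2 g1 g2) 'X^2 x = 0.
  by move=> xE; rewrite expr2 drinfeld_actM !actX.
have [|x xE] := tate_lift Fsep_closure (n := 2) (tors nu2 _); first by rewrite pnu2.
have [|y yE] := tate_lift Fsep_closure (n := 2) (tors lam _); first by rewrite plam.
have x1 : x 1%N = nu1 by rewrite -tate_phiT xE.
have y1 : y 1%N = mu by rewrite -tate_phiT yE.
(* The adapted basis lifts nu2 and lam; at level 1 it is independent because nu1 is integral and mu
   is not. *)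
pose e' (i : 'I_2) := if i == 0 then x else y.
have m0 : @moore k Fsep (e' 0 1%N) (e' 1 1%N) != 0.
  rewrite /e' /= x1 y1; apply/eqP => /(moore_eq0 iota n0)[c muE]; apply: Omu.
  rewrite muE; apply: (subringM (place_subring plO)) => //; exact: (place_poly plO).
have uP := new_basis_moore e_basis q_odd m0.
have e'B := new_basis uP.
have surj : forall M, M \in unitmx -> exists s, rho_mx e_basis s = M.
  apply: (change_basis_surj uP (e'B := e'B)).
  (* The scalar a1 / a2 serves as an element of k other than 0 and 1. *)
  apply: (@adapted_surjective _ _ _ Fsep_closure _ _ _ e'B a2 O plO q_odd g20 _ _ _ _ (a1 / a2)).
  - rewrite /e' /= xE; apply: (@unramified_field _ _ _ Fsep_closure g1 g2 a2 O a2_neq0 plO nu2) => //.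
    by rewrite pnu2.
  - by rewrite /e' /= y1.
  - by rewrite /e' /= yE.
  - exact: (no_rational_line eta_nonsquare eta_neq0 a1_neq0 g1a1 g2a1).
  - by rewrite mulf_neq0 ?invr_eq0.
  - apply: contra a1_neq_a2 => /eqP E; apply/eqP.
    by rewrite -[a1](divfK a2_neq0) E mul1r.
move=> [M uM]; have [s sE] := surj M uM; exists s; exact: val_inj.
Qed.
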